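(* Let $S\subset\mathbb N_0$ be nonempty, let $\theta\in(0,1)$, and let $X_S$ be the one-sided $S$-gap shift with left shift $\sigma$. Let $\phi\in C^\theta(X_S)$ be a renewal-type potential with induced one-symbol potential $\psi:S\to\mathbb R$. Let $P$ be the unique real solution of $$\sum_{n\in S}e^{\psi(n)-P(n+1)}=1 .$$ If $S$ is finite, assume $P>\phi(0^\infty)$; if $S$ is infinite, no additional assumption is made. Then $$P=P_{\mathrm{top}}(X_S,\sigma,\phi),$$ and $\phi$ has a unique equilibrium state $\mu_\phi$ on $X_S$. Moreover, there exists a constant $C>0$, depending only on $S,\phi$ and $\theta$, such that for every $\sigma$-invariant Borel probability measure $\mu$ on $X_S$ and every $f\in C^\theta(X_S)$, $$\left|\int f\,d\mu-\int f\,d\mu_\phi\right|\le C\,\|f\|_\theta\,\sqrt{P-\left(h_\mu(\sigma)+\int\phi\,d\mu\right)} .$$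
   Context: $\mathbb N_0=\{0,1,2,\dots\}$. For nonempty $S\subset\mathbb N_0$, the one-sided $S$-gap shift $X_S\subset\{0,1\}^{\mathbb N_0}$ is the set of all $x=(x_k)_{k\ge0}$ such that whenever two consecutive (i.e. successive) symbols $1$ occur in $x$, the number of zeros between them belongs to $S$; it contains $0^\infty=000\cdots$, and $\sigma$ is the left shift. For $\theta\in(0,1)$ put $d_\theta(x,y)=\theta^{t(x,y)}$, $t(x,y)=\min\{k\ge0:x_k\ne y_k\}$, $d_\theta(x,x)=0$. $C^\theta(X_S)$ is the space of bounded real functions with $\|f\|_\theta=\|f\|_\infty+|f|_\theta<\infty$, where $|f|_\theta=\sup_{x\ne y}|f(x)-f(y)|/d_\theta(x,y)$. Let $Y_S=S^{\mathbb N_0}$, $\pi(y)=10^{y_0}10^{y_1}10^{y_2}\cdots\in X_S$ and $\tau(y)=y_0+1$ for $y\in Y_S$. A potential $\phi\in C^\theta(X_S)$ is renewal-type, with induced one-symbol potential $\psi:S\to\mathbb R$, if $\sum_{j=0}^{\tau(y)-1}\phi(\sigma^j\pi(y))=\psi(y_0)$ for all $y\in Y_S$. For such $\phi$, the equation in the claim has exactly one real solution $P$. $h_\mu(\sigma)$ is the measure-theoretic entropy. $P_{\mathrm{top}}(X_S,\sigma,\phi)$ is the topological pressure, equal by the variational principle to $\sup\{h_\mu(\sigma)+\int\phi\,d\mu:\mu\ \sigma\text{-invariant Borel probability on }X_S\}$; an equilibrium state is an invariant measure attaining this supremum. *)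

(* Defs.v *)
From HB Require Import structures.
From mathcomp Require Import all_boot all_order all_algebra.
From mathcomp Require Import all_classical all_reals all_analysis.

Set Implicit Arguments.
Unset Strict Implicit.
Unset Printing Implicit Defensive.

Import Order.TTheory GRing.Theory Num.Theory.
Import numFieldNormedType.Exports.

Local Open Scope classical_set_scope.
Local Open Scope ring_scope.

Section entropy.
Context {d : measure_display} {T : measurableType d} {R : realType}.
Variables (mu : set T -> \bar R) (f : T -> T).

(* Cells are allowed to be empty; they contribute nothing to the entropy. *)
Definition measurable_partition (k : nat) (xi : 'I_k -> set T) : Prop :=
  [/\ forall i, measurable (xi i),
      trivIset [set: 'I_k] xi
    & \bigcup_i xi i = [set: T]].

Definition join_cell (k : nat) (xi : 'I_k -> set T) (n : nat)
    (w : {ffun 'I_n -> 'I_k}) : set T :=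
  [set x | forall i : 'I_n, xi (w i) (iter i f x)].

(* Shannon entropy of the n-th join; [ln 0 = 0], so [0 * ln 0 = 0]. *)
Definition join_entropy (k : nat) (xi : 'I_k -> set T) (n : nat) : R :=
  - \sum_(w : {ffun 'I_n -> 'I_k})
      fine (mu (join_cell xi w)) * ln (fine (mu (join_cell xi w))).

(* For an [f]-invariant probability [mu] the sequence [join_entropy xi] is
   subadditive, so this upper limit is a limit. *)
Definition partition_entropy (k : nat) (xi : 'I_k -> set T) : \bar R :=
  limn_esup (fun n : nat => (join_entropy xi n / n%:R)%:E).

Definition entropy : \bar R :=
  ereal_sup [set h | exists (k : nat) (xi : 'I_k -> set T),
    measurable_partition xi /\ h = partition_entropy xi].

Definition invariant_measure : Prop :=
  forall A : set T, measurable A -> mu (f @^-1` A) = mu A.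

End entropy.

Section pressure.
Context {R : realType} {X : choiceType}.
Variables (dist : X -> X -> R) (f : X -> X) (phi : X -> R).

Definition birkhoff_sum (n : nat) (x : X) : R :=
  \sum_(j < n) phi (iter j f x).

Definition bowen_separated (n : nat) (e : R) (E : set X) : Prop :=
  forall x y, E x -> E y -> x <> y ->
    exists i : 'I_n, e < dist (iter i f x) (iter i f y).

(* On a compact space the separated sets of a continuous map are finite. *)
Definition separated_sum (n : nat) (e : R) : \bar R :=
  ereal_sup [set (\sum_(x \in E) expR (birkhoff_sum n x))%:E
            | E in [set E | finite_set E /\ bowen_separated n e E]].

Definition separated_pressure (e : R) : \bar R :=
  limn_esup (fun n : nat => ((n%:R^-1)%:E * lne (separated_sum n e))%E).

Definition topological_pressure : \bar R :=
  lim (separated_pressure e @[e --> 0^'+]).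

End pressure.

Definition gap_set (S : set nat) : set cantor_space :=
  [set x | forall i j : nat, (i < j)%N -> x i = true -> x j = true ->
     (forall k : nat, (i < k < j)%N -> x k = false) -> S (j - i).-1].

Definition gap_shift (S : set nat) : Type := gap_set S.

(* The subspace topology from the product topology of [{0,1}^N], which is also
   the topology of every [dtheta theta] below, for [0 < theta < 1]. *)
HB.instance Definition _ (S : set nat) :=
  Topological.copy (gap_shift S) (set_type (gap_set S)).

Definition gap_seq (S : set nat) (x : gap_shift S) : nat -> bool := set_val x.

Lemma zero_inf_subproof (S : set nat) : gap_set S (fun=> false).
Proof. by []. Qed.

Definition zero_inf (S : set nat) : gap_shift S :=
  SigSub (mem_set (@zero_inf_subproof S)).

HB.instance Definition _ (S : set nat) :=
  isPointed.Build (gap_shift S) (zero_inf S).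

Lemma gap_sigma_subproof (S : set nat) (x : gap_shift S) :
  gap_set S (fun k => gap_seq x k.+1).
Proof.
have xS : gap_set S (gap_seq x) by exact: set_valP.
move=> i j ij xi xj nox; rewrite -subSS.
by apply: (xS i.+1 j.+1) => // -[//|k]; exact: nox.
Qed.

Definition gap_sigma (S : set nat) (x : gap_shift S) : gap_shift S :=
  SigSub (mem_set (@gap_sigma_subproof S x)).

Definition borel_gap_shift (S : set nat) :=
  g_sigma_algebraType (@open (gap_shift S)).

HB.instance Definition _ (S : set nat) := Measurable.on (borel_gap_shift S).

Section holder.
Context {R : realType} {S : set nat}.
Variable theta : R.

Definition dtheta (x y : gap_shift S) : R :=
  match pselect (exists k, gap_seq x k != gap_seq y k) with
  | left neq_xy => theta ^+ ex_minn neq_xy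
  | right _ => 0
  end.

Definition sup_norm (f : gap_shift S -> R) : \bar R :=
  ereal_sup [set `|f x|%:E | x in [set: gap_shift S]].

Definition holder_seminorm (f : gap_shift S -> R) : \bar R :=
  ereal_sup [set (`|f p.1 - f p.2| / dtheta p.1 p.2)%:E
            | p in [set p : gap_shift S * gap_shift S | p.1 <> p.2]].

Definition holder_norm (f : gap_shift S -> R) : \bar R :=
  (sup_norm f + holder_seminorm f)%E.

Definition Ctheta : set (gap_shift S -> R) :=
  [set f | (holder_norm f < +oo)%E].

End holder.

(* The position of the m-th symbol 1 in 1 0^(y_0) 1 0^(y_1) 1 ... *)
Definition one_position (y : nat -> nat) (m : nat) : nat :=
  (\sum_(i < m) (y i).+1)%N.

Lemma one_positionS y m :
  one_position y m.+1 = (one_position y m + (y m).+1)%N.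
Proof. by rewrite /one_position big_ord_recr. Qed.

Lemma leq_one_position y : {homo one_position y : m n / (m <= n)%N}.
Proof.
by apply: homo_leq => // [|m]; [exact: leq_trans|rewrite one_positionS leq_addr].
Qed.

Definition coding_seq (y : nat -> nat) : nat -> bool :=
  fun k => `[< exists m, k = one_position y m >].

Lemma coding_subproof (S : set nat) (y : nat -> S) :
  gap_set S (coding_seq (fun i => set_val (y i))).
Proof.
set z := fun i => _; move=> i j ij /asboolP[a ia] /asboolP[b jb] nox.
have ab : (a < b)%N.
  rewrite ltnNge; apply/negP => /(leq_one_position z).
  by rewrite -ia -jb leqNgt ij.
have aj : (one_position z a.+1 <= j)%N by rewrite jb; exact: leq_one_position.
have ja : j = one_position z a.+1.
  apply/eqP; rewrite eqn_leq aj andbT leqNgt; apply/negP => lt_aj.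
  have /nox : (i < one_position z a.+1 < j)%N.
    by rewrite lt_aj andbT one_positionS -ia addnS ltnS leq_addr.
  by move/asboolPn; apply; exists a.+1.
by rewrite ja ia one_positionS addKn /z; exact: set_valP.
Qed.

Definition coding (S : set nat) (y : nat -> S) : gap_shift S :=
  SigSub (mem_set (@coding_subproof S y)).

Definition return_time (S : set nat) (y : nat -> S) : nat := (set_val (y 0%N)).+1.

Definition renewal_type {R : realType} {S : set nat} (theta : R)
    (phi : gap_shift S -> R) (psi : S -> R) : Prop :=
  Ctheta theta phi /\
  forall y : nat -> S,
    birkhoff_sum (@gap_sigma S) phi (return_time y) (coding y) = psi (y 0%N).

Section equilibrium.
Context {R : realType} {S : set nat}.

Definition free_energy (phi : gap_shift S -> R)
    (mu : probability (borel_gap_shift S) R) : \bar R :=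
  (entropy mu (@gap_sigma S) + (\int[mu]_x phi x)%:E)%E.

Definition equilibrium_state (phi : gap_shift S -> R)
    (mu : probability (borel_gap_shift S) R) : Prop :=
  invariant_measure mu (@gap_sigma S) /\
  free_energy phi mu =
    ereal_sup [set free_energy phi nu
              | nu in [set nu : probability (borel_gap_shift S) R
                      | invariant_measure nu (@gap_sigma S)]].

End equilibrium.

(* Main.v *)
Require Import Defs.
From HB Require Import structures.
From mathcomp Require Import all_boot all_order all_algebra.
From mathcomp Require Import all_classical all_reals all_analysis.
From mathcomp Require Import measurable_realfun.
From mathcomp Require Import ring lra zify.

Set Implicit Arguments.
Unset Strict Implicit.
Unset Printing Implicit Defensive.

Import Order.TTheory GRing.Theory Num.Theory.
Import numFieldNormedType.Exports.

Local Open Scope classical_set_scope.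
Local Open Scope ring_scope.

(** The measure of maximal free energy is a stationary renewal process, and
everything rests on sums over words.  Let [p a = expR (psi a - P * (a + 1))], a
probability on the gaps.  The block sums of [phi] over [1 0^a] equal [psi a]
behind coded sequences; in general they are bounded by it from both sides up to
bounded coboundaries ([correction_step]).  Since the sums of [phi] over a long run of zeros are
close to multiples of [phi 0^oo], the hypothesis [phi 0^oo < P], automatic for
infinite [S] ([P_gt_zinf]), gives [p] exponential tails.

Upper bounds.  For a Hoelder function [g], let [Z_n g] be the sum of
[exp (S_n g)] over the words of length [n], each continued with zeros.  For any
invariant measure and any finite partition, Gibbs' inequality against a suitable
law on names shows that the entropy plus the integral of [g] is at most the
growth rate of [Z_n g] ([entropy_le]).  This is used for [g = phi + t f], where
that rate is at most [P + t M + C t^2] up to an arbitrarily small error, with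
[C] uniform over the unit ball of Hoelder functions
([partition_fun_second_order]).  To see this, put one block after the other in
front of a sequence.  A bounded function [U], built from the expectations of
the sums of [f] over the blocks in front, makes the block sums of [f - M] almost
centered with respect to the newest gap; expanding the exponential to second
order leaves only the quadratic term, which is finite by the tails of [p].

Existence.  The stationary renewal process with gap law [p] has explicit
cylinder masses, so it is the image of Lebesgue measure under a coding by
nested intervals ([ex_renewal_measure]).  Its cylinders [w] have mass at most a
constant times [exp (S_n phi - n P)].  Hence its free energy is at least [P]
([entropy_ge]), and by the case [t = 0] it is the maximum [P].  The same
inequality, summed over all words, bounds [Z_n phi] from below, so that [Z_n]
grows exactly at rate [P]; separated sets compare with words, and the
topological pressure is [P] as well.

Stability.  Let [d] be the deficit of an invariant measure [mu].  Adding the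
second-order bound for [mu] at [t] to the one for the equilibrium state at [- t]
cancels [M] and leaves [t * Delta <= d + 2 C t^2], where [Delta] is the
difference of the two integrals of [f].  The choice [t = sqrt d] proves the
estimate ([stability]) when [d] is small, and otherwise [Delta <= 2] suffices.  For [d = 0] it shows that the measures agree on
cylinders, which is uniqueness. *)

(** * Binary sequences, words and admissibility *)

Notation binseq := (nat -> bool).

Definition scons (b : bool) (x : binseq) : binseq :=
  fun k => if k is k'.+1 then x k' else b.

Definition sshift (n : nat) (x : binseq) : binseq := fun k => x (n + k)%N.
Arguments sshift n%_N x.

Definition agree (n : nat) (x y : binseq) := forall k, (k < n)%N -> x k = y k.
Arguments agree n%_N x y.

Definition catw (w : seq bool) (x : binseq) : binseq := foldr scons x w.

Definition zinf : binseq := fun=> false.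

Definition zeros (n : nat) (x : binseq) : binseq := iter n (scons false) x.
Arguments zeros n%_N x.

Definition block (a : nat) (x : binseq) : binseq := scons true (zeros a x).
Arguments block a%_N x.

(** Words are enumerated by their last symbol: put in front of a sequence, a word
    then splits off the symbol next to it, as in an iterated operator. *)
Fixpoint words (n : nat) : seq (seq bool) :=
  if n is m.+1 then
    [seq rcons w false | w <- words m] ++ [seq rcons w true | w <- words m]
  else [:: [::]].
Arguments words n%_N.

Lemma sshift0 x : sshift 0 x = x. Proof. by []. Qed.

Lemma sshiftS n x : sshift n.+1 x = sshift n (sshift 1 x).
Proof. by apply/funext => k; rewrite /sshift addSn add1n. Qed.

Lemma sshiftD m n x : sshift m (sshift n x) = sshift (n + m) x.
Proof. by apply/funext => k; rewrite /sshift addnA. Qed.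

Lemma sshift_scons b x : sshift 1 (scons b x) = x.
Proof. by []. Qed.

Lemma sshiftS_scons n b x : sshift n.+1 (scons b x) = sshift n x.
Proof. by []. Qed.

Lemma zerosS n x : zeros n.+1 x = scons false (zeros n x).
Proof. by []. Qed.

Lemma zerosSr n x : zeros n.+1 x = zeros n (scons false x).
Proof. exact: iterSr. Qed.

Lemma zeros_zinf n : zeros n zinf = zinf.
Proof. by elim: n => [|n IH]; rewrite // zerosS IH; apply/funext => -[]. Qed.

Lemma sshift_zinf n : sshift n zinf = zinf.
Proof. by []. Qed.

Lemma sshift_zeros j n x : (j <= n)%N -> sshift j (zeros n x) = zeros (n - j) x.
Proof.
by elim: j n => [|j IH] [|n] jn //; rewrite sshiftS subSS -IH.
Qed.

Lemma sshift_zerosE n x : sshift n (zeros n x) = x.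
Proof. by rewrite sshift_zeros // subnn. Qed.

Lemma zerosE n x k : zeros n x k = if (k < n)%N then false else x (k - n)%N.
Proof.
by elim: n k => [|n IH] [|k] //; rewrite zerosS /= IH ltnS subSS.
Qed.

Lemma sshift_block a x : sshift a.+1 (block a x) = x.
Proof. by rewrite sshiftS sshift_scons sshift_zerosE. Qed.

Lemma agree_sym n x y : agree n x y -> agree n y x.
Proof. by move=> h k kn; rewrite h. Qed.

Lemma agree_le m n x y : (m <= n)%N -> agree n x y -> agree m x y.
Proof. by move=> mn h k km; apply: h; exact: leq_trans km mn. Qed.

Lemma agree_scons n b x y : agree n x y -> agree n.+1 (scons b x) (scons b y).
Proof. by move=> h [|k] //= kn; exact: h. Qed.

Lemma agree_sshift j n x y : agree n x y -> agree (n - j) (sshift j x) (sshift j y).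
Proof. by move=> h k kn; apply: (h (j + k)%N); rewrite -ltn_subRL. Qed.

Lemma agree_zeros a n x y : agree n x y -> agree (a + n) (zeros a x) (zeros a y).
Proof. by move=> h; elim: a => //= a IH; exact: agree_scons. Qed.

Lemma agree_block a n x y :
  agree n x y -> agree (a.+1 + n) (block a x) (block a y).
Proof. by move=> h; exact/agree_scons/agree_zeros. Qed.

Lemma agree_zeros_zinf n x : agree n (zeros n x) zinf.
Proof. by move=> k kn; rewrite zerosE kn. Qed.

Lemma catw_rcons w b x : catw (rcons w b) x = catw w (scons b x).
Proof. by rewrite /catw foldr_rcons. Qed.

Lemma sshift_catw w x : sshift (size w) (catw w x) = x.
Proof. by elim: w => //= b w IH; rewrite sshiftS_scons. Qed.

Lemma catwE w x k : catw w x k = if (k < size w)%N then nth false w k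
  else x (k - size w)%N.
Proof. by elim: w k => [|b w IH] [|k] //=; rewrite ?subn0 //= IH ltnS subSS. Qed.

Lemma mkseq_catw w x : mkseq (catw w x) (size w) = w.
Proof.
apply: (@eq_from_nth _ false); rewrite size_mkseq // => i iw.
by rewrite nth_mkseq // catwE iw.
Qed.

Lemma agree_mkseq n x y : agree n x y <-> mkseq x n = mkseq y n.
Proof.
split=> h.
  by apply/eq_in_map => k; rewrite mem_iota add0n => /andP[_ kn]; exact: h.
by move=> k kn; have := congr1 (nth false ^~ k) h; rewrite !nth_mkseq.
Qed.

Lemma agree_catw_mkseq n x y : agree n (catw (mkseq x n) y) x.
Proof. by move=> k kn; rewrite catwE size_mkseq kn nth_mkseq. Qed.

Lemma catw_mkseq n x : catw (mkseq x n) (sshift n x) = x.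
Proof.
apply/funext => k; rewrite catwE size_mkseq; case: ltnP => kn.
  by rewrite nth_mkseq.
by rewrite /sshift subnKC.
Qed.

Lemma mkseq_sshift x i m n : (i + m <= n)%N ->
  mkseq (sshift i x) m = take m (drop i (mkseq x n)).
Proof.
move=> imn; apply: (@eq_from_nth _ false).
  by rewrite size_mkseq size_takel // size_drop size_mkseq; lia.
move=> k; rewrite size_mkseq => km; rewrite nth_mkseq // nth_take // nth_drop.
by rewrite nth_mkseq //; apply: leq_trans imn; rewrite ltn_add2l.
Qed.

Lemma mem_words n w : (w \in words n) = (size w == n).
Proof.
elim: n w => [|n IH] w /=; first by rewrite inE; case: w.
rewrite mem_cat; case/lastP: w => [|w b].
  by apply/negbTE/norP; split; apply/mapP => -[[]].
rewrite size_rcons eqSS -IH; have inj c : injective (rcons^~ c : seq bool -> _).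
  by move=> u v /rcons_inj[].
case: b; rewrite (mem_map (inj _)).
  case: (boolP (rcons _ _ \in _)) => // /mapP[v _ /eqP].
  by rewrite eqseq_rcons andbF.
rewrite orbC; case: (boolP (rcons _ _ \in _)) => // /mapP[v _ /eqP].
by rewrite eqseq_rcons andbF.
Qed.

Lemma uniq_words n : uniq (words n).
Proof.
elim: n => //= n IH; have inj c : injective (rcons^~ c : seq bool -> _).
  by move=> u v /rcons_inj[].
rewrite cat_uniq !map_inj_uniq // IH /= andbT; apply/hasPn => _ /mapP[w _ ->].
by apply/mapP => -[v _ /eqP]; rewrite eqseq_rcons andbF.
Qed.

Lemma mkseq_words x n : mkseq x n \in words n.
Proof. by rewrite mem_words size_mkseq. Qed.

Lemma big_words (R : nmodType) n (F : seq bool -> R) :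
  \sum_(w <- words n.+1) F w =
  \sum_(w <- words n) (F (rcons w false) + F (rcons w true)).
Proof. by rewrite /= big_cat /= !big_map big_split. Qed.

Section admissible.
Variable S : set nat.
Local Notation adm := (gap_set S).

Lemma adm_sshift n x : adm x -> adm (sshift n x).
Proof.
move=> xS i j ij xi xj nox; have := xS (n + i)%N (n + j)%N.
rewrite ltn_add2l => /(_ ij xi xj); rewrite subnDl; apply => k /andP[ik kj].
have nk : (n <= k)%N by apply: leq_trans (ltnW ik); exact: leq_addr.
rewrite -(subnKC nk); apply: nox.
by move: ik kj; rewrite -{1 2}(subnKC nk) !ltn_add2l => -> ->.
Qed.

Lemma adm_scons_inv b x : adm (scons b x) -> adm x.
Proof. by move/(@adm_sshift 1). Qed.

Lemma adm_scons0 x : adm x -> adm (scons false x).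
Proof.
move=> xS [|i] [|j] //= ij xi xj nox; rewrite subSS.
by apply: (xS i j) => // k kij; exact: (nox k.+1).
Qed.

Lemma adm_zeros n x : adm x -> adm (zeros n x).
Proof. by move=> xS; elim: n => //= n; exact: adm_scons0. Qed.

Lemma adm_zinf : adm zinf. Proof. by []. Qed.

Lemma adm_scons1 x : adm x ->
  (forall j, x j = true -> (forall k, (k < j)%N -> x k = false) -> S j) ->
  adm (scons true x).
Proof.
move=> xS h [|i] [|j] //= ij xi xj nox; last first.
  by rewrite subSS; apply: (xS i j) => // k kij; exact: (nox k.+1).
by apply: h => // k kj; exact: (nox k.+1).
Qed.

Lemma adm_block a x : adm x -> x 0%N = true -> S a -> adm (block a x).
Proof.
move=> xS x0 Sa; apply: adm_scons1; first exact: adm_zeros.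
move=> j; rewrite zerosE; case: ltnP => // aj _ h.
suff <- : a = j by [].
apply/eqP; rewrite eqn_leq aj /= leqNgt; apply/negP => aj'.
by have := h a aj'; rewrite zerosE ltnn subnn x0.
Qed.

Lemma adm_block_zinf a : adm (block a zinf).
Proof. by apply: adm_scons1; rewrite zeros_zinf. Qed.

Lemma adm_block_inv a x : x 0%N = true -> adm (block a x) -> S a.
Proof.
move=> x0 /(_ 0 a.+1)%N; rewrite subn0 /=; apply => //.
  by rewrite zerosE ltnn subnn.
by move=> [|k] //= /[!ltnS] ka; rewrite zerosE ka.
Qed.

Lemma adm_zeros_inv n x : adm (zeros n x) -> adm x.
Proof. by move/(@adm_sshift n); rewrite sshift_zerosE. Qed.

Lemma adm_block_tail a x : adm (block a x) -> adm x.
Proof. by move/adm_scons_inv/adm_zeros_inv. Qed.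

(** Continuing a prefix with zeros creates no new pair of successive ones. *)
Lemma adm_catw_zinf x n : adm x -> adm (catw (mkseq x n) zinf).
Proof.
move=> xS i j ij; rewrite !catwE size_mkseq.
case: (ltnP j n) => // jn; rewrite (ltn_trans ij jn) => xi xj nox.
move: xi xj; rewrite !nth_mkseq ?(ltn_trans ij jn) // => xi xj.
apply: xS => // k /andP[ik kj]; have := nox k; rewrite ik kj => /(_ isT).
by rewrite catwE size_mkseq (ltn_trans kj jn) nth_mkseq ?(ltn_trans kj jn).
Qed.

Definition to_shift (x : binseq) : gap_shift S :=
  match pselect (adm x) with
  | left xS => SigSub (mem_set xS)
  | right _ => zero_inf S
  end.

Lemma to_shiftK x : adm x -> gap_seq (to_shift x) = x.
Proof. by move=> xS; rewrite /to_shift; case: pselect. Qed.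

Lemma gap_seqP (x : gap_shift S) : adm (gap_seq x).
Proof. exact: set_valP. Qed.

Lemma gap_seq_inj : injective (@gap_seq S).
Proof. by move=> x y; exact: val_inj. Qed.

Lemma gap_seqK (x : gap_shift S) : to_shift (gap_seq x) = x.
Proof. by apply: gap_seq_inj; rewrite to_shiftK //; exact: gap_seqP. Qed.

Lemma gap_seq_sigma (x : gap_shift S) :
  gap_seq (gap_sigma x) = sshift 1 (gap_seq x).
Proof. by []. Qed.

Lemma gap_seq_iter n (x : gap_shift S) :
  gap_seq (iter n (@gap_sigma S) x) = sshift n (gap_seq x).
Proof.
elim: n x => //= n IH x; rewrite gap_seq_sigma IH sshiftD.
by rewrite addn1.
Qed.

End admissible.

Section birkhoff.
Variable R : realType.
Implicit Types g : binseq -> R.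

Definition bsum g (n : nat) (x : binseq) : R := \sum_(j < n) g (sshift j x).
Arguments bsum g n%_N x.

Lemma bsum0 g x : bsum g 0 x = 0. Proof. by rewrite /bsum big_ord0. Qed.

Lemma bsumS g n x : bsum g n.+1 x = g x + bsum g n (sshift 1 x).
Proof.
by rewrite /bsum big_ord_recl; congr (_ + _); apply: eq_bigr => i _; rewrite sshiftS.
Qed.

Lemma bsum1 g x : bsum g 1 x = g x.
Proof. by rewrite bsumS bsum0 addr0. Qed.

Lemma bsumD g m n x : bsum g (m + n) x = bsum g m x + bsum g n (sshift m x).
Proof.
elim: m x => [|m IH] x; first by rewrite bsum0 add0r.
by rewrite addSn !bsumS IH addrA sshiftD add1n.
Qed.

Lemma bsum_add g h n x : bsum (fun y => g y + h y) n x = bsum g n x + bsum h n x.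
Proof. by rewrite /bsum big_split. Qed.

Lemma bsum_scale c g n x : bsum (fun y => c * g y) n x = c * bsum g n x.
Proof. by rewrite /bsum mulr_sumr. Qed.

Lemma bsum_cst c n x : bsum (fun=> c) n x = c * n%:R.
Proof. by rewrite /bsum sumr_const card_ord mulr_natr. Qed.

End birkhoff.

(** * Partition functions over admissible words *)

Section partition_function.
Context (R : realType) (S : set nat).
Local Notation adm := (gap_set S).
Implicit Types (g h : binseq -> R) (x : binseq).

(** The [n]-th iterate of the transfer operator of the weight [expR g], applied
    to the constant function 1. *)
Definition partition_fun g (n : nat) (x : binseq) : R :=
  \sum_(w <- words n | `[< adm (catw w x) >]) expR (bsum g n (catw w x)).
Arguments partition_fun g n%_N x.

Lemma partition_fun_ge0 g n x : 0 <= partition_fun g n x.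
Proof. by apply: sumr_ge0 => w _; exact: expR_ge0. Qed.

Lemma partition_fun0 g x : adm x -> partition_fun g 0 x = 1.
Proof.
by move=> xS; rewrite /partition_fun big_cons big_nil /= asboolT // bsum0 expR0 addr0.
Qed.

Lemma partition_fun_nadm g n x : ~ adm x -> partition_fun g n x = 0.
Proof.
move=> xS; rewrite /partition_fun big_pred0 // => w; apply/asboolPn => /(@adm_sshift _ (size w)).
by rewrite sshift_catw.
Qed.

Lemma partition_funS g n x : partition_fun g n.+1 x =
  expR (g (scons false x)) * partition_fun g n (scons false x) +
  expR (g (scons true x)) * partition_fun g n (scons true x).
Proof.
rewrite /partition_fun big_mkcond big_words big_split /=.
suff step b : \sum_(w <- words n)
    (if `[< adm (catw (rcons w b) x) >]
     then expR (bsum g n.+1 (catw (rcons w b) x)) else 0) =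
    expR (g (scons b x)) *
      \sum_(w <- words n | `[< adm (catw w (scons b x)) >])
         expR (bsum g n (catw w (scons b x))).
  by rewrite !step.
rewrite [in RHS]big_mkcond mulr_sumr big_seq_cond [in RHS]big_seq_cond.
apply: eq_bigr => w; rewrite mem_words andbT => /eqP wn.
rewrite catw_rcons; case: ifP => _; last by rewrite mulr0.
have e : sshift n (catw w (scons b x)) = scons b x by rewrite -wn sshift_catw.
by rewrite -expRD -[in LHS](addn1 n) bsumD e bsum1 addrC.
Qed.

(** Preimages are sorted by the position of the first symbol 1 that is put in
    front of [x]. *)
Lemma partition_fun_unroll g n x : adm x -> partition_fun g n x =
  \sum_(a < n) expR (bsum g a.+1 (block a x)) * partition_fun g (n - a.+1) (block a x)
  + expR (bsum g n (zeros n x)).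
Proof.
elim: n x => [|n IH] x xS; first by rewrite big_ord0 partition_fun0 // bsum0 expR0 add0r.
rewrite partition_funS IH; last exact: adm_scons0.
rewrite big_ord_recl mulrDr [LHS]addrC addrA; congr (_ + _ + _).
  by rewrite /= subn1 bsum1.
  rewrite mulr_sumr; apply: eq_bigr => a _.
  rewrite subSS mulrA -expRD -[block (bump 0 a) x]/(scons true (zeros a.+1 x)).
  rewrite zerosSr -/(block a (scons false x)); congr (expR _ * _).
  rewrite -[(bump 0 a).+1]/(a.+2) -[in RHS](addn1 a.+1) bsumD sshift_block.
  by rewrite bsum1 addrC.
rewrite -expRD zerosSr.
by rewrite -[in RHS](addn1 n) bsumD sshift_zerosE bsum1 addrC.
Qed.

(** A positive function [h] that dominates its image under the operator that
    puts one complete block in front of a sequence bounds the growth of the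
    partition functions up to a polynomial factor. *)
Lemma partition_fun_le g h (B c H : R) :
  0 < c -> (forall x, adm x -> x 0%N = true -> c <= h x <= H) ->
  (forall x n, adm x -> bsum g n (zeros n x) <= B) ->
  (forall x, adm x -> g x <= B) ->
  (forall x n, adm x -> x 0%N = true ->
     \sum_(a < n | `[< S a >]) expR (bsum g a.+1 (block a x)) * h (block a x)
       <= h x) ->
  exists2 K, 0 < K & forall n, partition_fun g n zinf <= K * (n.+1)%:R ^+ 2.
Proof.
move=> c0 hcH gz gB sup.
pose K1 := expR B / c.
have K10 : 0 < K1 by rewrite divr_gt0 // expR_gt0.
have one n x : adm x -> x 0%N = true -> partition_fun g n x <= n.+1%:R * K1 * h x.
  elim/ltn_ind: n x => n IH x xS x1.
  have /andP[cx _] := hcH _ xS x1; have hx0 : 0 < h x by exact: lt_le_trans cx.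
  rewrite partition_fun_unroll // -[n.+1%:R]natr1 !mulrDl mul1r lerD //; last first.
    apply: (@le_trans _ _ (expR B)); first by rewrite ler_expR gz.
    by rewrite /K1 mulrAC ler_pdivlMr // ler_wpM2l // expR_ge0.
  apply: (@le_trans _ _ (n%:R * K1 *
    \sum_(a < n | `[< S a >]) expR (bsum g a.+1 (block a x)) * h (block a x))).
    rewrite mulr_sumr [leRHS]big_mkcond; apply: ler_sum => a _.
    case: asboolP => Sa; last first.
      by rewrite partition_fun_nadm ?mulr0 // => /(adm_block_inv x1).
    have bS := adm_block xS x1 Sa.
    rewrite mulrCA ler_wpM2l ?expR_ge0 //.
    apply: le_trans (IH _ _ _ bS erefl) _; first by have := ltn_ord a; lia.
    have /andP[cb _] := hcH _ bS erefl.
    rewrite ler_wpM2r ?(le_trans (ltW c0)) // ler_wpM2r ?(ltW K10) //.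
    by rewrite ler_nat; have := ltn_ord a; lia.
  by rewrite ler_wpM2l ?sup // mulr_ge0 // ltW.
have H0 : 0 <= H.
  have /andP[cb bH] := hcH _ (@adm_block_zinf S 0%N) erefl.
  exact: le_trans (ltW c0) (le_trans cb bH).
exists (expR B + expR (B + B) * K1 * H) => [|n].
  by apply: ltr_pwDl; rewrite ?expR_gt0 // mulr_ge0 // mulr_ge0 ?expR_ge0 // ltW.
rewrite partition_fun_unroll //.
apply: (@le_trans _ _ (\sum_(a < n) expR (B + B) * (n.+1%:R * K1 * H) + expR B)).
  apply: lerD; last by rewrite ler_expR gz.
  apply: ler_sum => a _; have bS := @adm_block_zinf S a.
  have /andP[cb bH] := hcH _ bS erefl.
  apply: ler_pM => //; rewrite ?expR_ge0 ?partition_fun_ge0 //.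
    rewrite ler_expR bsumS lerD ?gB // /block sshift_scons.
    by have := gz zinf a; apply.
  apply: le_trans (one _ _ bS erefl) _; apply: ler_pM => //.
  - by rewrite mulr_ge0 // ltW.
  - exact: le_trans (ltW c0) cb.
  - by rewrite ler_wpM2r ?(ltW K10) // ler_nat; have := ltn_ord a; lia.
rewrite sumr_const card_ord -[X in X + _ <= _]mulr_natl mulrDl addrC lerD //.
  by rewrite ler_peMr ?expR_ge0 // exprn_ege1 // ler1n.
have -> : n%:R * (expR (B + B) * (n.+1%:R * K1 * H)) =
  (expR (B + B) * K1 * H) * (n%:R * n.+1%:R) by ring.
apply: ler_wpM2l; first by rewrite mulr_ge0 // mulr_ge0 ?expR_ge0 // ltW.
by rewrite expr2 ler_wpM2r // ler_nat.
Qed.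

End partition_function.

(** * Expectations for the gap distribution *)

Section expectation.
Context (R : realType) (S : set nat) (p w : nat -> R).
Hypothesis p_ge0 : forall a, 0 <= p a.
Hypothesis p_out : forall a, ~ S a -> p a = 0.
Hypothesis p_sum : series p @ \oo --> (1 : R).
Hypothesis w_ge1 : forall a, 1 <= w a.
Hypothesis pw_sum : cvgn (series (fun a => p a * w a)).
Implicit Types u v : nat -> R.

Definition gap_mean v : R := limn (series (fun a => p a * v a)).

(** The bound is needed on [S] only, where [p] lives; in the application [w] is an
    exponential, so that functions of linear growth are dominated. *)
Definition dominated v := exists B : R, forall a, S a -> `|v a| <= B * w a.

Lemma dominated_bounded v (B : R) :
  (forall a, S a -> `|v a| <= B) -> dominated v.
Proof.
move=> vB; exists `|B| => a Sa; apply: le_trans (vB _ Sa) _.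
by rewrite (le_trans (ler_norm _)) // ler_peMr.
Qed.

Lemma dominated_cst (c : R) : dominated (fun=> c).
Proof. by apply: (@dominated_bounded _ `|c|). Qed.

Lemma dominatedD u v :
  dominated u -> dominated v -> dominated (fun a => u a + v a).
Proof.
move=> [B uB] [C vC]; exists (B + C) => a Sa; rewrite mulrDl.
by apply: le_trans (ler_normD _ _) _; rewrite lerD ?uB ?vC.
Qed.

Lemma dominatedZ c v : dominated v -> dominated (fun a => c * v a).
Proof.
move=> [B vB]; exists (`|c| * B) => a Sa.
by rewrite normrM -mulrA ler_wpM2l ?vB.
Qed.

Lemma dominated_sum (I : Type) (r : seq I) (v : I -> nat -> R) :
  (forall i, dominated (v i)) -> dominated (fun a => \sum_(i <- r) v i a).
Proof.
move=> dv; elim: r => [|i r IH].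
  by under eq_fun do rewrite big_nil; exact: dominated_cst.
by under eq_fun do rewrite big_cons; exact: dominatedD.
Qed.

Lemma gap_mean_cvg v : dominated v -> cvgn (series (fun a => p a * v a)).
Proof.
move=> [B vB]; apply: normed_cvg.
apply: (@series_le_cvg _ _ (fun a => `|B| * (p a * w a))) => [n|n|n|].
- exact: normr_ge0.
- by rewrite !mulr_ge0 // (le_trans ler01).
- have [Sn|Sn] := pselect (S n); last first.
    by rewrite /= p_out // !mul0r normr0 mulr0.
  rewrite /= normrM (ger0_norm (p_ge0 n)) mulrCA ler_wpM2l //.
  apply: le_trans (vB _ Sn) _; rewrite ler_wpM2r ?ler_norm //.
  exact: le_trans ler01 _.
- rewrite (_ : (fun a => `|B| * (p a * w a)) = `|B| *: (fun a => p a * w a)) //.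
  exact: is_cvg_seriesZ.
Qed.

Lemma gap_meanD u v : dominated u -> dominated v ->
  gap_mean (fun a => u a + v a) = gap_mean u + gap_mean v.
Proof.
move=> du dv; rewrite /gap_mean -lim_seriesD; [|exact: gap_mean_cvg..].
by congr (limn (series _)); apply/funext => a; rewrite mulrDr.
Qed.

Lemma gap_meanZ c v : dominated v -> gap_mean (fun a => c * v a) = c * gap_mean v.
Proof.
move=> dv; rewrite /gap_mean -[RHS](lim_seriesZ c (gap_mean_cvg dv)).
by congr (limn (series _)); apply/funext => a; rewrite mulrCA.
Qed.

Lemma gap_mean_cst c : gap_mean (fun=> c) = c.
Proof.
have -> : (fun _ : nat => c) = (fun a => c * (fun=> 1) a).
  by apply/funext => a; rewrite mulr1.
rewrite gap_meanZ; last exact: dominated_cst.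
rewrite (_ : gap_mean _ = 1) ?mulr1 // /gap_mean.
under eq_fun do rewrite mulr1.
exact: cvg_lim p_sum.
Qed.

Lemma gap_meanB u v : dominated u -> dominated v ->
  gap_mean (fun a => u a - v a) = gap_mean u - gap_mean v.
Proof.
move=> du dv; rewrite -mulN1r -gap_meanZ // -gap_meanD //; last exact: dominatedZ.
by congr gap_mean; apply/funext => a; rewrite mulN1r.
Qed.

Lemma gap_mean_sum (I : Type) (r : seq I) (v : I -> nat -> R) :
  (forall i, dominated (v i)) ->
  gap_mean (fun a => \sum_(i <- r) v i a) = \sum_(i <- r) gap_mean (v i).
Proof.
move=> dv; elim: r => [|i r IH].
  by rewrite big_nil; under eq_fun do rewrite big_nil; rewrite gap_mean_cst.
rewrite big_cons -IH -gap_meanD //; last exact: dominated_sum.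
by congr gap_mean; apply/funext => a; rewrite big_cons.
Qed.

Lemma gap_mean_le u v : dominated u -> dominated v ->
  (forall a, S a -> u a <= v a) -> gap_mean u <= gap_mean v.
Proof.
move=> du dv uv; apply: lim_series_le; [exact: gap_mean_cvg..|move=> a].
have [Sa|Sa] := pselect (S a); first by rewrite ler_wpM2l ?uv.
by rewrite p_out // !mul0r.
Qed.

Lemma gap_mean_norm_le v (B : R) : (forall a, S a -> `|v a| <= B) -> `|gap_mean v| <= B.
Proof.
move=> vB; have dv := dominated_bounded vB; rewrite ler_norml; apply/andP; split.
  rewrite -(gap_mean_cst (- B)); apply: gap_mean_le => // [|a Sa]; first exact: dominated_cst.
  by have := vB _ Sa; rewrite ler_norml => /andP[].
rewrite -[leRHS]gap_mean_cst; apply: gap_mean_le => // [|a Sa]; first exact: dominated_cst.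
by have := vB _ Sa; rewrite ler_norml => /andP[].
Qed.

Lemma gap_mean_partial v n : dominated v -> (forall a, 0 <= v a) ->
  \sum_(a < n) p a * v a <= gap_mean v.
Proof.
move=> dv v0; have -> : \sum_(a < n) p a * v a = series (fun a => p a * v a) n.
  by rewrite seriesEord.
apply: (@nondecreasing_cvgn_le _ (series _)); last exact: gap_mean_cvg.
by apply: nondecreasing_series => a _ _; rewrite mulr_ge0.
Qed.

End expectation.

(** Two applications of [1 + x <= expR x], at [x] and at [- x]. *)
Lemma expR_le_quadratic (R : realType) (x : R) :
  expR x <= 1 + x + x ^+ 2 * expR `|x|.
Proof.
have h1 : expR x <= 1 + x * expR x.
  have := expR_ge1Dx (- x); rewrite expRN => h.
  have e0 := expR_gt0 x.
  have : expR x * (1 - x) <= expR x * (expR x)^-1 by rewrite ler_wpM2l // ltW.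
  rewrite divff ?gt_eqF // mulrBr mulr1; lra.
have h2 := expR_ge1Dx x.
have [x0|x0] := lerP 0 x.
  rewrite ger0_norm //.
  have : x * expR x <= x * (1 + x * expR x) by rewrite ler_wpM2l.
  rewrite expr2; lra.
rewrite ltr0_norm //.
have e1 : 1 <= expR (- x) by rewrite -expR0 ler_expR oppr_ge0 ltW.
have : x * (expR x - 1) <= x ^+ 2.
  by rewrite expr2 ler_wnM2l ?(ltW x0) // lerBrDl.
have : x ^+ 2 <= x ^+ 2 * expR (- x) by rewrite ler_peMr // sqr_ge0.
rewrite mulrBr mulr1; lra.
Qed.

(** * Second-order bound for the perturbed partition functions *)

Definition holder_on (R : realType) (S : set nat) (theta c : R)
    (f : binseq -> R) :=
  forall n x y, gap_set S x -> gap_set S y -> agree n x y ->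
    `|f x - f y| <= c * theta ^+ n.

Section bounded_distortion.
Context (R : realType) (S : set nat) (theta : R).
Hypotheses (theta_gt0 : 0 < theta) (theta_lt1 : theta < 1).
Local Notation adm := (gap_set S).

(** Along the orbit the length of the agreement decreases by one at each step, so
    that the errors form a geometric series. *)
Lemma bsum_holder f (c : R) m n (x y : binseq) : 0 <= c -> holder_on S theta c f ->
  adm x -> adm y -> agree (m + n) x y ->
  `|bsum f m x - bsum f m y| <= c / (1 - theta) * theta ^+ n.
Proof.
move=> c0 hf xS yS; have t1 : 0 < 1 - theta by rewrite subr_gt0.
suff : agree (m + n) x y -> `|bsum f m x - bsum f m y| <=
    c * theta ^+ n * ((1 - theta ^+ m.+1) / (1 - theta)).
  move=> h /h/le_trans; apply; rewrite [leRHS]mulrAC ler_wpM2l //.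
    by rewrite mulr_ge0 // exprn_ge0 // ltW.
  by rewrite ler_piMl ?invr_ge0 ?(ltW t1) // lerBlDr lerDl exprn_ge0 // ltW.
elim: m x y xS yS => [|m IH] x y xS yS xy.
  by rewrite !bsum0 subrr normr0 expr1 divff ?gt_eqF // mulr1 mulr_ge0 // exprn_ge0 // ltW.
rewrite !bsumS opprD addrACA; apply: le_trans (ler_normD _ _) _.
have h1 : `|f x - f y| <= c * theta ^+ n * theta ^+ m.+1.
  by rewrite -mulrA -exprD addnC; exact: hf.
have h2 : `|bsum f m (sshift 1 x) - bsum f m (sshift 1 y)| <=
    c * theta ^+ n * ((1 - theta ^+ m.+1) / (1 - theta)).
  apply: IH; [exact: adm_sshift..|].
  by have := @agree_sshift 1 _ _ _ xy; rewrite addSn subn1.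
apply: le_trans (lerD h1 h2) _; rewrite -mulrDr.
suff -> : theta ^+ m.+1 + (1 - theta ^+ m.+1) / (1 - theta) =
    (1 - theta ^+ m.+2) / (1 - theta) by [].
rewrite [theta ^+ m.+2]exprS; field; rewrite gt_eqF //.
Qed.

Lemma bsum_block_holder f (c : R) a n (x y : binseq) : 0 <= c -> holder_on S theta c f ->
  adm x -> adm y -> x 0%N = true -> y 0%N = true -> S a -> agree n x y ->
  `|bsum f a.+1 (block a x) - bsum f a.+1 (block a y)| <=
    c / (1 - theta) * theta ^+ n.
Proof.
move=> c0 hf xS yS x1 y1 Sa xy; apply: bsum_holder => //; [exact: adm_block..|].
exact: agree_block.
Qed.

End bounded_distortion.

Section second_order.
Context (R : realType) (S : set nat) (theta : R).
Hypotheses (theta_gt0 : 0 < theta) (theta_lt1 : theta < 1).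
Local Notation adm := (gap_set S).
Variables (p : nat -> R) (kappa K P : R).
Hypothesis p_ge0 : forall a, 0 <= p a.
Hypothesis p_out : forall a, ~ S a -> p a = 0.
Hypothesis p_sum : series p @ \oo --> (1 : R).
Hypothesis kappa_gt0 : 0 < kappa.
Hypothesis p_tail : forall a, p a <= K * expR (- (2 * kappa) * a.+1%:R).

Let w (a : nat) : R := expR (kappa * a.+1%:R).

Let w_ge1 a : 1 <= w a.
Proof. by rewrite -expR0 ler_expR mulr_ge0 // ltW. Qed.

Let K_ge0 : 0 <= K.
Proof.
have := le_trans (p_ge0 0) (p_tail 0).
by rewrite pmulr_lge0 // expR_gt0.
Qed.

Let pw_sum : cvgn (series (fun a => p a * w a)).
Proof.
have q1 : `|expR (- kappa)| < 1.
  by rewrite ger0_norm ?expR_ge0 // -expR0 ltr_expR oppr_lt0.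
apply: (@series_le_cvg _ _ (geometric K (expR (- kappa)))) => [n|n|n|].
- by rewrite mulr_ge0 // expR_ge0.
- by rewrite /= mulr_ge0 // exprn_ge0 // expR_ge0.
- apply: (@le_trans _ _ (K * expR (- (2 * kappa) * n.+1%:R) * w n)).
    by rewrite ler_wpM2r // expR_ge0.
  rewrite -mulrA ler_wpM2l // -expRD -expRM_natr ler_expR.
  rewrite -natr1; have : 0 <= n%:R * kappa by rewrite mulr_ge0 // ltW.
  have := kappa_gt0; lra.
- exact: is_cvg_geometric_series.
Qed.

Let len_w a : a.+1%:R <= kappa^-1 * w a.
Proof.
rewrite ler_pdivlMl //; apply: le_trans (expR_ge1Dx _).
by rewrite lerDr.
Qed.

Local Notation E := (gap_mean p).
Local Notation dom := (dominated S w).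

Let dom_bounded := @dominated_bounded R S w w_ge1.
Let dom_cst := @dominated_cst R S w w_ge1.
Let gap_meanD' := @gap_meanD R S p w p_ge0 p_out w_ge1 pw_sum.
Let gap_meanB' := @gap_meanB R S p w p_ge0 p_out w_ge1 pw_sum.
Let gap_meanZ' := @gap_meanZ R S p w p_ge0 p_out w_ge1 pw_sum.
Let gap_mean_le' := @gap_mean_le R S p w p_ge0 p_out w_ge1 pw_sum.
Let gap_mean_norm_le' := @gap_mean_norm_le R S p w p_ge0 p_out p_sum w_ge1 pw_sum.
Let gap_mean_cst' := @gap_mean_cst R S p w p_ge0 p_out p_sum w_ge1 pw_sum.

Let dom_len : dom (fun a => a.+1%:R).
Proof. by exists kappa^-1 => a _; rewrite ger0_norm // len_w. Qed.

Let Etau : R := E (fun a => a.+1%:R).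

Let Etau_ge1 : 1 <= Etau.
Proof.
rewrite -[leLHS]gap_mean_cst'; apply: gap_mean_le' => // a _.
by rewrite ler1n.
Qed.

Section one_function.
Variable f : binseq -> R.
Hypothesis f_le1 : forall x, `|f x| <= 1.
Hypothesis f_holder : holder_on S theta 1 f.

Let F a x := bsum f a.+1 (block a x).

Let F_le a x : `|F a x| <= a.+1%:R.
Proof.
rewrite /F /bsum; apply: le_trans (ler_norm_sum _ _ _) _.
apply: (@le_trans _ _ (\sum_(j < a.+1) 1)); first exact: ler_sum.
by rewrite sumr_const card_ord.
Qed.

Let dom_F x : dom (F^~ x).
Proof. by exists kappa^-1 => a _; apply: le_trans (F_le _ _) (len_w _). Qed.

(** The conditional expectations of the sum of [f] over the block that lies
    [k] blocks in front of [x]. *)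
Let v := fix v k x : R :=
  if k is k'.+1 then E (fun a => v k' (block a x)) else E (F^~ x).

Let ell : R := (1 - theta)^-1.

Let ell_ge1 : 1 <= ell.
Proof. by rewrite invf_ge1 ?subr_gt0 // lerBlDr lerDl ltW. Qed.

Let v_le k x : `|v k x| <= Etau.
Proof.
elim: k x => [|k IH] x /=; last by apply: gap_mean_norm_le'.
rewrite ler_norml; apply/andP; split.
  rewrite /Etau -mulN1r -gap_meanZ' //; apply: gap_mean_le' => //.
    exact: dominatedZ.
  by move=> a _; rewrite mulN1r; have := F_le a x; rewrite ler_norml => /andP[].
by apply: gap_mean_le' => // a _; have := F_le a x; rewrite ler_norml => /andP[].
Qed.

Let dom_v k x : dom (fun a => v k (block a x)).
Proof. by apply: dom_bounded => a _; exact: v_le. Qed.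

Let v_lip k n x y : adm x -> adm y -> x 0%N = true -> y 0%N = true ->
  agree n x y -> `|v k x - v k y| <= ell * theta ^+ (n + k).
Proof.
elim: k n x y => [|k IH] n x y xS yS x1 y1 xy /=; rewrite -gap_meanB' //;
  apply: gap_mean_norm_le' => a Sa.
  have := bsum_block_holder theta_gt0 theta_lt1 ler01 f_holder xS yS x1 y1 Sa xy.
  by rewrite addn0 div1r.
have h : agree (a.+1 + n) (block a x) (block a y) by exact: agree_block.
apply: le_trans (IH (a.+1 + n)%N _ _ _ _ erefl erefl h) _.
- exact: adm_block.
- exact: adm_block.
rewrite ler_wpM2l ?(le_trans ler01) //.
by apply: ler_wiXn2l; rewrite ?(ltW theta_gt0) ?(ltW theta_lt1) //; lia.
Qed.

(** [v (k + i)] is an average of values of [v k], and the oscillation of [v k] is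
    exponentially small because [k] blocks shield it from the sequence behind. *)
Let v_mix k i x y : adm x -> adm y -> x 0%N = true -> y 0%N = true ->
  `|v (k + i) x - v k y| <= ell * theta ^+ k.
Proof.
elim: i x => [|i IH] x xS yS x1 y1.
  by rewrite addn0 -[k in theta ^+ k]add0n; exact: v_lip.
rewrite addnS /= -[v k y]gap_mean_cst' -gap_meanB' //.
by apply: gap_mean_norm_le' => a Sa; apply: IH => //; exact: adm_block.
Qed.

Let xs : binseq := block 0 zinf.

Variable N : nat.
Let M : R := v N xs / Etau.

Let Etau_gt0 : 0 < Etau. Proof. exact: lt_le_trans ltr01 _. Qed.

Let MEtau : M * Etau = v N xs.
Proof. by rewrite /M divfK // gt_eqF. Qed.

Let M_le1 : `|M| <= 1.
Proof.
rewrite /M normrM normfV (gtr0_norm Etau_gt0) ler_pdivrMr // mul1r.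
exact: v_le.
Qed.

(** Adding this coboundary makes the block sums of [f - M] almost centered
    with respect to the gap in front. *)
Let U x : R := \sum_(k < N) (v k x - v N xs).

Let U_le x : adm x -> x 0%N = true -> `|U x| <= ell ^+ 2.
Proof.
move=> xS x1; apply: le_trans (ler_norm_sum _ _ _) _.
apply: (@le_trans _ _ (\sum_(k < N) ell * theta ^+ k)).
  apply: ler_sum => k _; have := v_mix k (N - k) (@adm_block_zinf S 0%N) xS erefl x1.
  by rewrite subnKC ?(ltnW (ltn_ord k)) // distrC.
rewrite -mulr_sumr expr2 ler_wpM2l ?(le_trans ler01) //.
have := @geometric_seriesE R 1 theta; rewrite lt_eqF // => /(_ isT)/(congr1 (@^~ N)).
rewrite seriesEord /= => h.
under eq_bigr do rewrite -[_ ^+ _]mul1r.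
rewrite h mul1r /ell ler_pdivrMr ?subr_gt0 // mulVf ?gt_eqF ?subr_gt0 //.
by rewrite lerBlDr lerDl exprn_ge0 // ltW.
Qed.

Let V x a : R := F a x - M * a.+1%:R + (U (block a x) - U x).

Let D : R := 2 + 2 * ell ^+ 2.

Let V_le x a : adm x -> x 0%N = true -> S a -> `|V x a| <= D * a.+1%:R.
Proof.
move=> xS x1 Sa; rewrite /V.
have b1 := F_le a x; have b2 := U_le xS x1.
have b3 := U_le (adm_block xS x1 Sa) erefl.
have b4 : `|M * a.+1%:R| <= a.+1%:R.
  by rewrite normrM [X in _ * X]ger0_norm // ler_piMl.
apply: le_trans (ler_normD _ _) _.
apply: le_trans (lerD (ler_normB _ _) (ler_normB _ _)) _.
apply: le_trans (lerD (lerD b1 b4) (lerD b3 b2)) _.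
have : ell ^+ 2 * 1 <= ell ^+ 2 * a.+1%:R by rewrite ler_wpM2l ?sqr_ge0 // ler1n.
rewrite /D; lra.
Qed.

Let dom_U x : adm x -> x 0%N = true -> dom (fun a => U (block a x)).
Proof.
move=> xS x1; apply: dom_bounded => a Sa.
by apply: U_le => //; exact: adm_block.
Qed.

Let V_mean x : adm x -> x 0%N = true -> `|E (V x)| <= ell * theta ^+ N.
Proof.
move=> xS x1; have dU := dom_U xS x1.
suff -> : E (V x) = v N x - v N xs.
  by have := v_mix N 0 xS (@adm_block_zinf S 0%N) x1 erefl; rewrite addn0.
rewrite /V gap_meanD'; last 2 first.
- by apply: dominatedD => //; under eq_fun do rewrite -mulNr; exact: dominatedZ.
- by apply: dominatedD => //; exact: dom_cst.
rewrite gap_meanB' //; last exact: dominatedZ.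
rewrite gap_meanZ' // MEtau -/(v 0 x) gap_meanB' // gap_mean_cst' /U.
rewrite (@gap_mean_sum R S p w p_ge0 p_out p_sum w_ge1 pw_sum); last first.
  move=> k; apply: dominatedD => //; exact: dom_cst.
under [X in _ + (X - _)]eq_bigr => k _.
  rewrite gap_meanB' // gap_mean_cst' -/(v k.+1 x); over.
rewrite -sumrB; under eq_bigr do rewrite opprD addrACA subrr addr0.
rewrite [X in _ + X](_ : _ = v N x - v 0 x); first by ring.
by rewrite -(big_mkord xpredT (fun k => v k.+1 x - v k x)) telescope_sumr.
Qed.

Let C : R := D ^+ 2 * (16 / kappa ^+ 2) * E w.

Let dom_w : dom w.
Proof. by exists 1 => a _; rewrite mul1r ger0_norm // expR_ge0. Qed.

Let D_gt0 : 0 < D.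
Proof. by rewrite /D ltr_pwDl // mulr_ge0 // sqr_ge0. Qed.

(** The linear term of the expansion is the mean of [V], which is almost 0; the
    quadratic term is finite because the gaps have exponential moments. *)
Let V_exp x t n : adm x -> x 0%N = true -> `|t| * D <= kappa / 2 ->
  \sum_(a < n | `[< S a >]) p a * expR (t * V x a) <=
  expR (C * t ^+ 2 + `|t| * (ell * theta ^+ N)).
Proof.
move=> xS x1 tD.
have tV a : S a -> `|t * V x a| <= kappa / 2 * a.+1%:R.
  move=> Sa; rewrite normrM; apply: (@le_trans _ _ (`|t| * (D * a.+1%:R))).
    by rewrite ler_wpM2l ?V_le.
  by rewrite mulrA ler_wpM2r.
pose u a := if `[< S a >] then expR (t * V x a) else 0.
have dV : dom (V x).
  exists (D * kappa^-1) => a Sa; apply: le_trans (V_le xS x1 Sa) _.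
  by rewrite -mulrA ler_wpM2l ?(ltW D_gt0).
have dquad : dom (fun a => 1 + t * V x a + D ^+ 2 * (16 / kappa ^+ 2) * t ^+ 2 * w a).
  apply: dominatedD; last exact: dominatedZ.
  by apply: dominatedD; [exact: dom_cst|exact: dominatedZ].
have du : dom u.
  exists 1 => a Sa; rewrite /u asboolT // mul1r ger0_norm ?expR_ge0 // ler_expR.
  apply: le_trans (ler_norm _) (le_trans (tV _ Sa) _).
  by rewrite ler_wpM2r // ler_piMr ?(ltW kappa_gt0) // invf_le1 ?ler1n.
have -> : \sum_(a < n | `[< S a >]) p a * expR (t * V x a) =
    \sum_(a < n) p a * u a.
  rewrite big_mkcond; apply: eq_bigr => a _; rewrite /u.
  by case: ifP => _; rewrite ?mulr0.
apply: le_trans (gap_mean_partial p_ge0 p_out w_ge1 pw_sum n du _) _.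
  by move=> a; rewrite /u; case: ifP => _ //; exact: expR_ge0.
apply: le_trans (gap_mean_le' du dquad _) _.
  move=> a Sa; rewrite /u asboolT //; apply: le_trans (expR_le_quadratic _) _.
  rewrite lerD2l.
  have l0 : 0 <= a.+1%:R :> R by [].
  have q1 : (t * V x a) ^+ 2 <= D ^+ 2 * t ^+ 2 * a.+1%:R ^+ 2.
    rewrite -real_normK ?num_real // -[t ^+ 2]real_normK ?num_real // -!exprMn.
    rewrite lerXn2r ?nnegrE ?mulr_ge0 ?(ltW D_gt0) // normrM.
    by rewrite [D * _]mulrC -mulrA ler_wpM2l ?V_le.
  have q2 : expR `|t * V x a| <= expR (kappa / 2 * a.+1%:R) by rewrite ler_expR tV.
  have q3 : a.+1%:R ^+ 2 <= 16 / kappa ^+ 2 * expR (kappa / 2 * a.+1%:R).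
    have h : kappa / 4 * a.+1%:R <= expR (kappa / 4 * a.+1%:R).
      by apply: le_trans (expR_ge1Dx _); rewrite lerDr.
    have h2 : (kappa / 4 * a.+1%:R) ^+ 2 <= expR (kappa / 4 * a.+1%:R) ^+ 2.
      by rewrite lerXn2r ?nnegrE ?expR_ge0 // mulr_ge0 // divr_ge0 // ltW.
    have e2 : expR (kappa / 4 * a.+1%:R) ^+ 2 = expR (kappa / 2 * a.+1%:R).
      by rewrite -expRM_natr; congr expR; field.
    rewrite e2 in h2.
    have -> : a.+1%:R ^+ 2 = 16 / kappa ^+ 2 * (kappa / 4 * a.+1%:R) ^+ 2 :> R.
      by field; rewrite gt_eqF.
    by rewrite ler_wpM2l // divr_ge0 // sqr_ge0.
  apply: le_trans (ler_pM _ _ q1 q2) _; rewrite ?sqr_ge0 ?expR_ge0 //.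
  apply: (@le_trans _ _ (D ^+ 2 * t ^+ 2 *
      (16 / kappa ^+ 2 * expR (kappa / 2 * a.+1%:R)) *
      expR (kappa / 2 * a.+1%:R))).
    rewrite ler_wpM2r ?expR_ge0 // ler_wpM2l // mulr_ge0 ?sqr_ge0 //.
  rewrite le_eqVlt; apply/orP; left; apply/eqP.
  have -> : w a = expR (kappa / 2 * a.+1%:R) * expR (kappa / 2 * a.+1%:R).
    by rewrite -expRD /w; congr expR; field.
  ring.
rewrite gap_meanD'; last 2 first.
- by apply: dominatedD; [exact: dom_cst|exact: dominatedZ].
- exact: dominatedZ.
rewrite gap_meanD'; [|exact: dom_cst|exact: dominatedZ].
rewrite gap_mean_cst' !gap_meanZ' //.
apply: le_trans (expR_ge1Dx _); rewrite -addrA lerD2l addrC lerD //.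
  by rewrite /C le_eqVlt; apply/orP; left; apply/eqP; ring.
apply: le_trans (ler_norm _) _; rewrite normrM ler_wpM2l //.
exact: V_mean.
Qed.

Variables (phi correction : binseq -> R) (c B : R).
Hypothesis phi_le : forall x, `|phi x| <= c.
Hypothesis phi_holder : holder_on S theta c phi.
Hypothesis phi_zinf : phi zinf + 2 * kappa <= P.
Hypothesis correction_le : forall x, adm x -> x 0%N = true -> `|correction x| <= B.
Hypothesis correction_block : forall x a, adm x -> x 0%N = true -> S a ->
  expR (bsum phi a.+1 (block a x) - P * a.+1%:R + correction (block a x)) <=
  p a * expR (correction x).

(** The weight [correction + t * U] turns the bound for one block into the
    hypothesis of [partition_fun_le]; the number of symbols of a block is at
    least 1, so that the constant part of the rate absorbs the error of each
    block. *)
Lemma partition_fun_one_function t : `|t| * D <= kappa / 2 ->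
  exists2 K', 0 < K' & forall n,
   partition_fun S (fun x => phi x + t * f x) n zinf <= K' * n.+1%:R ^+ 2 *
     expR (n%:R * (P + t * M + C * t ^+ 2 + `|t| * (ell * theta ^+ N))).
Proof.
move=> tD; set rho := P + t * M + _ + _.
have D2 : 2 <= D by rewrite /D lerDl mulr_ge0 // sqr_ge0.
have t2 : `|t| * 2 <= kappa / 2 by apply: le_trans tD; rewrite ler_wpM2l.
have C0 : 0 <= C.
  rewrite /C mulr_ge0 //; first by rewrite mulr_ge0 ?sqr_ge0 // divr_ge0 // sqr_ge0.
  rewrite -[leLHS]gap_mean_cst'; apply: gap_mean_le' => // a _; exact: expR_ge0.
have e0 : 0 <= `|t| * (ell * theta ^+ N).
  by rewrite !mulr_ge0 // ?exprn_ge0 ?(ltW theta_gt0) // (le_trans ler01).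
have Ct0 : 0 <= C * t ^+ 2 by rewrite mulr_ge0 // sqr_ge0.
have tle1 x : `|x| <= 1 -> `|t * x| <= `|t|.
  by move=> x1; rewrite normrM ler_piMr.
have c0 : 0 <= c by apply: le_trans (phi_le zinf).
pose g x := phi x + t * f x - rho.
have gE n x : bsum g n x = bsum (fun x => phi x + t * f x) n x - rho * n%:R.
  by rewrite /g bsum_add bsum_cst mulNr.
have g_hold : holder_on S theta (c + `|t|) g.
  move=> n x y xS yS xy; have -> : g x - g y = phi x - phi y + t * (f x - f y).
    by rewrite /g; ring.
  apply: le_trans (ler_normD _ _) _; rewrite mulrDl lerD ?phi_holder // normrM.
  by rewrite ler_wpM2l // -[leRHS]mul1r f_holder.
have g_zinf : g zinf <= 0.
  have := tle1 _ (f_le1 zinf); have := tle1 _ M_le1.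
  rewrite !ler_norml => /andP[h1 h2] /andP[h3 h4].
  have := kappa_gt0; have := phi_zinf; rewrite /g /rho; lra.
pose B1 := (c + `|t|) / (1 - theta) + c + `|t| + `|rho|.
have [||||K' K'0 HK] := @partition_fun_le R S g (fun x => expR (correction x + t * U x)) B1
   (expR (- (B + `|t| * ell ^+ 2))) (expR (B + `|t| * ell ^+ 2)) (expR_gt0 _).
- move=> x xS x1; rewrite !ler_expR -ler_norml.
  apply: le_trans (ler_normD _ _) _; rewrite lerD ?correction_le // normrM.
  by rewrite ler_wpM2l // U_le.
- move=> x n xS.
  have ct0 : 0 <= c + `|t| by rewrite addr_ge0.
  have ag : agree (n + 0) (zeros n x) zinf.
    by rewrite addn0; exact: agree_zeros_zinf.
  have := bsum_holder theta_gt0 theta_lt1 ct0 g_hold (@adm_zeros S n x xS)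
    (@adm_zinf S) ag.
  rewrite expr0 mulr1 ler_norml => /andP[_].
  have -> : bsum g n zinf = g zinf * n%:R.
    by rewrite /bsum (eq_bigr (fun=> g zinf)) // sumr_const card_ord mulr_natr.
  have : g zinf * n%:R <= 0 by rewrite mulr_le0_ge0.
  rewrite /B1; have := normr_ge0 rho; have := normr_ge0 t; have := c0; lra.
- move=> x _; rewrite /g /B1.
  have := tle1 _ (f_le1 x); have := phi_le x.
  rewrite !ler_norml => /andP[h1 h2] /andP[h3 h4].
  have : 0 <= (c + `|t|) / (1 - theta).
    by apply: divr_ge0; [exact: addr_ge0|rewrite subr_ge0 ltW].
  have := ler_norm (- rho); rewrite normrN; lra.
- move=> x n xS x1.
  apply: (@le_trans _ _ (\sum_(a < n | `[< S a >]) expR (correction x + t * U x -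
     (C * t ^+ 2 + `|t| * (ell * theta ^+ N))) * (p a * expR (t * V x a)))).
    apply: ler_sum => a /asboolP Sa; rewrite -expRD gE bsum_add bsum_scale.
    have := correction_block xS x1 Sa; rewrite -/(F a x) => hc.
    have -> : expR (correction x + t * U x - (C * t ^+ 2 + `|t| * (ell * theta ^+ N))) *
      (p a * expR (t * V x a)) = (p a * expR (correction x)) *
      expR (t * U x + t * V x a - (C * t ^+ 2 + `|t| * (ell * theta ^+ N))).
      by rewrite !expRD; ring.
    apply: le_trans (ler_wpM2r (expR_ge0 _) hc).
    rewrite -expRD ler_expR /V /rho.
    have : (C * t ^+ 2 + `|t| * (ell * theta ^+ N)) * 1 <=
      (C * t ^+ 2 + `|t| * (ell * theta ^+ N)) * a.+1%:R.
      by rewrite ler_wpM2l ?addr_ge0 // ler1n.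
    lra.
  rewrite -mulr_sumr expRD; have h := V_exp n xS x1 tD.
  apply: le_trans (ler_wpM2l _ h) _; first by rewrite mulr_ge0 // expR_ge0.
  by rewrite -mulrA -expRD addNr expR0 mulr1.
exists K' => // n.
suff -> : partition_fun S (fun x => phi x + t * f x) n zinf = partition_fun S g n zinf * expR (n%:R * rho).
  by rewrite ler_wpM2r ?expR_ge0.
rewrite /partition_fun mulr_suml; apply: eq_bigr => u _.
by rewrite gE -expRD mulrC; congr expR; ring.
Qed.

End one_function.

Variables (phi correction : binseq -> R) (c B : R).
Hypothesis phi_le : forall x, `|phi x| <= c.
Hypothesis phi_holder : holder_on S theta c phi.
Hypothesis phi_zinf : phi zinf + 2 * kappa <= P.
Hypothesis correction_le : forall x, adm x -> x 0%N = true -> `|correction x| <= B.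
Hypothesis correction_block : forall x a, adm x -> x 0%N = true -> S a ->
  expR (bsum phi a.+1 (block a x) - P * a.+1%:R + correction (block a x)) <=
  p a * expR (correction x).

(** [N] is taken so large that the error of centering, of order [theta ^+ N],
    drops below [eps]; the other constants do not depend on [N]. *)
Lemma partition_fun_second_order : exists C t0 : R, [/\ 0 <= C, 0 < t0 &
  forall f, (forall x, `|f x| <= 1) -> holder_on S theta 1 f ->
  forall eps, 0 < eps -> exists M, forall t, `|t| <= t0 ->
  exists2 K', 0 < K' & forall n,
   partition_fun S (fun x => phi x + t * f x) n zinf <= K' * n.+1%:R ^+ 2 *
     expR (n%:R * (P + t * M + C * t ^+ 2 + `|t| * eps))].
Proof.
pose D : R := 2 + 2 * (1 - theta)^-1 ^+ 2.
have D0 : 0 < D by rewrite /D ltr_pwDl // mulr_ge0 // sqr_ge0.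
exists (D ^+ 2 * (16 / kappa ^+ 2) * E w), (kappa / 2 / D); split.
- rewrite mulr_ge0 //; first by rewrite mulr_ge0 ?sqr_ge0 // divr_ge0 // sqr_ge0.
  rewrite -[leLHS]gap_mean_cst'; apply: gap_mean_le' => // [|a _]; last exact: expR_ge0.
  by exists 1 => a _; rewrite mul1r ger0_norm // expR_ge0.
- by rewrite !divr_gt0.
move=> f f1 fh eps e0.
have [N hN] : exists N, (1 - theta)^-1 * theta ^+ N <= eps.
  have t1 : `|theta| < 1 by rewrite gtr0_norm.
  have /cvgr0Pnorm_le/(_ _ e0)[N _ hN] := @cvg_geometric R (1 - theta)^-1 theta t1.
  by exists N; apply: le_trans (ler_norm _) (hN N _); rewrite /=.
eexists; move=> t tt0.
have tD : `|t| * D <= kappa / 2 by rewrite -ler_pdivlMr.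
have [K' K'0 HK] := @partition_fun_one_function f f1 fh N phi correction c B phi_le phi_holder
  phi_zinf correction_le correction_block t tD.
exists K' => // n; apply: le_trans (HK n) _.
rewrite ler_wpM2l //; first by rewrite mulr_ge0 ?sqr_ge0 // ltW.
rewrite ler_expR; apply: ler_wpM2l; first exact: ler0n.
by apply: lerD; [exact: lexx|exact: ler_wpM2l].
Qed.

End second_order.

(** * The gap distribution of a renewal-type potential *)

Section holder_bounds.
Context (R : realType) (S : set nat) (theta : R).
Hypotheses (theta_gt0 : 0 < theta) (theta_lt1 : theta < 1).
Local Notation adm := (gap_set S).
Implicit Types (f : gap_shift S -> R) (x y : gap_shift S).

Definition raw f (x : binseq) : R := f (to_shift S x).

Lemma to_shift_zinf : to_shift S zinf = zero_inf S.
Proof. by apply: gap_seq_inj; rewrite to_shiftK. Qed.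

Lemma bsum_raw f n x : bsum (raw f) n (gap_seq x) =
  birkhoff_sum (@gap_sigma S) f n x.
Proof.
apply: eq_bigr => j _; rewrite /raw -gap_seq_iter; congr f.
exact: gap_seqK.
Qed.

Lemma dtheta_agree n x y : agree n (gap_seq x) (gap_seq y) ->
  dtheta theta x y <= theta ^+ n.
Proof.
move=> xy; rewrite /dtheta; case: pselect => [h|_]; last first.
  by rewrite exprn_ge0 // ltW.
case: ex_minnP => m /eqP hm _; rewrite ler_wiXn2l ?ltW // leqNgt.
by apply/negP => mn; apply: hm; exact: xy.
Qed.

Lemma dtheta_gt0 x y : x <> y -> 0 < dtheta theta x y.
Proof.
move=> xy; rewrite /dtheta; case: pselect => [h|h].
  by rewrite exprn_gt0.
exfalso; apply: xy; apply: gap_seq_inj; apply/funext => k.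
by apply/eqP/negPn/negP => hk; apply: h; exists k.
Qed.

Lemma holder_seminorm_ge0 f : (0 <= holder_seminorm theta f)%E.
Proof.
pose x := to_shift S (block 0 zinf).
have xz : x <> zero_inf S.
  move=> /(congr1 (fun z => gap_seq z 0%N)).
  by rewrite to_shiftK //; exact: adm_block_zinf.
apply: (@le_trans _ _ (`|f x - f (zero_inf S)| / dtheta theta x (zero_inf S))%:E).
  by rewrite lee_fin divr_ge0 // ltW // dtheta_gt0.
by apply: ereal_sup_ubound; exists (x, zero_inf S).
Qed.

Lemma sup_norm_ge f x : (`|f x|%:E <= sup_norm f)%E.
Proof. by apply: ereal_sup_ubound; exists x. Qed.

Lemma sup_norm_ge0 f : (0 <= sup_norm f)%E.
Proof. by apply: le_trans (sup_norm_ge f (zero_inf S)); rewrite lee_fin. Qed.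

Lemma holder_norm_ge0 f : (0 <= holder_norm theta f)%E.
Proof. by rewrite adde_ge0 // ?sup_norm_ge0 ?holder_seminorm_ge0. Qed.

Lemma Ctheta_fin f : Ctheta theta f -> holder_norm theta f \is a fin_num.
Proof. by move=> h; rewrite ge0_fin_numE // holder_norm_ge0. Qed.

Lemma Ctheta_le f x : Ctheta theta f -> `|f x| <= fine (holder_norm theta f).
Proof.
move=> hf; rewrite -lee_fin fineK ?Ctheta_fin //.
by apply: le_trans (sup_norm_ge f x) _; rewrite leeDl // holder_seminorm_ge0.
Qed.

Lemma Ctheta_holder f n x y : Ctheta theta f ->
  agree n (gap_seq x) (gap_seq y) ->
  `|f x - f y| <= fine (holder_norm theta f) * theta ^+ n.
Proof.
move=> hf xy; have hN := holder_norm_ge0 f.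
have [->|/eqP neq] := eqVneq x y.
  by rewrite subrr normr0 mulr_ge0 ?fine_ge0 // exprn_ge0 // ltW.
have d0 := dtheta_gt0 neq.
apply: (@le_trans _ _ (fine (holder_norm theta f) * dtheta theta x y)).
  rewrite -ler_pdivrMr // -lee_fin fineK ?Ctheta_fin //.
  apply: (@le_trans _ _ (holder_seminorm theta f)); last first.
    by rewrite leeDr // sup_norm_ge0.
  by apply: ereal_sup_ubound; exists (x, y).
by rewrite ler_wpM2l ?fine_ge0 // dtheta_agree.
Qed.

Lemma raw_holder f : Ctheta theta f ->
  holder_on S theta (fine (holder_norm theta f)) (raw f).
Proof. by move=> hf n x y xS yS xy; apply: Ctheta_holder; rewrite // !to_shiftK. Qed.

End holder_bounds.

(** This makes the coding of a gap sequence accessible to induction on blocks. *)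
Lemma coding_seqE (z : nat -> nat) :
  coding_seq z = block (z 0%N) (coding_seq (fun i => z i.+1)).
Proof.
have pos m : one_position z m.+1 =
    ((z 0%N).+1 + one_position (fun i => z i.+1) m)%N.
  by rewrite /one_position big_ord_recl.
apply/funext => k; rewrite /coding_seq.
have -> : block (z 0%N) (coding_seq (fun i => z i.+1)) k =
   `[< k = 0%N \/ exists m, k = ((z 0%N).+1 + one_position (fun i => z i.+1) m)%N >].
  case: k => [|k]; first by rewrite asboolT //; left.
  rewrite /block /= zerosE; case: ltnP => zk.
    by rewrite asboolF // => -[//|[m]]; lia.
  rewrite /coding_seq; apply/asbool_equiv_eq; split=> [[m hm]|[//|[m hm]]].
    by right; exists m; lia.
  by exists m; lia.
apply/asbool_equiv_eq; split=> [[[|m]]|[->|[m ->]]].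
- by rewrite /one_position big_ord0; left.
- by rewrite pos => ->; right; exists m.
- by exists 0%N; rewrite /one_position big_ord0.
- by exists m.+1; rewrite pos.
Qed.

Section renewal.
Context (R : realType) (S : set nat) (theta : R).
Hypotheses (theta_gt0 : 0 < theta) (theta_lt1 : theta < 1).
Hypothesis S_neq0 : S !=set0.
Variables (phi : gap_shift S -> R) (psi : S -> R).
Hypothesis phi_renewal : renewal_type theta phi psi.
Variable P : R.
Local Notation adm := (gap_set S).

Definition psi_nat (a : nat) : R :=
  match pselect (S a) with
  | left Sa => psi (SigSub (mem_set Sa))
  | right _ => 0
  end.

Definition gap_weight (a : nat) : R :=
  if `[< S a >] then expR (psi_nat a - P * a.+1%:R) else 0.

Lemma psi_nat_val (n : S) : psi_nat (set_val n) = psi n.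
Proof.
rewrite /psi_nat; case: pselect => [h|]; last by have := set_valP n.
by congr psi; apply: val_inj.
Qed.

Let phiC : Ctheta theta phi. Proof. by case: phi_renewal. Qed.
Let c := fine (holder_norm theta phi).
Let c_ge0 : 0 <= c. Proof. by rewrite fine_ge0 // holder_norm_ge0. Qed.

Lemma raw_phi_le x : `|raw phi x| <= c.
Proof. exact: Ctheta_le. Qed.

Let hphi : holder_on S theta c (raw phi).
Proof. exact: raw_holder. Qed.

Lemma renewal_block a z : S a -> (forall i, S (z i)) ->
  bsum (raw phi) a.+1 (block a (coding_seq z)) = psi_nat a.
Proof.
move=> Sa Sz; have [_ ren] := phi_renewal.
pose y (i : nat) : S := if i is j.+1 then SigSub (mem_set (Sz j))
  else SigSub (mem_set Sa).
have -> : block a (coding_seq z) = gap_seq (coding y).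
  rewrite -[RHS]/(coding_seq (fun i => set_val (y i))).
  by rewrite [RHS]coding_seqE.
by rewrite bsum_raw -[a.+1]/(return_time y) ren -psi_nat_val.
Qed.

Definition blocks (l : seq nat) (x : binseq) : binseq := foldr block x l.

Definition blocks_length (l : seq nat) : nat := sumn [seq a.+1 | a <- l].

Let inS (l : seq nat) := all (fun a => `[< S a >]) l.

Lemma blocks_coding l z : (forall i, S (z i)) -> inS l ->
  exists2 z', (forall i, S (z' i)) & blocks l (coding_seq z) = coding_seq z'.
Proof.
move=> Sz; elim: l => [|a l IH] /=; first by exists z.
move=> /andP[/asboolP Sa /IH[z' Sz' ->]].
exists (fun i => if i is j.+1 then z' j else a) => [[|i]//|].
by rewrite [RHS]coding_seqE.
Qed.

Lemma renewal_blocks l z : (forall i, S (z i)) -> inS l ->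
  bsum (raw phi) (blocks_length l) (blocks l (coding_seq z)) =
  \sum_(a <- l) psi_nat a.
Proof.
move=> Sz; elim: l => [|a l IH] /=; first by rewrite big_nil bsum0.
move=> /andP[/asboolP Sa Sl]; have [z' Sz' e] := blocks_coding Sz Sl.
rewrite big_cons bsumD sshift_block IH //; congr (_ + _).
by rewrite e renewal_block.
Qed.

Lemma adm_blocks l x : adm x -> x 0%N = true -> inS l ->
  adm (blocks l x) /\ blocks l x 0%N = true.
Proof.
move=> xS x1; elim: l => [|a l IH] //= /andP[/asboolP Sa /IH[lS l1]].
by split=> //; exact: adm_block.
Qed.

Lemma agree_blocks l x y : agree (blocks_length l) (blocks l x) (blocks l y).
Proof.
elim: l => [|a l IH]; first by move=> k; rewrite ltn0.
exact: agree_block.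
Qed.

Let s0 : nat := xget 0%N S.
Let Ss0 : S s0.
Proof. by rewrite /s0; case: xgetP => // h; case: S_neq0 => a /h. Qed.

Let xs : binseq := coding_seq (fun=> s0).
Let xs_adm : adm xs /\ xs 0%N = true.
Proof.
split; last by rewrite /xs coding_seqE.
by rewrite /xs; exact: (@coding_subproof S (fun=> SigSub (mem_set Ss0))).
Qed.

Let B := c / (1 - theta).
Let B_ge0 : 0 <= B. Proof. by rewrite divr_ge0 // subr_ge0 ltW. Qed.

(** Behind coded sequences the renewal identity is exact, and the blocks do not
    notice which sequence follows them beyond the distortion of a Hoelder sum. *)
Lemma block_defect l x : adm x -> x 0%N = true -> inS l ->
  `|bsum (raw phi) (blocks_length l) (blocks l x) - \sum_(a <- l) psi_nat a| <= B.
Proof.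
move=> xS x1 Sl; rewrite -(@renewal_blocks l (fun=> s0)) //.
have [lS l1] := adm_blocks xS x1 Sl.
have [xsS xs1] := xs_adm; have [lsS ls1] := adm_blocks xsS xs1 Sl.
have ag : agree (blocks_length l + 0) (blocks l x) (blocks l xs).
  by rewrite addn0; exact: agree_blocks.
have := bsum_holder theta_gt0 theta_lt1 c_ge0 hphi lS lsS ag.
by rewrite expr0 mulr1.
Qed.

(** Sequences that end in zeros need not be limits of codings, and there the
    block sums of the potential may differ from [psi].  The total difference
    over any number of blocks is bounded; its supremum is a coboundary that
    dominates the difference over one block.  The two signs [sgn] give upper and
    lower bounds for the block sums. *)
Definition correction (sgn : R) (x : binseq) : R :=
  sup [set sgn * (bsum (raw phi) (blocks_length l) (blocks l x) -
                  \sum_(a <- l) psi_nat a) | l in [set l | inS l]].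

Section correction.
Variable sgn : R.
Hypothesis sgn1 : `|sgn| = 1.

Let defect x l := sgn * (bsum (raw phi) (blocks_length l) (blocks l x) -
                  \sum_(a <- l) psi_nat a).

Let defect_le x l : adm x -> x 0%N = true -> inS l -> `|defect x l| <= B.
Proof. by move=> xS x1 Sl; rewrite normrM sgn1 mul1r block_defect. Qed.

Let correction_sup x : adm x -> x 0%N = true ->
  has_sup [set defect x l | l in [set l | inS l]].
Proof.
move=> xS x1; split; first by exists (defect x [::]), [::].
exists B => _ [l Sl <-]; exact: le_trans (ler_norm _) (defect_le xS x1 Sl).
Qed.

Lemma correction_le x : adm x -> x 0%N = true -> `|correction sgn x| <= B.
Proof.
move=> xS x1; have [ne ub] := correction_sup xS x1.
have h0 : 0 <= correction sgn x.
  apply: (@le_trans _ _ (defect x [::])).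
    by rewrite /defect big_nil bsum0 subrr mulr0.
  by apply: ub_le_sup => //; exists [::].
rewrite ger0_norm //; apply: ge_sup => // _ [l Sl <-].
exact: le_trans (ler_norm _) (defect_le xS x1 Sl).
Qed.

Lemma correction_step a x : adm x -> x 0%N = true -> S a ->
  sgn * (bsum (raw phi) a.+1 (block a x) - psi_nat a) + correction sgn (block a x)
    <= correction sgn x.
Proof.
move=> xS x1 Sa; have bS := adm_block xS x1 Sa.
rewrite addrC -lerBrDr; have [ne ub] := correction_sup bS erefl.
apply: ge_sup => // _ [l Sl <-]; rewrite lerBrDr.
apply: ub_le_sup; first by case: (correction_sup xS x1).
exists (rcons l a); first by rewrite /= /inS all_rcons asboolT.
have -> : blocks (rcons l a) x = blocks l (block a x).
  by rewrite /blocks foldr_rcons.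
have -> : blocks_length (rcons l a) = (blocks_length l + a.+1)%N.
  by rewrite /blocks_length map_rcons sumn_rcons.
rewrite bsumD big_rcons /= -mulrDr.
have -> : sshift (blocks_length l) (blocks l (block a x)) = block a x.
  elim: l {Sl} => //= d l IH.
  rewrite -[blocks_length (d :: l)]/(d.+1 + blocks_length l)%N.
  by rewrite -sshiftD sshift_block IH.
congr (sgn * _); ring.
Qed.

End correction.

Let z0 := phi (zero_inf S).

(** All symbols of the block except the first see a long run of zeros, hence
    values of the potential that are summably close to the one at [0^oo]. *)
Lemma psi_nat_approx a : S a -> `|psi_nat a - a.+1%:R * z0| <= 2 * c + B.
Proof.
move=> Sa; rewrite -(@renewal_block a (fun=> s0)) // -/xs.
have [xsS xs1] := xs_adm; have bS := adm_block xsS xs1 Sa.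
have ag : agree (a + 0) (zeros a xs) zinf.
  by rewrite addn0; exact: agree_zeros_zinf.
have h1 := bsum_holder theta_gt0 theta_lt1 c_ge0 hphi (@adm_zeros S a xs xsS) (@adm_zinf S) ag.
rewrite expr0 mulr1 in h1.
have h2 : bsum (raw phi) a zinf = a%:R * z0.
  rewrite /bsum (eq_bigr (fun=> z0)) ?sumr_const ?card_ord ?mulr_natl // => j _.
  by rewrite /raw sshift_zinf to_shift_zinf.
rewrite bsumS -[sshift 1 _]/(zeros a xs) -natr1 mulrDl mul1r -h2.
have -> : raw phi (block a xs) + bsum (raw phi) a (zeros a xs) -
  (bsum (raw phi) a zinf + z0) = raw phi (block a xs) - z0 +
  (bsum (raw phi) a (zeros a xs) - bsum (raw phi) a zinf) by ring.
apply: le_trans (ler_normD _ _) _; rewrite lerD //.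
apply: le_trans (ler_normB _ _) _; rewrite mulrDl mul1r lerD ?raw_phi_le //.
by rewrite /z0 -to_shift_zinf raw_phi_le.
Qed.

Hypothesis P_eq : \esum_(n in [set: S])
              (expR (psi n - P * (set_val n).+1%:R))%:E = 1%E.

Lemma gap_weight_ge0 a : 0 <= gap_weight a.
Proof. by rewrite /gap_weight; case: ifP => // _; exact: expR_ge0. Qed.

Lemma gap_weight_out a : ~ S a -> gap_weight a = 0.
Proof. by move=> Sa; rewrite /gap_weight asboolF. Qed.

Lemma gap_weight_in a : S a -> gap_weight a = expR (psi_nat a - P * a.+1%:R).
Proof. by move=> Sa; rewrite /gap_weight asboolT. Qed.

Lemma gap_weight_sum : series gap_weight @ \oo --> (1 : R).
Proof.
have : (\sum_(0 <= i <oo) (gap_weight i)%:E = 1)%E.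
  rewrite nneseries_esumT; last by move=> i; rewrite lee_fin gap_weight_ge0.
  rewrite -P_eq (esumID S) //; last by move=> i _; rewrite lee_fin gap_weight_ge0.
  rewrite !setTI [X in (_ + X)%E]esum1 ?adde0; last first.
    by move=> i /= Si; rewrite gap_weight_out.
  rewrite (@reindex_esum _ _ _ [set: S] S set_val).
    by apply: eq_esum => n _; rewrite gap_weight_in ?psi_nat_val //; exact: set_valP.
  split=> [n _|n m _ _|a Sa]; first exact: set_valP.
    exact: val_inj.
  by exists (SigSub (mem_set Sa)).
move=> h; have : (fun n => (series gap_weight n)%:E) @ \oo --> 1%:E.
  rewrite -[X in _ --> X]h.
  have -> : (fun n => (series gap_weight n)%:E) = (fun n => \sum_(0 <= i < n) (gap_weight i)%:E)%E.
    by apply/funext => n; rewrite sumEFin.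
  by apply: is_cvg_nneseries => i _ _; rewrite lee_fin gap_weight_ge0.
by move/fine_cvg.
Qed.

Hypothesis P_gt : finite_set S -> phi (zero_inf S) < P.

(** For infinite [S] the weights [gap_weight] of the gaps tend to 0, which forces
    [P] to exceed the value of the potential at the fixed point. *)
Lemma P_gt_zinf : z0 < P.
Proof.
have [fS|iS] := pselect (finite_set S); first exact: P_gt.
rewrite ltNge; apply/negP => Pz.
have cv0 := cvg_series_cvg_0 (cvgP _ gap_weight_sum).
pose e := expR (- (2 * c + B)).
have /cvgr0Pnorm_lt/(_ _ (expR_gt0 _ : 0 < e))[N _ hN] := cv0.
apply: iS; apply: (sub_finite_set _ (finite_II N)) => a Sa /=.
rewrite ltnNge; apply/negP => Na; have := hN a Na; apply/negP.
rewrite -leNgt ger0_norm ?gap_weight_ge0 // gap_weight_in // ler_expR.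
have := psi_nat_approx Sa; rewrite ler_norml => /andP[h _].
have : P * a.+1%:R <= a.+1%:R * z0 by rewrite mulrC ler_wpM2l.
lra.
Qed.

Lemma gap_weight_tail a :
  gap_weight a <= expR (2 * c + B) * expR (- (P - z0) * a.+1%:R).
Proof.
have [Sa|Sa] := pselect (S a); last by rewrite gap_weight_out // mulr_ge0 // expR_ge0.
rewrite gap_weight_in // -expRD ler_expR.
have := psi_nat_approx Sa; rewrite ler_norml => /andP[_ h]; lra.
Qed.

Lemma correction_block x a : adm x -> x 0%N = true -> S a ->
  expR (bsum (raw phi) a.+1 (block a x) - P * a.+1%:R + correction 1 (block a x)) <=
  gap_weight a * expR (correction 1 x).
Proof.
move=> xS x1 Sa; rewrite gap_weight_in // -expRD ler_expR.
have := correction_step (normr1 R) xS x1 Sa; rewrite mul1r; lra.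
Qed.

End renewal.

(** * Cylinders and Borel sets *)

Section cylinders.
Variable S : set nat.
Local Notation adm := (gap_set S).
Local Notation X := (borel_gap_shift S).

Definition prefix_of (n : nat) (x : X) : seq bool := mkseq (gap_seq x) n.
Arguments prefix_of n%_N x.

Definition cyl (w : seq bool) : set X := [set x | prefix_of (size w) x = w].

Lemma coord_continuous k : continuous (fun x : gap_shift S => gap_seq x k).
Proof.
move=> x; apply: (@continuous_comp (gap_shift S) cantor_space bool
  (fun x : gap_shift S => set_val x) (fun y => y k)).
  exact: (@initial_continuous _ _ (set_val : gap_shift S -> cantor_space)).
exact: (@proj_continuous nat (fun=> bool) k).
Qed.

Lemma open_coord k b : open [set x : gap_shift S | gap_seq x k = b].
Proof.
have /continuousP/(_ [set b]) := @coord_continuous k; apply.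
exact: discrete_open.
Qed.

Lemma cyl_nil : cyl [::] = setT.
Proof. by apply/seteqP; split. Qed.

Lemma cyl_rcons w b :
  cyl (rcons w b) = cyl w `&` [set x | gap_seq x (size w) = b].
Proof.
rewrite /cyl /prefix_of size_rcons; apply/seteqP; split=> x /=.
  by rewrite mkseqS => /rcons_inj[].
by move=> [h1 h2]; rewrite mkseqS h1 h2.
Qed.

Lemma open_cyl w : open (cyl w : set (gap_shift S)).
Proof.
elim/last_ind: w => [|w b IH]; first by rewrite cyl_nil; exact: openT.
by rewrite cyl_rcons; apply: openI => //; exact: open_coord.
Qed.

Lemma measurable_cyl w : measurable (cyl w : set X).
Proof. by apply: sub_sigma_algebra; exact: open_cyl. Qed.

(** A set that contains no cylinder around [x] leaves out a sequence that
    converges to [x]. *)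
Lemma open_cyl_sub (U : set (gap_shift S)) x : open U -> U x ->
  exists n, cyl (prefix_of n x) `<=` U.
Proof.
case=> V oV <- Vx; apply: contrapT => /forallNP h.
have {}h n : exists y : gap_shift S,
    prefix_of n y = prefix_of n x /\ ~ V (set_val y).
  have /existsNP[y /not_implyP[yn yV]] := h n.
  by exists y; split => //; move: yn; rewrite /cyl /= size_mkseq.
have [y hy] := choice h.
have cv : (fun n => set_val (y n) : cantor_space) @ \oo --> (set_val x : cantor_space).
  apply/cvg_sup => k W [T] [[Q] oQ <-] Qx QW; exists k.+1 => // n /= kn; apply: QW.
  rewrite /= /proj; have [/agree_mkseq/(_ _ kn) e _] := hy n.
  by move: Qx; rewrite /= /proj -[set_val x k]/(gap_seq x k) -e.
have [|N _ hN] := cv V; first exact: open_nbhs_nbhs.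
by have [_] := hy N; apply; exact: (hN N (leqnn N)).
Qed.

(** Every open set is a union of cylinders, and there are countably many of them. *)
Lemma borel_ind (E : set (set X)) :
  (forall w, E (cyl w)) -> E set0 -> (forall A, E A -> E (~` A)) ->
  (forall F : (set X)^nat, (forall i, E (F i)) -> E (\bigcup_i F i)) ->
  forall A, measurable A -> E A.
Proof.
move=> Ecyl E0 EC EU; apply: smallest_sub.
  by split => // A EA; rewrite setTD; exact: EC.
move=> U oU; pose F n := if unpickle n is Some w then
  (if `[< cyl w `<=` U >] then cyl w else set0) else set0.
have -> : U = \bigcup_n F n.
  apply/seteqP; split=> [x Ux|x [n _]].
    have [n hn] := open_cyl_sub oU Ux.
    exists (pickle (prefix_of n x)) => //; rewrite /F pickleK.
    by rewrite asboolT // /cyl /= size_mkseq.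
  by rewrite /F; case: unpickle => // w; case: asboolP => // h /h.
by apply: EU => n; rewrite /F; case: unpickle => // w; case: asboolP.
Qed.

Lemma measurable_word n (h : pred (seq bool)) :
  measurable [set x : X | h (prefix_of n x)].
Proof.
have -> : [set x : X | h (prefix_of n x)] =
    \big[setU/set0]_(w <- words n | h w) cyl w.
  apply/seteqP; split=> x /=.
    move=> hx; rewrite -bigcup_seq_cond; exists (prefix_of n x).
      by rewrite /= hx mkseq_words.
    by rewrite /cyl /= size_mkseq.
  rewrite -bigcup_seq_cond => -[w /andP[+ hw]]; rewrite mem_words => /eqP wn.
  by rewrite /cyl /= wn => ->.
by apply: bigsetU_measurable => w _; exact: measurable_cyl.
Qed.

Lemma measurable_fun_word d (Y : measurableType d) n (h : seq bool -> Y) :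
  measurable_fun setT (fun x : X => h (prefix_of n x)).
Proof.
move=> _ B mB; rewrite setTI.
have -> : (fun x : X => h (prefix_of n x)) @^-1` B =
    [set x | [pred w | `[< B (h w) >]] (prefix_of n x)].
  by apply/seteqP; split=> x /asboolP.
exact: measurable_word.
Qed.

Lemma prefix_sigma n (x : X) :
  prefix_of n.+1 x = gap_seq x 0%N :: prefix_of n (gap_sigma x : X).
Proof. by rewrite /prefix_of /mkseq /= -[1%N]addn0 iotaDl -map_comp. Qed.

Lemma preimage_sigma_cyl w :
  (@gap_sigma S : X -> X) @^-1` (cyl w) = cyl (false :: w) `|` cyl (true :: w).
Proof.
apply/seteqP; split=> x /=; rewrite /cyl /=.
  move=> h; rewrite prefix_sigma h.
  by case: (gap_seq x 0%N); [right|left].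
by case; rewrite prefix_sigma => -[_].
Qed.

Lemma measurable_gap_sigma :
  measurable_fun setT (@gap_sigma S : X -> X).
Proof.
move=> _; apply: borel_ind => [w||A|F].
- rewrite setTI preimage_sigma_cyl.
  by apply: measurableU; exact: measurable_cyl.
- by rewrite preimage_set0 setI0.
- by rewrite !setTI preimage_setC => mA; exact: measurableC.
- move=> mF; rewrite setTI preimage_bigcup; apply: bigcup_measurable => i _.
  by have := mF i; rewrite setTI.
Qed.

Lemma cylI u v : cyl u `&` cyl v = set0 \/ exists w, cyl u `&` cyl v = cyl w.
Proof.
wlog uv : u v / (size u <= size v)%N.
  move=> h; case: (leqP (size u) (size v)) => [|/ltnW] uv; first exact: h.
  by rewrite setIC; exact: h.
have tk (x : X) : mkseq (gap_seq x) (size u) = take (size u) (mkseq (gap_seq x) (size v)).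
  by have := @mkseq_sshift (gap_seq x) 0 (size u) (size v) uv; rewrite drop0 sshift0.
have [tv|tv] := eqVneq (take (size u) v) u.
  right; exists v; apply/seteqP; split=> [x []//|x xv]; split=> //.
  by rewrite /cyl /= /prefix_of tk -[in RHS]tv; congr take.
left; apply/seteqP; split=> // x [xu xv]; move/eqP: tv; apply.
by rewrite -[in RHS]xu -[in LHS]xv /prefix_of -tk.
Qed.

Lemma measure_cyl_unique (R : realType)
    (m1 m2 : {measure set X -> \bar R}) :
  (m1 setT < +oo)%E -> (forall w, m1 (cyl w) = m2 (cyl w)) ->
  forall A, measurable A -> m1 A = m2 A.
Proof.
move=> fin12 e12 A mA.
pose G : set (set X) := [set A | A = set0 \/ exists w, A = cyl w].
have Gm : G `<=` measurable.
  by move=> _ [->|[w ->]]; [exact: measurable0|exact: measurable_cyl].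
apply: (@g_sigma_algebra_measure_unique _ R X G Gm (fun=> setT)).
- by move=> i; right; exists [::]; rewrite cyl_nil.
- by apply/seteqP; split=> // x _; exists 0%N.
- move=> _ _ [->|[u ->]] [->|[v ->]]; rewrite ?set0I ?setI0; try by left.
  by have [->|[w ->]] := cylI u v; [left|right; exists w].
- by move=> _ [->|[w ->]]; [rewrite !measure0|exact: e12].
- by [].
move: A mA; apply: borel_ind => [w||B|F].
- by apply: sub_sigma_algebra; right; exists w.
- exact: sigma_algebra0.
- by move=> hB; rewrite -setTD; exact: sigma_algebraCD.
- by move=> hF; exact: sigma_algebra_bigcup.
Qed.

Section approximation.
Context (R : realType) (mu : probability X R).

Let Delta (A B : set X) := (A `\` B) `|` (B `\` A).

Let word_set n (h : pred (seq bool)) : set X := [set x | h (prefix_of n x)].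

Let approx (A : set X) := measurable A /\ forall e : R, 0 < e ->
  exists n, forall m, (n <= m)%N ->
  exists h, (mu (Delta A (word_set m h)) <= e%:E)%E.

Let mDelta A B : measurable A -> measurable B -> measurable (Delta A B).
Proof. by move=> mA mB; apply: measurableU; exact: measurableD. Qed.

Let approxC A : approx A -> approx (~` A).
Proof.
move=> [mA hA]; split; first exact: measurableC.
move=> e e0; have [n hn] := hA e e0; exists n => m nm.
have [h hh] := hn m nm; exists (predC h); apply: le_trans hh.
rewrite le_eqVlt; apply/orP; left; apply/eqP; congr (mu _).
have -> : word_set m (predC h) = ~` word_set m h.
  by apply/seteqP; split=> x /= /negP.
by rewrite /Delta !setDE !setCK setUC [~` A `&` _]setIC [~` _ `&` A]setIC.
Qed.

Let approxU A B : approx A -> approx B -> approx (A `|` B).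
Proof.
move=> [mA hA] [mB hB]; split; first exact: measurableU.
move=> e e0; have e2 : 0 < e / 2 by rewrite divr_gt0.
have [n1 hn1] := hA _ e2; have [n2 hn2] := hB _ e2.
exists (maxn n1 n2) => m; rewrite geq_max => /andP[/hn1[h1 H1] /hn2[h2 H2]].
exists (predU h1 h2).
have m1 := measurable_word m h1; have m2 := measurable_word m h2.
have m3 := measurable_word m (predU h1 h2).
apply: (@le_trans _ _ (mu (Delta A (word_set m h1) `|` Delta B (word_set m h2)))).
  apply: le_measure; rewrite ?inE; [|apply: measurableU|].
  - by apply: mDelta => //; exact: measurableU.
  - exact: mDelta.
  - exact: mDelta.
  move=> x [[[Ax|Bx] hx]|[/orP[hx|hx] nAB]].
  - left; left; split=> // h; apply: hx.
    by apply/orP; left.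
  - right; left; split=> // h; apply: hx.
    by apply/orP; right.
  - by left; right; split=> // Ax; apply: nAB; left.
  - by right; right; split=> // Bx; apply: nAB; right.
apply: le_trans (measureU2 _ _ _) _; [exact: mDelta..|].
by rewrite [e in e%:E]splitr EFinD leeD.
Qed.

Let approx0 : approx set0.
Proof.
split=> // e e0; exists 0%N => m _; exists pred0.
have -> : Delta set0 (word_set m pred0) = set0.
  by apply/seteqP; split=> // x [[]|[]].
by rewrite measure0 lee_fin ltW.
Qed.

(** The sets that can be approximated form a sigma-algebra.  Any large length is
    allowed, so that finitely many sets can be approximated at a common one. *)
Lemma borel_approx A : measurable A -> forall e : R, 0 < e ->
  exists n, forall m, (n <= m)%N -> exists h : pred (seq bool),
    (mu ((A `\` [set x | h (prefix_of m x)]) `|`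
         ([set x | h (prefix_of m x)] `\` A)) <= e%:E)%E.
Proof.
move=> mA; suff [] : approx A by [].
move: A mA; apply: borel_ind => [w||A|F hF]; [|exact: approx0|exact: approxC|].
  split=> [|e e0]; first exact: measurable_cyl.
  exists (size w) => m wm; exists (fun u => take (size w) u == w).
  rewrite (_ : Delta _ _ = set0) ?measure0 ?lee_fin ?ltW //.
  have -> : word_set m (fun u => take (size w) u == w) = cyl w.
    rewrite /word_set /cyl /prefix_of; apply/seteqP; split=> x /=.
      by rewrite -[X in take _ X]drop0 -mkseq_sshift // => /eqP.
    by rewrite -[X in take _ X]drop0 -mkseq_sshift // => ->.
  by rewrite /Delta setDv setU0.
have mF i : measurable (F i) by case: (hF i).
pose G n := \bigcup_(i < n) F i.
have mG n : measurable (G n) by apply: bigcup_measurable => i _; exact: mF.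
have aG n : approx (G n).
  elim: n => [|n IH]; first by rewrite /G bigcup_mkord big_ord0; exact: approx0.
  by rewrite /G bigcup_mkord big_ord_recr /= -bigcup_mkord; exact: approxU.
have GF : \bigcup_n G n = \bigcup_i F i.
  apply/seteqP; split=> x; first by move=> [n _ [i _ Fi]]; exists i.
  by move=> [i _ Fi]; exists i.+1 => //; exists i => /=.
have mU : measurable (\bigcup_i F i) by apply: bigcup_measurable => i _; exact: mF.
have sub N : G N `<=` \bigcup_i F i by move=> x [i _ Fi]; exists i.
split=> // e e0; have e2 : 0 < e / 2 by rewrite divr_gt0.
have cv : mu \o G @ \oo --> mu (\bigcup_i F i).
  rewrite -GF; apply: nondecreasing_cvg_mu => //; first by rewrite GF.
  move=> n m nm; apply/subsetPset => x [i /= ni Fi].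
  by exists i => //=; exact: leq_trans ni nm.
have [N hN] : exists N, (mu ((\bigcup_i F i) `\` G N) <= (e / 2)%:E)%E.
  have cf : fine \o (mu \o G) @ \oo --> fine (mu (\bigcup_i F i)).
    by apply: fine_cvg; rewrite fineK //; exact: fin_num_measure.
  have /cvgrPdist_le/(_ _ e2)[N _ hN] := cf.
  exists N; have {}hN := hN N (leqnn N).
  rewrite /= measureD // ?setIidr //; last first.
    by rewrite ltey_eq fin_num_measure.
  have muU : mu (\bigcup_i F i) = (fine (mu (\bigcup_i F i)))%:E.
    by rewrite fineK // fin_num_measure.
  have muG : mu (G N) = (fine (mu (G N)))%:E by rewrite fineK // fin_num_measure.
  have h : ((fine (mu (\bigcup_i F i)))%:E - (fine (mu (G N)))%:E <= (e / 2)%:E)%E.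
    by rewrite -EFinB lee_fin; exact: le_trans (ler_norm _) hN.
  by rewrite -muU -muG in h; exact: h.
have [_ /(_ _ e2)[n hn]] := aG N; exists n => m /hn[h hh]; exists h.
have mh := measurable_word m h.
apply: (@le_trans _ _ (mu (((\bigcup_i F i) `\` G N) `|` Delta (G N) (word_set m h)))).
  apply: le_measure; rewrite ?inE; [exact: mDelta| |].
    by apply: measurableU; [exact: measurableD|exact: mDelta].
  move=> x [[Fx hx]|[hx Fx]].
    by have [Gx|Gx] := pselect (G N x); [right; left|left].
  by right; right; split => // /sub.
apply: le_trans (measureU2 _ _ _) _; [exact: measurableD|exact: mDelta|].
by rewrite [e in e%:E]splitr EFinD leeD.
Qed.

End approximation.
End cylinders.

(** * Integrals of functions of finitely many coordinates *)

Section limn_esup.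
Variable R : realType.
Implicit Types (u : (\bar R)^nat) (c : R).

Lemma limn_esup_le u c : (forall e : R, 0 < e -> exists N, forall n, (N <= n)%N ->
  (u n <= (c + e)%:E)%E) -> (limn_esup u <= c%:E)%E.
Proof.
move=> h; apply/lee_addgt0Pr => e e0; have [N hN] := h e e0.
apply: (@le_trans _ _ (ereal_sup [set u n | n in [set n | (N <= n)%N]])).
  by apply: ereal_inf_lbound; exists [set n | (N <= n)%N] => //; exists N.
by rewrite -EFinD; apply: ge_ereal_sup => _ [n /= Nn <-]; exact: hN.
Qed.

Lemma limn_esup_ge u c : (forall e : R, 0 < e -> exists N, forall n, (N <= n)%N ->
  ((c - e)%:E <= u n)%E) -> (c%:E <= limn_esup u)%E.
Proof.
move=> h; apply/lee_subgt0Pr => e e0; have [N hN] := h e e0.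
apply: le_ereal_inf_tmp => _ [V [m _ mV] <-].
apply: (@le_trans _ _ (u (maxn N m))).
  by rewrite -EFinB; apply: hN; exact: leq_maxl.
by apply: ereal_sup_ubound; exists (maxn N m) => //; apply: mV; exact: leq_maxr.
Qed.

Lemma eventually_small (K e : R) : 0 < e ->
  exists N, forall n, (N <= n)%N -> (0 < n)%N /\ K / n%:R <= e.
Proof.
move=> e0; exists (Num.truncn (`|K| / e)).+1 => n hn.
have n0 : (0 < n)%N by apply: leq_trans hn.
split=> //; rewrite ler_pdivrMr ?ltr0n // mulrC -ler_pdivrMr //.
apply: (@le_trans _ _ (`|K| / e)).
  by rewrite ler_wpM2r ?ler_norm // invr_ge0 ltW.
apply: le_trans (ltW (truncnS_gt _)) _; rewrite ler_nat //.
Qed.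

End limn_esup.

Section integration.
Context d (T : measurableType d) (R : realType) (mu : probability T R).
Implicit Types f g : T -> R.

Lemma integrable_bounded f B : measurable_fun setT f ->
  (forall x, `|f x| <= B) -> mu.-integrable setT (EFin \o f).
Proof.
move=> mf fB; apply: measurable_bounded_integrable => //.
  by rewrite -ge0_fin_numE // fin_num_measure.
exists B; split; first exact: num_real.
by move=> b Bb x _; apply: le_trans (fB x) (ltW Bb).
Qed.

Lemma integrable_cstR (c : R) : mu.-integrable setT (EFin \o (fun=> c)).
Proof. by apply: (@integrable_bounded _ `|c|) => // x; exact: lexx. Qed.

Lemma Rintegral_sum (I : Type) (r : seq I) (F : I -> T -> R) :
  (forall i, mu.-integrable setT (EFin \o F i)) ->
  \int[mu]_x (\sum_(i <- r) F i x) = \sum_(i <- r) \int[mu]_x F i x.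
Proof.
move=> iF; elim: r => [|i r IH].
  rewrite big_nil; under [LHS]eq_Rintegral => x _ do rewrite big_nil.
  by rewrite Rintegral_cst // mul0r.
rewrite big_cons -IH -RintegralD //.
  by apply: eq_Rintegral => x _; rewrite big_cons.
have := @integrable_sum _ _ _ mu setT measurableT _ r xpredT
  (fun i => EFin \o F i) (fun i _ => iF i).
by apply: eq_integrable => // x _; rewrite /= sumEFin.
Qed.

Lemma Rintegral1 : \int[mu]_x 1 = 1 :> R.
Proof.
rewrite Rintegral_cst // mul1r -[RHS]/(fine 1%E); congr fine.
exact: probability_setT.
Qed.

Lemma Rintegral_indic (A : set T) : measurable A ->
  \int[mu]_x \1_A x = fine (mu A) :> R.
Proof. by move=> mA; rewrite /Rintegral integral_indic // setIT. Qed.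

Lemma integrable_indicR (A : set T) : measurable A ->
  mu.-integrable setT (EFin \o (\1_A : T -> R)).
Proof.
move=> mA; apply: (@integrable_bounded _ 1); first exact: measurable_indic.
by move=> x; rewrite indicE; case: (x \in A); rewrite ?normr1 ?normr0.
Qed.

Section labels.
Context (I : eqType) (r : seq I) (k : T -> I).
Hypotheses (r_uniq : uniq r) (k_in : forall x, k x \in r).
Hypothesis mk : forall i, measurable (k @^-1` [set i]).

Lemma label_sum (h : I -> R) x :
  h (k x) = \sum_(i <- r) h i * \1_(k @^-1` [set i]) x.
Proof.
rewrite (bigD1_seq (k x)) //= indicE mem_set // mulr1 big1 ?addr0 // => i ik.
by rewrite indicE memNset ?mulr0 // => /= ki; move: ik; rewrite -ki eqxx.
Qed.

(** Integrals of finitely valued functions; [r] lists the values so that words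
    as well as finite types can serve as labels. *)
Lemma Rintegral_label (h : I -> R) :
  \int[mu]_x h (k x) = \sum_(i <- r) h i * fine (mu (k @^-1` [set i])).
Proof.
under [LHS]eq_Rintegral => x _ do rewrite label_sum.
have iI i : mu.-integrable setT (EFin \o (fun x => h i * \1_(k @^-1` [set i]) x)).
  by have := integrableZl measurableT (h i) (integrable_indicR (mk i)).
rewrite Rintegral_sum //; apply: eq_bigr => i _.
by rewrite RintegralZl // ?Rintegral_indic //; exact: integrable_indicR.
Qed.

Lemma measurable_label (h : I -> R) : measurable_fun setT (fun x => h (k x)).
Proof.
under eq_fun do rewrite label_sum.
by apply: measurable_sum => i; apply: measurable_funM => //; exact: measurable_indic.
Qed.

Lemma integrable_label (h : I -> R) :
  mu.-integrable setT (EFin \o (fun x => h (k x))).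
Proof.
apply: (@integrable_bounded _ (\sum_(i <- r) `|h i|)); first exact: measurable_label.
move=> x; rewrite (bigD1_seq (k x)) //= lerDl.
by apply: sumr_ge0.
Qed.

End labels.
End integration.

Section entropy_cross.
Variables (R : realType) (I : finType) (m q : I -> R).
Hypotheses (m_ge0 : forall i, 0 <= m i) (m_sum : \sum_i m i = 1).
Hypotheses (q_ge0 : forall i, 0 <= q i) (q_sum : \sum_i q i <= 1).
Hypothesis q_gt0 : forall i, 0 < m i -> 0 < q i.

(** Gibbs' inequality, from [ln x <= x - 1]. *)
Lemma entropy_le_cross :
  - \sum_i m i * ln (m i) <= \sum_i (- ln (q i)) * m i.
Proof.
rewrite -subr_ge0 opprK -big_split /=.
apply: (@le_trans _ _ (\sum_i (m i - q i))).
  by rewrite sumrB m_sum subr_ge0.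
apply: ler_sum => i _; have := m_ge0 i; rewrite le_eqVlt => /predU1P[<-|mi].
  by rewrite mulr0 mul0r addr0 sub0r oppr_le0.
have qi := q_gt0 mi.
have : ln (1 + (q i / m i - 1)) <= q i / m i - 1.
  by apply: le_ln1Dx; rewrite ltrBrDr addNr divr_gt0.
rewrite [1 + _]addrC subrK ln_div ?posrE // => h.
have : m i * (ln (q i) - ln (m i)) <= m i * (q i / m i - 1).
  by apply: ler_wpM2l => //; exact: ltW.
by rewrite [m i * (_ / _ - _)]mulrBr mulr1 mulrCA divff ?gt_eqF // mulr1; lra.
Qed.

End entropy_cross.

Section prefix_functions.
Context (S : set nat) (R : realType) (theta : R).
Hypotheses (theta_gt0 : 0 < theta) (theta_lt1 : theta < 1).
Local Notation X := (borel_gap_shift S).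
Local Notation adm := (gap_set S).

Definition holder_fun (B : R) (g : X -> R) :=
  (forall x, `|g x| <= B) /\
  forall n (x y : X), agree n (gap_seq x) (gap_seq y) ->
    `|g x - g y| <= B * theta ^+ n.

Lemma holder_fun_Ctheta (f : gap_shift S -> R) : Ctheta theta f ->
  holder_fun (fine (holder_norm theta f)) f.
Proof.
by move=> hf; split=> [x|n x y xy]; [exact: Ctheta_le|exact: Ctheta_holder].
Qed.

Lemma holder_fun_lin B C g h (t : R) : holder_fun B g -> holder_fun C h ->
  holder_fun (B + `|t| * C) (fun x => g x + t * h x).
Proof.
move=> [g1 g2] [h1 h2]; split=> [x|n x y xy].
  by apply: le_trans (ler_normD _ _) _; rewrite lerD // normrM ler_wpM2l.
have -> : g x + t * h x - (g y + t * h y) = (g x - g y) + t * (h x - h y) by ring.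
apply: le_trans (ler_normD _ _) _; rewrite mulrDl lerD ?g2 // normrM -mulrA.
by rewrite ler_wpM2l ?h2.
Qed.

Lemma holder_fun_raw B g : holder_fun B g -> holder_on S theta B (raw g).
Proof. by move=> [_ g2] n x y xS yS xy; apply: g2; rewrite !to_shiftK. Qed.

Lemma expr_small (e : R) B : 0 < e -> exists N, B * theta ^+ N <= e.
Proof.
move=> e0; have t1 : `|theta| < 1 by rewrite gtr0_norm.
have /cvgr0Pnorm_le/(_ _ e0)[N _ hN] := @cvg_geometric R B theta t1.
by exists N; apply: le_trans (ler_norm _) (hN N _) => /=.
Qed.

(** A Hoelder function is the limit of its values at the sequences that are cut
    after [n] symbols and continued with zeros. *)
Lemma measurable_holder B g : holder_fun B g -> measurable_fun setT g.
Proof.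
move=> [g1 g2]; apply/measurable_EFinP.
apply: (@emeasurable_fun_cvg _ _ _ _ (fun n x =>
  (raw g (catw (prefix_of n x) zinf))%:E)).
  by move=> n; apply/measurable_EFinP;
     exact: (measurable_fun_word n (fun w => raw g (catw w zinf))).
move=> x _; apply/fine_cvgP; split; first exact: nearW.
apply/cvgrPdist_le => e e0; have [N hN] := expr_small B e0.
exists N => // n /= Nn; apply: le_trans hN.
have B0 : 0 <= B by apply: le_trans (normr_ge0 _) (g1 x).
apply: (@le_trans _ _ (B * theta ^+ n)); last first.
  by rewrite ler_wpM2l // ler_wiXn2l // ltW.
have aS := @adm_catw_zinf S (gap_seq x) n (@gap_seqP S x).
rewrite /raw; apply: (g2 n x (to_shift S _)); rewrite to_shiftK //.
by apply: agree_sym; exact: agree_catw_mkseq.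
Qed.

Variable mu : probability X R.
Hypothesis mu_inv : invariant_measure mu (@gap_sigma S).

Lemma integrable_holder B g : holder_fun B g ->
  mu.-integrable setT (EFin \o g).
Proof.
by move=> hg; apply: (integrable_bounded _ (measurable_holder hg)); case: hg.
Qed.

Lemma measurable_iter_sigma n :
  measurable_fun setT (iter n (@gap_sigma S) : X -> X).
Proof.
elim: n => [|n IH] /=; first exact: measurable_id.
exact: (measurableT_comp (@measurable_gap_sigma S) IH).
Qed.

Lemma mu_iter_sigma n A : measurable A ->
  mu ((iter n (@gap_sigma S) : X -> X) @^-1` A) = mu A.
Proof.
elim: n A => // n IH A mA; rewrite -[RHS]mu_inv // -[RHS]IH //.
by have := @measurable_gap_sigma S measurableT A mA; rewrite setTI.
Qed.

Lemma Rintegral_sigma n B g : holder_fun B g ->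
  \int[mu]_x g (iter n (@gap_sigma S) x) = \int[mu]_x g x.
Proof.
move=> hg; have mn := measurable_iter_sigma n.
have mg := measurable_holder hg.
have ig : mu.-integrable ((iter n (@gap_sigma S) : X -> X) @^-1` setT)
    ((EFin \o g) \o (iter n (@gap_sigma S) : X -> X)).
  rewrite preimage_setT; apply: (@integrable_bounded _ _ _ _ _ B).
    exact: (measurableT_comp mg mn).
  by move=> x; case: hg.
have mEg : measurable_fun setT (EFin \o g) by exact/measurable_EFinP.
have h := integral_pushforward mn mEg ig measurableT.
rewrite preimage_setT in h; rewrite /Rintegral; congr fine.
apply: etrans (esym h) _.
by apply: eq_measure_integral => A mA _; exact: mu_iter_sigma.
Qed.

Lemma bsum_gap_seq (g : X -> R) n x :
  bsum (raw g) n (gap_seq x) = \sum_(j < n) g (iter j (@gap_sigma S) x).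
Proof. by apply: eq_bigr => j _; rewrite /raw -gap_seq_iter gap_seqK. Qed.

Lemma integrable_iter B g n : holder_fun B g ->
  mu.-integrable setT (EFin \o (fun x => g (iter n (@gap_sigma S) x))).
Proof.
move=> hg; apply: (@integrable_bounded _ _ _ _ _ B); last by case: hg.
exact: (measurableT_comp (measurable_holder hg) (measurable_iter_sigma n)).
Qed.

Lemma integrable_bsum B g n : holder_fun B g ->
  mu.-integrable setT (EFin \o (fun x => bsum (raw g) n (gap_seq x))).
Proof.
move=> hg; apply: (@integrable_bounded _ _ _ _ _ (\sum_(j < n) B)).
  under eq_fun do rewrite bsum_gap_seq.
  apply: measurable_sum => j.
  exact: (measurableT_comp (measurable_holder hg) (measurable_iter_sigma j)).
move=> x; rewrite bsum_gap_seq; apply: le_trans (ler_norm_sum _ _ _) _.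
by apply: ler_sum => j _; case: hg.
Qed.

Lemma Rintegral_bsum B g n : holder_fun B g ->
  \int[mu]_x bsum (raw g) n (gap_seq x) = n%:R * \int[mu]_x g x.
Proof.
move=> hg; under [LHS]eq_Rintegral => x _ do rewrite bsum_gap_seq.
rewrite Rintegral_sum; last by move=> j; exact: integrable_iter hg.
rewrite (eq_bigr (fun=> \int[mu]_x g x)); last first.
  by move=> j _; exact: Rintegral_sigma hg.
by rewrite sumr_const card_ord mulr_natl.
Qed.

End prefix_functions.

(** * Upper bound for the entropy *)

Section entropy_upper.
Context (S : set nat) (R : realType) (theta : R).
Hypotheses (theta_gt0 : 0 < theta) (theta_lt1 : theta < 1).
Local Notation X := (borel_gap_shift S).
Local Notation adm := (gap_set S).
Local Notation sigma := (@gap_sigma S : X -> X).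
Variable mu : probability X R.
Hypothesis mu_inv : invariant_measure mu sigma.
Variables (g : X -> R) (B : R).
Hypothesis hg : holder_fun theta B g.
Variables (K rho : R).
Hypothesis K_gt0 : 0 < K.
Hypothesis Z_le : forall n, partition_fun S (raw g) n zinf <= K * expR (n%:R * rho).

Let B_ge0 : 0 <= B.
Proof. by case: hg => h _; apply: le_trans (h (zero_inf S)). Qed.

Section partition.
Variables (k : nat) (xi : 'I_k -> set X).
Hypothesis xiP : measurable_partition xi.

Let cover x : exists i, xi i x.
Proof.
have [_ _ xiT] := xiP; have : [set: X] x by [].
by rewrite -xiT => -[i _ xix]; exists i.
Qed.

Let lab (x : X) : 'I_k := projT1 (cid (cover x)).

Let labP x i : xi i x <-> lab x = i.
Proof.
have lx : xi (lab x) x by exact: projT2 (cid (cover x)).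
split=> [xix|<- //]; have [_ tI _] := xiP.
by apply: (tI _ _ I I); exists x.
Qed.

Let name n (x : X) : {ffun 'I_n -> 'I_k} :=
  [ffun i : 'I_n => lab (iter i sigma x)].

Lemma join_cellE n w : join_cell sigma xi w = (name n) @^-1` [set w].
Proof.
apply/seteqP; split=> x /=.
  by move=> h; apply/ffunP => i; rewrite ffunE; apply/labP.
by move=> <- i; rewrite ffunE; apply/labP.
Qed.

Lemma measurable_join_cell n (w : {ffun 'I_n -> 'I_k}) :
  measurable (join_cell sigma xi w).
Proof.
have [mxi _ _] := xiP.
have -> : join_cell sigma xi w =
    \bigcap_(i in [set: 'I_n]) ((iter i sigma) @^-1` xi (w i)).
  by apply/seteqP; split=> x /= h i; [move=> _|]; exact: h.
apply: fin_bigcap_measurable => // i _.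
by have := @measurable_iter_sigma S i measurableT _ (mxi (w i)); rewrite setTI.
Qed.

Variables (N : nat) (best : seq bool -> 'I_k) (delta : R).
Hypotheses (delta_gt0 : 0 < delta) (delta_lt1 : delta < 1).

Definition mislabeled : set X := [set x | lab x <> best (prefix_of N x)].

Lemma measurable_mislabeled : measurable mislabeled.
Proof.
have [mxi _ _] := xiP.
have -> : mislabeled = \bigcup_(i in [set: 'I_k])
    (xi i `&` [set x | [pred u | best u != i] (prefix_of N x)]).
  apply/seteqP; split=> x /=.
    move=> h; exists (lab x) => //; split; first exact/labP.
    by apply/eqP => e; apply: h.
  by move=> [i _ [/labP <- /= /eqP]]; rewrite /mislabeled /= => + e; rewrite e.
apply: fin_bigcup_measurable => // i _.
by apply: measurableI => //; exact: measurable_word.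
Qed.

Let k_gt0 : (0 < k)%N.
Proof. by case: (lab (zero_inf S)) => i; exact: leq_ltn_trans. Qed.

Let dk_gt0 : 0 < delta / k%:R.
Proof. by rewrite divr_gt0 // ltr0n. Qed.

Let dk_lt1 : delta / k%:R <= 1.
Proof.
rewrite ler_pdivrMr ?ltr0n // mul1r (le_trans (ltW delta_lt1)) //.
by rewrite ler1n.
Qed.

(** The law of a guessed label, given [N] symbols; mixing in the uniform law
    keeps the cost of a wrong guess finite. *)
Let guess (j : 'I_k) (u : seq bool) : R :=
  (1 - delta) * (j == best u)%:R + delta / k%:R.

Let guess_sum u : \sum_j guess j u = 1.
Proof.
rewrite /guess big_split /= -mulr_sumr sumr_const card_ord -[_ *+ k]mulr_natr.
rewrite divfK ?pnatr_eq0 -?lt0n // (bigD1 (best u)) //= eqxx big1 ?addr0.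
  by rewrite (_ : true%:R = 1) // mulr1 subrK.
by move=> j /negbTE ->.
Qed.

Let a : R := - ln (1 - delta).
Let b : R := - ln (delta / k%:R).
Let loss (x : X) : R := a + b * \1_mislabeled x.

Let guess_ge (x : X) : expR (- loss x) <= guess (lab x) (prefix_of N x).
Proof.
rewrite /loss /guess indicE; case: (boolP (x \in mislabeled)) => hx.
  have -> : (lab x == best (prefix_of N x)) = false.
    by apply/eqP; move: hx; rewrite inE.
  rewrite mulr0 add0r mulr1 -[leRHS]lnK ?posrE // ler_expR.
  have : ln (1 - delta) <= 0 by rewrite ln_le0 // gerBl ltW.
  rewrite /a /b; lra.
have -> : (lab x == best (prefix_of N x)) = true.
  by apply/eqP; apply: contrapT => h; move/negP: hx; apply; rewrite inE.
rewrite mulr0 addr0 !mulr1 /a opprK lnK ?posrE ?subr_gt0 //.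
by rewrite lerDl ltW.
Qed.

Let guesses n (w : {ffun 'I_n -> 'I_k}) (v : seq bool) : R :=
  \prod_(i < n) guess (w i) (take N (drop i v)).

Let guess_gt0 j u : 0 < guess j u.
Proof. by rewrite ltr_wpDl // mulr_ge0 // subr_ge0 ltW. Qed.

Let guesses_ge n (x : X) :
  expR (- \sum_(i < n) loss (iter i sigma x)) <=
  guesses (name n x) (prefix_of (n + N) x).
Proof.
rewrite -sumrN expR_sum; apply: ler_prod => i _.
rewrite expR_ge0 /= ffunE /prefix_of -mkseq_sshift.
  by rewrite -gap_seq_iter; exact: guess_ge.
by rewrite leq_add2r ltnW.
Qed.

Let guesses_sum n v : \sum_(w : {ffun 'I_n -> 'I_k}) guesses w v = 1.
Proof.
rewrite /guesses -(bigA_distr_bigA (fun (i : 'I_n) j => guess j (take N (drop i v)))).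
by rewrite big1 // => i _; rewrite guess_sum.
Qed.

Let Z n := partition_fun S (raw g) n zinf.

Let Q n (v : seq bool) : R :=
  if `[< adm (catw v zinf) >] then expR (bsum (raw g) n (catw v zinf)) / Z n else 0.

Let Q_ge0 n v : 0 <= Q n v.
Proof.
by rewrite /Q; case: ifP => // _; rewrite divr_ge0 ?expR_ge0 // partition_fun_ge0.
Qed.

Let Q_sum n : \sum_(v <- words n) Q n v <= 1.
Proof.
rewrite /Q -big_mkcond /= -mulr_suml.
have [->|Z0] := eqVneq (Z n) 0; first by rewrite invr0 mulr0.
by rewrite -/(partition_fun S (raw g) n zinf) -/(Z n) divff.
Qed.

Let Q_ge n (x : X) :
  expR (bsum (raw g) n (gap_seq x) - B / (1 - theta) - ln K - n%:R * rho) <=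
  Q n (prefix_of n x).
Proof.
have xS := @gap_seqP S x; have aS := @adm_catw_zinf S (gap_seq x) n xS.
rewrite /Q asboolT //.
have Zn : 0 < Z n.
  rewrite /Z /partition_fun big_mkcond (bigD1_seq (prefix_of n x)) ?mkseq_words ?uniq_words //=.
  rewrite asboolT // ltr_pwDl ?expR_gt0 // sumr_ge0 // => u _.
  by case: ifP => // _; exact: expR_ge0.
rewrite ler_pdivlMr //; apply: le_trans (ler_wpM2l (expR_ge0 _) (Z_le n)) _.
have -> : K * expR (n%:R * rho) = expR (ln K + n%:R * rho).
  by rewrite expRD lnK.
rewrite -expRD ler_expR.
have ag : agree (n + 0) (catw (prefix_of n x) zinf) (gap_seq x).
  by rewrite addn0; exact: agree_catw_mkseq.
have := bsum_holder theta_gt0 theta_lt1 B_ge0 (holder_fun_raw hg) aS xS ag.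
rewrite expr0 mulr1 ler_norml => /andP[h _]; lra.
Qed.

(** Gibbs' inequality for the following law on names of length [n]: choose a word
    of length [n + N] with probability proportional to [expR (bsum g)], then
    guess the label at time [i] from the symbols [i .. i + N - 1].  The word
    costs [ln (partition_fun)] minus the sum of [g], and each guess costs [a],
    plus [b] when it is wrong. *)
Lemma join_entropy_le n :
  join_entropy mu sigma xi n <= ln K + B / (1 - theta) +
    (n + N)%:R * (rho - \int[mu]_x g x) + n%:R * (a + b * fine (mu mislabeled)).
Proof.
pose m (w : {ffun 'I_n -> 'I_k}) := fine (mu (join_cell sigma xi w)).
pose q (w : {ffun 'I_n -> 'I_k}) := \sum_(v <- words (n + N)) Q (n + N) v * guesses w v.
pose cost (x : X) := ln K + B / (1 - theta) + (n + N)%:R * rho -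
  bsum (raw g) (n + N) (gap_seq x) + \sum_(i < n) loss (iter i sigma x).
have guesses0 w v : 0 <= guesses w v.
  by move=> *; apply: prodr_ge0 => i _; rewrite ltW.
have q_ge (x : X) : expR (- cost x) <= q (name n x).
  rewrite /q (bigD1_seq (prefix_of (n + N) x)) /= ?mkseq_words ?uniq_words //.
  apply: (@le_trans _ _ (Q (n + N) (prefix_of (n + N) x) *
      guesses (name n x) (prefix_of (n + N) x))); last first.
    by rewrite lerDl sumr_ge0 // => v _; rewrite mulr_ge0.
  apply: le_trans (ler_pM (expR_ge0 _) (expR_ge0 _) (Q_ge _ x) (guesses_ge n x)).
  by rewrite -expRD ler_expR /cost; lra.
have fib w : measurable (name n @^-1` [set w]).
  by rewrite -join_cellE; exact: measurable_join_cell.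
have lblE (h : {ffun 'I_n -> 'I_k} -> R) :
    \int[mu]_x h (name n x) = \sum_w h w * m w.
  rewrite (Rintegral_label mu (index_enum_uniq _) (fun x => mem_index_enum _) fib).
  by apply: eq_bigr => w _; rewrite /m join_cellE.
have m0 w : 0 <= m w by rewrite fine_ge0.
have m1 : \sum_w m w = 1.
  transitivity (\int[mu]_x (1 : R)); last exact: Rintegral1.
  by rewrite (lblE (fun=> 1)); apply: eq_bigr => w _; rewrite mul1r.
have q0 w : 0 <= q w by apply: sumr_ge0 => v _; rewrite mulr_ge0.
have q1 : \sum_w q w <= 1.
  rewrite /q exchange_big /=; apply: le_trans (Q_sum (n + N)).
  by apply: ler_sum => v _; rewrite -mulr_sumr guesses_sum mulr1.
have qpos w : 0 < m w -> 0 < q w.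
  move=> mw; have [x hx] : join_cell sigma xi w !=set0.
    by apply/set0P/eqP => e; move: mw; rewrite /m e measure0 ltxx.
  move: hx; rewrite join_cellE /= => <-.
  exact: lt_le_trans (expR_gt0 _) (q_ge x).
have := entropy_le_cross m0 m1 q0 q1 qpos.
rewrite -(lblE (fun w => - ln (q w))) => h; apply: le_trans h _.
have mloss : measurable_fun setT loss.
  apply: measurable_funD => //; apply: measurable_funM => //.
  apply: measurable_indic; exact: measurable_mislabeled.
have loss_le x : `|loss x| <= `|a| + `|b|.
  apply: le_trans (ler_normD _ _) _; rewrite lerD2l normrM ler_piMr //.
  by rewrite indicE; case: (_ \in _); rewrite ?normr1 ?normr0.
have iloss i : mu.-integrable setT (EFin \o (fun x => loss (iter i sigma x))).
  apply: (integrable_bounded _ _ (fun x => loss_le _)).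
  exact: (measurableT_comp mloss (@measurable_iter_sigma S i)).
have isum : mu.-integrable setT
    (EFin \o (fun x => \sum_(i < n) loss (iter i sigma x))).
  apply: (@integrable_bounded _ _ _ _ _ (\sum_(i < n) (`|a| + `|b|))).
    apply: measurable_sum => i.
    exact: (measurableT_comp mloss (@measurable_iter_sigma S i)).
  by move=> x; apply: le_trans (ler_norm_sum _ _ _) _; exact: ler_sum.
have ibsum := integrable_bsum theta_gt0 theta_lt1 mu (n + N) hg.
pose c0 : R := ln K + B / (1 - theta) + (n + N)%:R * rho.
have icst : mu.-integrable setT (EFin \o (fun=> c0)).
  exact: integrable_cstR.
have ib : mu.-integrable setT
    (EFin \o (fun x => c0 - bsum (raw g) (n + N) (gap_seq x))).
  by have := integrableB measurableT icst ibsum; apply: eq_integrable.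
have icost : mu.-integrable setT (EFin \o cost).
  by have := integrableD measurableT ib isum; apply: eq_integrable.
apply: (@le_trans _ _ (\int[mu]_x cost x)).
  apply: le_Rintegral => //.
    exact: (integrable_label mu (index_enum_uniq _) (fun x => mem_index_enum _) fib
      (fun w => - ln (q w))).
  move=> x _; rewrite lerNl -[leLHS]expRK ler_ln ?posrE ?expR_gt0 //.
  exact: lt_le_trans (expR_gt0 _) (q_ge x).
rewrite /cost -/c0 RintegralD // RintegralB //.
rewrite Rintegral_cst // -[fine (mu setT)]mul1r -(@Rintegral_cst _ _ _ mu) // Rintegral1 mulr1.
rewrite (Rintegral_bsum theta_gt0 theta_lt1 mu_inv _ hg) Rintegral_sum //.
rewrite (eq_bigr (fun=> a + b * fine (mu mislabeled))); last first.
  move=> i _; rewrite /loss RintegralD //; last 2 first.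
  - exact: integrable_cstR.
  - apply: (@integrable_bounded _ _ _ _ _ `|b|).
      apply: measurable_funM => //.
      apply: (measurableT_comp _ (@measurable_iter_sigma S i)).
      apply: measurable_indic; exact: measurable_mislabeled.
    move=> x; rewrite normrM ler_piMr // indicE.
    by case: (_ \in _); rewrite ?normr1 ?normr0.
  have mm : measurable (iter i sigma @^-1` mislabeled).
    have := @measurable_iter_sigma S i measurableT _ measurable_mislabeled.
    by rewrite setTI.
  rewrite Rintegral_cst // -[fine (mu setT)]mul1r -(@Rintegral_cst _ _ _ mu) //.
  rewrite Rintegral1 mulr1; congr (_ + _).
  rewrite (@eq_Rintegral _ _ _ _ _ (fun x => b * \1_(iter i sigma @^-1` mislabeled) x)).
    rewrite RintegralZl //; last exact: integrable_indicR.
    by rewrite Rintegral_indic // mu_iter_sigma //; exact: measurable_mislabeled.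
  by move=> x _; rewrite !indicE.
rewrite sumr_const card_ord -mulr_natl /c0; lra.
Qed.

End partition.

(** The guessing cost is made small by first choosing [delta] and then cylinders
    that approximate the cells of the partition well. *)
Lemma entropy_le : (entropy mu sigma <= (rho - \int[mu]_x g x)%:E)%E.
Proof.
apply: ge_ereal_sup => _ [k [xi [xiP ->]]].
apply: limn_esup_le => e e0; have e3 : 0 < e / 3 by rewrite divr_gt0.
have [mxi tI xiT] := xiP.
have k0 : (0 < k)%N.
  have : [set: X] (zero_inf S) by [].
  by rewrite -xiT => -[[i ik] _ _]; exact: leq_ltn_trans ik.
pose delta : R := 1 - expR (- (e / 3)).
have d0 : 0 < delta by rewrite subr_gt0 -[ltRHS]expR0 ltr_expR oppr_lt0.
have d1 : delta < 1 by rewrite ltrBlDr ltrDl expR_gt0.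
pose b := - ln (delta / k%:R).
have b0 : 0 <= b.
  rewrite /b oppr_ge0 ln_le0 // ler_pdivrMr ?ltr0n // mul1r.
  by apply: le_trans (ltW d1) _; rewrite ler1n.
pose er := e / 3 / (k%:R * (b + 1)).
have kb : 0 < k%:R * (b + 1) by rewrite mulr_gt0 ?ltr0n // ltr_wpDl.
have er0 : 0 < er by rewrite divr_gt0.
have [nn hnn] := choice (fun i => borel_approx mu (mxi i) er0).
pose N := (\max_i nn i)%N.
have [h hh] := choice (fun i => hnn i N (leq_bigmax i)).
pose best u := odflt (Ordinal k0) [pick i | h i u].
have bad : fine (mu (mislabeled xiP N best)) <= k%:R * er.
  pose D i := (xi i `\` [set x | h i (prefix_of N x)]) `|`
         ([set x | h i (prefix_of N x)] `\` xi i).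
  have mD i : measurable (D i).
    by apply: measurableU; apply: measurableD => //; exact: measurable_word.
  have mm := measurable_mislabeled xiP N best.
  rewrite -Rintegral_indic //.
  have iD i : mu.-integrable setT (EFin \o (\1_(D i) : X -> R)).
    exact: integrable_indicR.
  apply: (@le_trans _ _ (\int[mu]_x (\sum_i \1_(D i) x))).
    apply: le_Rintegral => //; first exact: integrable_indicR.
      have := integrable_sum measurableT (index_enum 'I_k) (P := xpredT) (fun i _ => iD i).
      by apply: eq_integrable => // x _; rewrite /= sumEFin.
    move=> x _; rewrite indicE; case: (boolP (x \in _)) => [|_]; last first.
      by apply: sumr_ge0 => i _; rewrite indicE.
    rewrite inE => bx.
    suff [i Dx] : exists i, D i x.
      by rewrite (bigD1 i) //= indicE mem_set // lerDl sumr_ge0 // => j _; rewrite indicE.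
    have : [set: X] x by []; rewrite -xiT => -[i _ xix].
    have [hi|hi] := boolP (h i (prefix_of N x)); last first.
      by exists i; left; split=> //=; apply/negP.
    move: bx; rewrite /mislabeled /= /best.
    case: pickP => [j hj|/(_ i)]; last by rewrite hi.
    move=> /= labj; exists j; right; split=> // xjx; apply: labj.
    case: cid => l /= xlx; apply: (tI _ _ I I); by exists x.
  rewrite Rintegral_sum // -[k in k%:R]card_ord -sum1_card natr_sum mulr_suml.
  apply: ler_sum => i _; rewrite mul1r Rintegral_indic //.
  by rewrite -lee_fin fineK ?fin_num_measure //; exact: hh.
set c := rho - \int[mu]_x g x.
have [N1 hN1] := eventually_small (ln K + B / (1 - theta) + N%:R * c) e3.
exists N1 => n /hN1[n0 hn]; rewrite lee_fin.
have n0R : 0 < n%:R :> R by rewrite ltr0n.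
rewrite ler_pdivrMr //; apply: le_trans (join_entropy_le xiP N best d0 d1 n) _.
rewrite ler_pdivrMr // in hn.
have ha : - ln (1 - delta) = e / 3 by rewrite /delta subKr expRK opprK.
have hb : b * fine (mu (mislabeled xiP N best)) <= e / 3.
  apply: le_trans (ler_wpM2l b0 bad) _; rewrite /er.
  rewrite (_ : b * _ = e / 3 * (b / (b + 1))); last first.
    by field; rewrite !gt_eqF ?ltr0n // ltr_wpDl.
  by rewrite ler_piMr ?(ltW e3) // ler_pdivrMr ?mul1r ?lerDl // ltr_wpDl.
rewrite -/c -/b ha natrD mulrDl.
have : n%:R * (e / 3 + b * fine (mu (mislabeled xiP N best))) <= n%:R * (e / 3 + e / 3).
  by rewrite ler_wpM2l // lerD2l.
lra.
Qed.

End entropy_upper.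

(** * Measures on words from consistent weights *)

Section unit_lebesgue.
Variable R : realType.

Definition unit_lebesgue : set (measurableTypeR R) -> \bar R :=
  mrestr lebesgue_measure (@measurable_itv R `[0, 1[).

HB.instance Definition _ := Measure.on unit_lebesgue.

Lemma unit_lebesgue_setT : unit_lebesgue setT = 1%E.
Proof.
rewrite /unit_lebesgue /mrestr setTI lebesgue_measure_itv /= lte_fin ltr01.
by rewrite oppr0 adde0.
Qed.

HB.instance Definition _ :=
  Measure_isProbability.Build _ _ _ unit_lebesgue unit_lebesgue_setT.

End unit_lebesgue.

Section interval_coding.
Context (S : set nat) (R : realType) (q : seq bool -> R).
Local Notation X := (borel_gap_shift S).
Local Notation adm := (gap_set S).
Hypothesis q_ge0 : forall w, 0 <= q w.
Hypothesis q_nil : q [::] = 1.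
Hypothesis q_rcons : forall w, q (rcons w false) + q (rcons w true) = q w.
Hypothesis q_adm : forall x, (forall n, 0 < q (mkseq x n)) -> adm x.

Let left_end (w : seq bool) : R :=
  \sum_(i < size w) if nth false w i then q (rcons (take i w) false) else 0.

Let left_rcons w b : left_end (rcons w b) =
  left_end w + if b then q (rcons w false) else 0.
Proof.
rewrite /left_end size_rcons big_ord_recr /= nth_rcons ltnn eqxx.
rewrite -cats1 take_size_cat //; congr (_ + _); apply: eq_bigr => i _.
by rewrite nth_cat ltn_ord take_cat ltn_ord.
Qed.

(** The words [w] of length [n] cut the unit interval, in lexicographic order,
    into intervals of length [q w]; this is the word whose interval
    contains [u]. *)
Let wd (u : R) := fix wd n : seq bool :=
  if n is m.+1 then rcons (wd m) (left_end (wd m) + q (rcons (wd m) false) <= u)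
  else [::].

Let size_wd u n : size (wd u n) = n.
Proof. by elim: n => //= n IH; rewrite size_rcons IH. Qed.

Let pt (u : R) : binseq := fun k => nth false (wd u k.+1) k.

Let mkseq_pt u n : mkseq (pt u) n = wd u n.
Proof.
elim: n => // n IH; rewrite mkseqS IH /pt /= nth_rcons size_wd ltnn eqxx.
by [].
Qed.

Let inI (w : seq bool) (u : R) := left_end w <= u < left_end w + q w.

Let wd_inI u n : 0 <= u < 1 -> inI (wd u n) u.
Proof.
move=> u01; elim: n => [|n /andP[h1 h2]] /=.
  by rewrite /inI /left_end big_ord0 add0r q_nil.
rewrite /inI left_rcons.
case: (boolP (left_end (wd u n) + q (rcons (wd u n) false) <= u)) => h /=.
  by rewrite h /= -addrA q_rcons.
by rewrite addr0 h1 ltNge.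
Qed.

Let inI_wd w u : inI w u -> wd u (size w) = w.
Proof.
elim/last_ind: w => // w b IH; rewrite /inI left_rcons size_rcons /=.
have q0 := q_ge0 (rcons w false); have q1 := q_ge0 (rcons w true).
have qw := q_rcons w.
case: b => /andP[h1 h2].
  by rewrite IH ?h1 // /inI; apply/andP; split; lra.
rewrite addr0 in h1 h2; rewrite IH; last by rewrite /inI; apply/andP; split; lra.
by rewrite leNgt h2.
Qed.

Let inI_unit w u : inI w u -> 0 <= u < 1.
Proof.
elim/last_ind: w => [|w b IH]; first by rewrite /inI /left_end big_ord0 add0r q_nil.
rewrite /inI left_rcons => h; apply: IH; rewrite /inI.
have q0 := q_ge0 (rcons w false); have q1 := q_ge0 (rcons w true).
have qw := q_rcons w; case: b h => /andP[h1 h2]; apply/andP; split; lra.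
Qed.

Let code (u : measurableTypeR R) : X :=
  if 0 <= (u : R) < 1 then to_shift S (pt u) else zero_inf S.

Let pt_adm u : 0 <= u < 1 -> adm (pt u).
Proof.
move=> u01; apply: q_adm => n; rewrite mkseq_pt.
have /andP[h1 h2] := wd_inI n u01.
by rewrite -(ltrD2l (left_end (wd u n))) addr0; exact: le_lt_trans h2.
Qed.

Let code_cyl u w : 0 <= u < 1 -> cyl w (code u) <-> inI w u.
Proof.
move=> u01; rewrite /cyl /code u01 /= /prefix_of to_shiftK ?mkseq_pt; last exact: pt_adm.
split=> [<-|]; first exact: wd_inI.
exact: inI_wd.
Qed.

Let inIE w : [set u | inI w u] = `[left_end w, left_end w + q w[%classic.
Proof. by apply/seteqP; split=> u; rewrite /= in_itv. Qed.

Let measurable_code : measurable_fun setT code.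
Proof.
move=> _; apply: borel_ind => [w||A|F].
- rewrite setTI.
  have -> : code @^-1` cyl w = [set u | inI w u] `|`
      (~` `[0, 1[ `&` (fun=> zero_inf S : X) @^-1` cyl w).
    apply/seteqP; split=> u /=.
      have [u01|u01] := boolP (0 <= u < 1); first by move/code_cyl; left; auto.
      rewrite /code (negbTE u01) => h; right; split=> //=.
      by rewrite in_itv /=; apply/negP.
    move=> [h|[/= h1 h2]]; first by apply/code_cyl; rewrite ?(inI_unit h).
    by move: h1; rewrite in_itv /= /code => /negP/negbTE ->.
  apply: measurableU; first by rewrite inIE; exact: measurable_itv.
  apply: measurableI; first by apply: measurableC; exact: measurable_itv.
  rewrite preimage_cst; case: ifP => _ //.
- by rewrite preimage_set0 setI0.
- by rewrite !setTI preimage_setC => mA; exact: measurableC.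
- move=> mF; rewrite setTI preimage_bigcup; apply: bigcup_measurable => i _.
  by have := mF i; rewrite setTI.
Qed.

(** The image of Lebesgue measure under the map that reads off the nested
    intervals which contain a point. *)
Lemma ex_probability_cyl :
  exists mu : probability X R, forall w, mu (cyl w) = (q w)%:E.
Proof.
pose mcode := isMeasurableFun.Build _ _ _ _ code measurable_code.
pose fcode : {mfun measurableTypeR R >-> X} :=
  MeasurableFun.Pack (MeasurableFun.Class mcode).
exists (distribution (@unit_lebesgue R) fcode) => w.
rewrite /distribution /pushforward /= /unit_lebesgue /mrestr.
have -> : code @^-1` cyl w `&` `[0, 1[ = `[left_end w, left_end w + q w[%classic.
  rewrite -inIE; apply/seteqP; split=> u /=.
    by rewrite in_itv /= => -[h u01]; apply/code_cyl.
  by move=> h; rewrite in_itv /= (inI_unit h); split=> //; apply/code_cyl; rewrite ?(inI_unit h).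
rewrite lebesgue_measure_itv /= lte_fin ltrDl.
case: ltP => h; first by rewrite -EFinB addrAC subrr add0r.
by congr EFin; apply/eqP; rewrite eq_le h q_ge0.
Qed.

End interval_coding.

(** * The renewal measure *)

Section geometric_tail.
Context (R : realType) (u : nat -> R) (s K r : R).
Hypotheses (r_gt0 : 0 < r) (r_lt1 : r < 1) (u_le : forall a, u a <= K * r ^+ a).
Hypothesis u_ge0 : forall a, 0 <= u a.

(** The partial sums beyond [l] are dominated by the telescoping differences of
    [K / (1 - r) * r ^+ l]. *)
Lemma geometric_tail l : series u @ \oo --> s ->
  0 <= s - series u l <= K / (1 - r) * r ^+ l.
Proof.
move=> us; have r1 : 0 < 1 - r by rewrite subr_gt0.
have K0 : 0 <= K by have := le_trans (u_ge0 0) (u_le 0); rewrite expr0 mulr1.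
have nd : nondecreasing_seq (series u) by apply: nondecreasing_series.
have cu : cvgn (series u) by exact: cvgP us.
have sE : limn (series u) = s by exact: cvg_lim us.
rewrite subr_ge0 -sE nondecreasing_cvgn_le //= lerBlDr.
have step d : series u (d + l)%N - series u l <=
    K / (1 - r) * (r ^+ l - r ^+ (d + l)).
  elim: d => [|d IH]; first by rewrite add0n !subrr mulr0.
  have -> : series u (d.+1 + l)%N = series u (d + l)%N + u (d + l)%N.
    by rewrite addSn seriesSr.
  have := u_le (d + l)%N; rewrite addSn [r ^+ (d + l).+1]exprS.
  have -> : K / (1 - r) * (r ^+ l - r * r ^+ (d + l)) =
    K / (1 - r) * (r ^+ l - r ^+ (d + l)) + K * r ^+ (d + l).
    by field; rewrite gt_eqF.
  lra.
apply: limr_le => //; exists l => // m /= lm.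
have := step (m - l)%N; rewrite subnK //.
have : 0 <= K / (1 - r) * r ^+ m by rewrite mulr_ge0 ?divr_ge0 ?exprn_ge0 // ltW.
rewrite mulrBr; lra.
Qed.

End geometric_tail.

Section renewal_weights.
Context (S : set nat) (R : realType) (p : nat -> R) (K r : R).
Local Notation X := (borel_gap_shift S).
Local Notation adm := (gap_set S).
Hypothesis p_ge0 : forall a, 0 <= p a.
Hypothesis p_out : forall a, ~ S a -> p a = 0.
Hypothesis p_sum : series p @ \oo --> (1 : R).
Hypotheses (r_gt0 : 0 < r) (r_lt1 : r < 1).
Hypothesis p_le : forall a, p a <= K * r ^+ a.

(** [T l] is the probability of a gap of length at least [l]. *)
Let T (l : nat) : R := 1 - series p l.

Let T_bounds l : 0 <= T l <= K / (1 - r) * r ^+ l.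
Proof. exact: geometric_tail. Qed.

Let TS l : T l.+1 + p l = T l.
Proof. by rewrite /T seriesSr; ring. Qed.

Let T0 : T 0 = 1.
Proof. by rewrite /T /series /= big_geq // subr0. Qed.

Let T_cvg : cvgn (series T).
Proof.
apply: (@series_le_cvg _ _ (geometric (K / (1 - r)) r)) => [n|n|n|].
- by have /andP[] := T_bounds n.
- by have /andP[h1 h2] := T_bounds n; exact: le_trans h1 h2.
- by have /andP[] := T_bounds n.
- by apply: is_cvg_geometric_series; rewrite gtr0_norm.
Qed.

Let D : R := limn (series T).

Let V_bounds k : 0 <= D - series T k <= K / (1 - r) / (1 - r) * r ^+ k.
Proof.
apply: geometric_tail => // [a|a]; by have /andP[] := T_bounds a.
Qed.

Let D_gt0 : 0 < D.
Proof.
have /andP[h _] := V_bounds 1; move: h; rewrite subr_ge0; apply: lt_le_trans.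
by rewrite /series /= big_nat1 T0.
Qed.

(** Stationary probability of [k] zeros at the beginning. *)
Let V (k : nat) : R := (D - series T k) / D.

Let V0 : V 0 = 1.
Proof. by rewrite /V /series /= big_geq // subr0 divff // gt_eqF. Qed.

Let VS k : V k.+1 + T k / D = V k.
Proof. by rewrite /V seriesSr; field; rewrite gt_eqF. Qed.

(** Weight of the word [w] that follows [1 0^l]. *)
Let rw := fix rw (l : nat) (w : seq bool) : R :=
  if w is b :: w' then (if b then p l * rw 0%N w' else rw l.+1 w') else T l.

(** Weight of the word [w] that follows [0^k]. *)
Let rz := fix rz (k : nat) (w : seq bool) : R :=
  if w is b :: w' then (if b then T k / D * rw 0%N w' else rz k.+1 w') else V k.

Let T_ge0 l : 0 <= T l. Proof. by have /andP[] := T_bounds l. Qed.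

Let V_ge0 k : 0 <= V k.
Proof. by have /andP[h _] := V_bounds k; rewrite divr_ge0 // ltW. Qed.

Let rw_ge0 l w : 0 <= rw l w.
Proof. by elim: w l => [|[] w IH] l /=; rewrite ?mulr_ge0. Qed.

Let rz_ge0 k w : 0 <= rz k w.
Proof.
elim: w k => [|[] w IH] k /=; rewrite ?V_ge0 ?IH //.
by rewrite mulr_ge0 // divr_ge0 // ltW.
Qed.

Let rw_rcons l w : rw l (rcons w false) + rw l (rcons w true) = rw l w.
Proof.
elim: w l => [|[] w IH] l /=; first by rewrite T0 mulr1.
  by rewrite -mulrDr IH.
exact: IH.
Qed.

Let rz_rcons k w : rz k (rcons w false) + rz k (rcons w true) = rz k w.
Proof.
elim: w k => [|[] w IH] k /=; first by rewrite T0 mulr1.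
  by rewrite -mulrDr rw_rcons.
exact: IH.
Qed.

Let rz_shift k w : rz k.+1 w + rw k w / D = rz k w.
Proof.
elim: w k => [|[] w IH] k //=.
by rewrite -(TS k); ring.
Qed.

Let rw_cat l w1 w2 : exists2 c, 0 <= c & rw l (w1 ++ true :: w2) = c * rw 0%N w2.
Proof.
elim: w1 l => [|[] w IH] l /=; first by exists (p l).
  have [c c0 ->] := IH 0%N; exists (p l * c); rewrite ?mulrA //.
  by rewrite mulr_ge0.
exact: IH.
Qed.

Let rz_cat k w1 w2 : exists2 c, 0 <= c & rz k (w1 ++ true :: w2) = c * rw 0%N w2.
Proof.
elim: w1 k => [|[] w IH] k /=.
- by exists (T k / D) => //; rewrite divr_ge0 // ltW.
- have [c c0 ->] := rw_cat 0 w w2; exists (T k / D * c); rewrite ?mulrA //.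
  by rewrite mulr_ge0 // divr_ge0 // ltW.
exact: IH.
Qed.

Let rw_zeros l m w : rw l (nseq m false ++ true :: w) = p (l + m)%N * rw 0%N w.
Proof.
elim: m l => [|m IH] l /=; first by rewrite addn0.
by rewrite IH addSnnS.
Qed.

Let rz_adm x : (forall n, 0 < rz 0 (mkseq x n)) -> adm x.
Proof.
move=> h i j ij xi xj nox; apply: contrapT => nS.
have := h j.+1.
have -> : mkseq x j.+1 = mkseq x i ++ true :: (nseq (j - i).-1 false ++ [:: true]).
  apply: (@eq_from_nth _ false).
    by rewrite size_mkseq size_cat /= size_cat size_mkseq size_nseq /=; lia.
  move=> k; rewrite size_mkseq => kj; rewrite nth_mkseq // nth_cat size_mkseq.
  case: ltnP => ki; first by rewrite nth_mkseq.
  case e : (k - i)%N => [|d] /=; first by have -> : k = i by lia.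
  rewrite nth_cat size_nseq nth_nseq; case: ltnP => dj.
    by rewrite nox //; lia.
  have -> : (d - (j - i).-1 = 0)%N by lia.
  by have -> : k = j by lia.
have [c c0 ->] := rz_cat 0 (mkseq x i) (nseq (j - i).-1 false ++ [:: true]).
by rewrite rw_zeros add0n p_out // mul0r mulr0 ltxx.
Qed.

Let rz_cons w : rz 0 (false :: w) + rz 0 (true :: w) = rz 0 w.
Proof. by rewrite /= T0 -(rz_shift 0 w); ring. Qed.

Variables (Phi correction : binseq -> R) (B : R).
Hypothesis T_Phi : forall l x, adm (block l x) ->
  r ^+ l <= expR (bsum Phi l.+1 (block l x) + B - correction (block l x)).
Hypothesis V_Phi : forall k x, adm x -> r ^+ k <= expR (bsum Phi k (zeros k x) + B).
Hypothesis p_Phi : forall l x, adm (block l x) -> x 0%N = true ->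
  p l <= expR (bsum Phi l.+1 (block l x) + correction x - correction (block l x)).
Hypothesis correction_B : forall x, adm x -> x 0%N = true -> - B <= correction x.

Let C : R := K / (1 - r).
Let C_ge0 : 0 <= C.
Proof. by have /andP[h1 h2] := T_bounds 0; rewrite expr0 mulr1 in h2; exact: le_trans h1 h2. Qed.

(** Over each complete block the corrections telescope, so that no error piles up
    with the number of blocks. *)
Let rw_le l w x : adm (block l (catw w x)) ->
  rw l w <= C * expR (bsum Phi (size w + l.+1) (block l (catw w x)) + B
                       - correction (block l (catw w x))).
Proof.
elim: w l => [|[] w IH] l xS /=.
- have /andP[_ h] := T_bounds l; apply: le_trans h _.
  by rewrite ler_wpM2l // T_Phi.
- have wS : adm (block 0 (catw w x)) by exact: adm_block_tail xS.
  apply: le_trans (ler_pM (p_ge0 l) (rw_ge0 0 w) (p_Phi xS erefl) (IH 0%N wS)) _.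
  rewrite mulrCA ler_wpM2l // -expRD ler_expR.
  pose y := block 0 (catw w x).
  rewrite -[catw (true :: w) x]/y -[scons true (catw w x)]/y -[block 0 (catw w x)]/y.
  rewrite addn1 [((size w).+1 + l.+1)%N]addnC bsumD sshift_block; lra.
- rewrite addSnnS; have := IH l.+1; rewrite /block zerosSr; exact.
Qed.

Let rz_le k w x : adm (zeros k (catw w x)) ->
  rz k w <= (C / (1 - r) + C * C * expR (2 * B)) / D * 
     expR (bsum Phi (size w + k) (zeros k (catw w x)) + B).
Proof.
have r1 : 0 < 1 - r by rewrite subr_gt0.
elim: w k => [|[] w IH] k xS /=.
- have /andP[_ h] := V_bounds k; rewrite /V mulrAC ler_pM2r ?invr_gt0 //.
  apply: le_trans h _; apply: ler_pM.
  + by apply: divr_ge0; [exact: C_ge0|exact: ltW].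
  + by rewrite exprn_ge0 // ltW.
  + by rewrite lerDl; apply: mulr_ge0; [exact: mulr_ge0|exact: expR_ge0].
  + by apply: V_Phi; exact: (@adm_zeros_inv S k x xS).
- have wS : adm (block 0 (catw w x)) by exact: adm_zeros_inv xS.
  have hw := rw_le wS; have hc := correction_B wS erefl.
  have /andP[_ hT] := T_bounds k.
  have hV := V_Phi k wS.
  rewrite [leLHS]mulrAC [leRHS]mulrAC ler_pM2r ?invr_gt0 //.
  apply: (@le_trans _ _ (C * expR (bsum Phi k (zeros k (block 0 (catw w x))) + B) *
      (C * expR (bsum Phi (size w + 1) (block 0 (catw w x)) + B + B)))).
    apply: ler_pM => //.
      by apply: le_trans hT _; rewrite ler_wpM2l.
    by apply: le_trans hw _; rewrite ler_wpM2l // ler_expR; lra.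
  rewrite mulrACA -expRD.
  apply: (@le_trans _ _ (C * C * expR (2 * B) *
      expR (bsum Phi ((size w).+1 + k) (zeros k (scons true (catw w x))) + B))).
    rewrite -[leRHS]mulrA; apply: ler_wpM2l; first exact: mulr_ge0.
    rewrite -expRD ler_expR.
    rewrite addn1 [((size w).+1 + k)%N]addnC bsumD sshift_zerosE.
    rewrite -[scons true (catw w x)]/(block 0 (catw w x)); lra.
  by rewrite ler_wpM2r ?expR_ge0 // lerDr divr_ge0 // ltW.
- rewrite addSnnS; have := IH k.+1; rewrite zerosSr; exact.
Qed.

(** The stationary renewal process whose gaps are independent with law [p]:
    an invariant measure whose cylinders satisfy the upper Gibbs inequality. *)
Lemma ex_renewal_measure : exists mu : probability X R,
  (forall w, mu (cyl (false :: w)) + mu (cyl (true :: w)) = mu (cyl w))%E /\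
  exists C', forall w x, adm (catw w x) ->
     fine (mu (cyl w)) <= C' * expR (bsum Phi (size w) (catw w x)).
Proof.
have [mu hmu] := ex_probability_cyl (rz_ge0 0) V0 (rz_rcons 0) rz_adm.
exists mu; split=> [w|]; first by rewrite !hmu -EFinD rz_cons.
exists ((C / (1 - r) + C * C * expR (2 * B)) / D * expR B) => w x xS.
rewrite hmu /= -mulrA -expRD [B + _]addrC.
by have := @rz_le 0 w x xS; rewrite addn0.
Qed.

End renewal_weights.

(** * Lower bound for the entropy and the topological pressure *)

Section entropy_lower.
Context (S : set nat) (R : realType) (theta : R).
Hypotheses (theta_gt0 : 0 < theta) (theta_lt1 : theta < 1).
Local Notation X := (borel_gap_shift S).
Local Notation adm := (gap_set S).
Local Notation sigma := (@gap_sigma S : X -> X).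
Variable mu : probability X R.
Hypothesis mu_inv : invariant_measure mu sigma.
Variables (g : X -> R) (B P C : R).
Hypothesis hg : holder_fun theta B g.
Hypothesis gibbs : forall w x, adm (catw w x) ->
  fine (mu (cyl w)) <= C * expR (bsum (raw g) (size w) (catw w x) - P * (size w)%:R).

Let alpha (i : 'I_2) : set X := cyl [:: i != ord0].

Let alphaP x i : alpha i x <-> gap_seq x 0%N = (i != ord0).
Proof.
rewrite /alpha /cyl /prefix_of /= /mkseq /=; split=> [[->]|->] //.
Qed.

Let sym (b : bool) : 'I_2 := if b then ord_max else ord0.

Let symP b i : b = (i != ord0) <-> sym b = i.
Proof.
split=> [->|<-]; last by case: b.
by case: i => -[|[|]] //= h; apply: val_inj.
Qed.

Let alpha_partition : measurable_partition alpha.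
Proof.
split=> [i||]; first exact: measurable_cyl.
  by move=> i j _ _ [x [/alphaP/symP <- /alphaP/symP <-]].
apply/seteqP; split=> // x _; exists (sym (gap_seq x 0%N)) => //.
exact/alphaP/symP.
Qed.

Let name n (x : X) : {ffun 'I_n -> 'I_2} := [ffun i : 'I_n => sym (gap_seq x i)].

Let join_cellE n (w : {ffun 'I_n -> 'I_2}) :
  join_cell sigma alpha w = name n @^-1` [set w].
Proof.
apply/seteqP; split=> x /=.
  move=> h; apply/ffunP => i; rewrite ffunE.
  have /alphaP := h i; rewrite gap_seq_iter /sshift addn0.
  by move=> ->; apply/symP.
move=> <- i; apply/alphaP; rewrite gap_seq_iter /sshift addn0 ffunE.
exact/symP.
Qed.

Let name_cyl n (x : X) : name n @^-1` [set name n x] = cyl (prefix_of n x).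
Proof.
apply/seteqP; split=> y /=; rewrite /cyl /= size_mkseq.
  move=> /ffunP h; apply/agree_mkseq => i ni.
  have := h (Ordinal ni); rewrite !ffunE /=.
  by case: (gap_seq y i); case: (gap_seq x i) => // /(congr1 val).
move=> /agree_mkseq h; apply/ffunP => i; rewrite !ffunE h //.
Qed.

Let measurable_fiber n w : measurable (name n @^-1` [set w]).
Proof.
have [[x hx]|h] := pselect (exists x, name n x = w).
  by rewrite -hx name_cyl; exact: measurable_cyl.
rewrite (_ : _ @^-1` _ = set0) //; apply/seteqP; split=> // x /= hx.
by apply: h; exists x.
Qed.

Let join_entropy_ge n : 0 < C ->
  n%:R * (P - \int[mu]_x g x) - ln C <= join_entropy mu sigma alpha n.
Proof.
move=> C0; pose m (w : {ffun 'I_n -> 'I_2}) := fine (mu (join_cell sigma alpha w)).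
have lblE (h : {ffun 'I_n -> 'I_2} -> R) :
    \int[mu]_x h (name n x) = \sum_w h w * m w.
  rewrite (Rintegral_label mu (index_enum_uniq _) (fun x => mem_index_enum _)
    (@measurable_fiber n)).
  by apply: eq_bigr => w _; rewrite /m join_cellE.
pose A : R := P * n%:R + n%:R * B - ln C.
(* Empty cells carry no mass; for them the value [A] dominates the Gibbs bound. *)
pose h w := if m w == 0 then A else - ln (m w).
have ibsum := integrable_bsum theta_gt0 theta_lt1 mu n hg.
have icst := integrable_cstR mu (P * n%:R - ln C).
have -> : join_entropy mu sigma alpha n = \int[mu]_x h (name n x).
  rewrite lblE /join_entropy -sumrN; apply: eq_bigr => w _; rewrite /h -/(m w).
  by case: eqP => [->|_]; rewrite ?mulr0 ?mul0r ?oppr0 // mulNr mulrC.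
have -> : n%:R * (P - \int[mu]_x g x) - ln C =
    \int[mu]_x (P * n%:R - ln C - bsum (raw g) n (gap_seq x)).
  rewrite RintegralB // (Rintegral_bsum theta_gt0 theta_lt1 mu_inv _ hg).
  rewrite Rintegral_cst // -[fine (mu setT)]mul1r -(@Rintegral_cst _ _ _ mu) //.
  by rewrite Rintegral1; ring.
apply: le_Rintegral => //.
- by have := integrableB measurableT icst ibsum; apply: eq_integrable.
- exact: (integrable_label mu (index_enum_uniq _) (fun x => mem_index_enum _)
    (@measurable_fiber n) h).
move=> x _; rewrite /h.
have [m0|m0] := eqVneq (m (name n x)) 0.
  rewrite /A addrAC lerD2r lerD2l bsum_gap_seq -sumrN.
  apply: (@le_trans _ _ (\sum_(j < n) B)).
    apply: ler_sum => j _; case: hg => h1 _; apply: le_trans (h1 (iter j sigma x)).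
    by rewrite lerNl; have := ler_norm (- g (iter j sigma x)); rewrite normrN; lra.
  by rewrite sumr_const card_ord mulr_natl.
have mx : 0 < m (name n x) by rewrite lt_def m0 fine_ge0.
have hm : m (name n x) <= C * expR (bsum (raw g) n (gap_seq x) - P * n%:R).
  rewrite /m join_cellE name_cyl.
  have := @gibbs (prefix_of n x) (sshift n (gap_seq x)).
  by rewrite catw_mkseq size_mkseq; apply; exact: gap_seqP.
have : ln (m (name n x)) <= ln (C * expR (bsum (raw g) n (gap_seq x) - P * n%:R)).
  by rewrite ler_ln // posrE mulr_gt0 // expR_gt0.
rewrite lnM ?posrE ?expR_gt0 // expRK; lra.
Qed.

(** It suffices to use the partition by the first symbol: the upper Gibbs
    inequality bounds the information of each word from below. *)
Lemma entropy_ge : ((P - \int[mu]_x g x)%:E <= entropy mu sigma)%E.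
Proof.
have C0 : 0 < C.
  have /= := @gibbs [::] zinf (@adm_zinf S).
  rewrite cyl_nil bsum0 probability_setT mulr0 subr0 expR0 mulr1.
  exact: lt_le_trans.
apply: (@le_trans _ _ (partition_entropy mu sigma alpha)); last first.
  by apply: ereal_sup_ubound; exists 2%N, alpha.
apply: limn_esup_ge => e e0; have [N hN] := eventually_small (ln C) e0.
exists N => n /hN[n0 hn]; rewrite lee_fin.
have n0R : 0 < n%:R :> R by rewrite ltr0n.
rewrite ler_pdivlMr //; apply: le_trans (join_entropy_ge n C0).
rewrite ler_pdivrMr // in hn; rewrite mulrBl [_ * n%:R]mulrC; lra.
Qed.

End entropy_lower.

Section pressure.
Context (S : set nat) (R : realType) (theta : R).
Hypotheses (theta_gt0 : 0 < theta) (theta_lt1 : theta < 1).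
Local Notation adm := (gap_set S).
Variables (phi : gap_shift S -> R) (B P : R).
Hypothesis hphi : holder_fun theta B phi.

Let Z n := partition_fun S (raw phi) n zinf.

Lemma ler_sum_sub (I : eqType) (s r : seq I) (F : I -> R) :
  uniq s -> uniq r -> {subset s <= r} -> (forall i, 0 <= F i) ->
  \sum_(i <- s) F i <= \sum_(i <- r) F i.
Proof.
move=> us ur sr F0.
have /(perm_big _) -> : perm_eq s [seq i <- r | i \in s].
  apply: uniq_perm; rewrite ?filter_uniq // => i; rewrite mem_filter.
  by case: (boolP (i \in s)) => // /sr ->.
rewrite big_filter big_mkcond; apply: ler_sum => i _.
by case: ifP.
Qed.

Lemma far_apart (e : R) (x y : gap_shift S) i : e < 1 ->
  gap_seq x i != gap_seq y i ->
  e < dtheta theta (iter i (@gap_sigma S) x) (iter i (@gap_sigma S) y).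
Proof.
move=> e1 xy; rewrite /dtheta; case: pselect => [h|[]]; last first.
  by exists 0%N; rewrite !gap_seq_iter /sshift addn0.
case: ex_minnP => k _ /(_ 0%N); rewrite !gap_seq_iter /sshift addn0 => /(_ xy).
by rewrite leqn0 => /eqP ->; rewrite expr0.
Qed.

(** The points [w 0^oo] are separated at every scale below 1. *)
Lemma separated_sum_ge n (e : R) : e < 1 ->
  ((Z n)%:E <= separated_sum (dtheta theta) (@gap_sigma S) phi n e)%E.
Proof.
move=> e1.
pose s := [seq to_shift S (catw v zinf) | v <- words n & `[< adm (catw v zinf) >]].
have us : uniq s.
  rewrite map_inj_in_uniq ?filter_uniq ?uniq_words // => u v.
  rewrite !mem_filter !mem_words => /andP[/asboolP uS /eqP un] /andP[/asboolP vS /eqP vn].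
  move=> /(congr1 (@gap_seq S)); rewrite !to_shiftK // => uv.
  by rewrite -(mkseq_catw u zinf) -(mkseq_catw v zinf) un vn uv.
apply: ereal_sup_ubound; exists [set` s].
  split; first exact: finite_seq.
  move=> _ _ /mapP[u + ->] /mapP[v + ->]; rewrite !mem_filter !mem_words.
  move=> /andP[/asboolP uS /eqP un] /andP[/asboolP vS /eqP vn] uv.
  have : ~ agree n (catw u zinf) (catw v zinf).
    move=> /agree_mkseq; rewrite -{1}un -vn !mkseq_catw => e2.
    by apply: uv; rewrite e2.
  move=> /existsNP[k /not_implyP[kn /eqP kuv]].
  by exists (Ordinal kn) => /=; apply: far_apart => //; rewrite !to_shiftK.
congr EFin; rewrite -fsbig_seq // /s big_map big_filter /Z /partition_fun.
apply: eq_bigr => v /asboolP vS; rewrite -bsum_raw to_shiftK //.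
Qed.

(** Points that are separated at scale [e] up to time [n] have different prefixes
    of length [n + N], where [theta ^+ N <= e]. *)
Lemma separated_sum_le (e : R) : 0 < e -> exists2 K, 0 < K & exists N, forall n,
  (separated_sum (dtheta theta) (@gap_sigma S) phi n e <= (K * Z (n + N)%N)%:E)%E.
Proof.
move=> e0; have [N hN] := expr_small theta_gt0 theta_lt1 1 e0.
rewrite mul1r in hN; have B0 : 0 <= B.
  by case: hphi => h _; exact: le_trans (h (zero_inf S)).
exists (expR (B / (1 - theta) + N%:R * B)); first exact: expR_gt0.
exists N => n; apply: ge_ereal_sup => _ [E [fE sepE] <-]; rewrite lee_fin.
rewrite fsbig_finite //=.
pose F v := if `[< adm (catw v zinf) >] then
  expR (B / (1 - theta) + N%:R * B + bsum (raw phi) (n + N) (catw v zinf)) else 0.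
have F0 v : 0 <= F v by rewrite /F; case: ifP => // _; exact: expR_ge0.
have FE (x : gap_shift S) : expR (birkhoff_sum (@gap_sigma S) phi n x) <=
    F (prefix_of (n + N) x).
  have xS := @gap_seqP S x; have aS := @adm_catw_zinf S (gap_seq x) (n + N)%N xS.
  rewrite /F asboolT // ler_expR -bsum_raw bsumD.
  have ag : agree (n + 0) (catw (prefix_of (n + N) x) zinf) (gap_seq x).
    apply: agree_le (agree_catw_mkseq (n := n + N)%N _ _).
    by rewrite addn0 leq_addr.
  have := bsum_holder theta_gt0 theta_lt1 B0 (holder_fun_raw hphi) aS xS ag.
  rewrite expr0 mulr1 ler_norml => /andP[h _].
  have : - (N%:R * B) <= bsum (raw phi) N (sshift n (catw (prefix_of (n + N) x) zinf)).
    rewrite lerNl -sumrN; apply: le_trans (_ : \sum_(j < N) B <= _).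
      by apply: ler_sum => j _; case: hphi => h1 _; apply: le_trans (ler_norm _) _; rewrite normrN; exact: h1.
    by rewrite sumr_const card_ord mulr_natl.
  lra.
pose s : seq (gap_shift S) := finmap.enum_fset (fset_set E).
apply: (@le_trans _ _ (\sum_(v <- [seq prefix_of (n + N) x | x : gap_shift S <- s]) F v)).
  by rewrite big_map; apply: ler_sum => x _; exact: FE.
have -> : expR (B / (1 - theta) + N%:R * B) * Z (n + N)%N = \sum_(v <- words (n + N)) F v.
  rewrite /Z /partition_fun mulr_sumr /F [in LHS]big_mkcond; apply: eq_bigr => v _.
  by case: ifP => // _; rewrite -expRD.
apply: ler_sum_sub => //; last 2 first.
- exact: uniq_words.
- by move=> _ /mapP[x _ ->]; exact: mkseq_words.
rewrite map_inj_in_uniq ?finmap.fset_uniq // => x y.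
rewrite /s !in_fset_set // !inE => xE yE pxy; apply: contrapT => xy.
have [i] := sepE x y xE yE xy; apply/negP; rewrite -leNgt.
apply: le_trans hN; apply: dtheta_agree => //.
rewrite !gap_seq_iter; move/agree_mkseq: pxy => /(@agree_sshift i).
by apply: agree_le; have := ltn_ord i; lia.
Qed.

Hypothesis Z_le : forall eps : R, 0 < eps -> exists2 K, 0 < K &
  forall n, Z n <= K * expR (n%:R * (P + eps)).
Hypothesis Z_ge : exists2 c : R, 0 < c & forall n, c * expR (n%:R * P) <= Z n.

Lemma separated_pressureE e : 0 < e -> e < 1 ->
  separated_pressure (dtheta theta) (@gap_sigma S) phi e = P%:E.
Proof.
move=> e0 e1; apply/eqP; rewrite eq_le; apply/andP; split.
  have [K K0 [N hN]] := separated_sum_le e0.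
  apply: limn_esup_le => eps eps0; have eps2 : 0 < eps / 2 by rewrite divr_gt0.
  have [K' K'0 hK'] := Z_le eps2.
  have [n1 hn1] := eventually_small (ln (K * K') + N%:R * (P + eps / 2)) eps2.
  exists n1 => n /hn1[n0 hn]; have n0R : 0 < n%:R :> R by rewrite ltr0n.
  pose b := K * (K' * expR ((n + N)%:R * (P + eps / 2))).
  have b0 : 0 < b by rewrite !mulr_gt0 ?expR_gt0.
  have sb : (separated_sum (dtheta theta) (@gap_sigma S) phi n e <= b%:E)%E.
    by apply: le_trans (hN n) _; rewrite lee_fin ler_wpM2l // ltW.
  have s0 : (0 <= separated_sum (dtheta theta) (@gap_sigma S) phi n e)%E.
    by apply: le_trans (separated_sum_ge n e1); rewrite lee_fin partition_fun_ge0.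
  apply: (@le_trans _ _ ((n%:R^-1)%:E * lne b%:E)%E).
    rewrite lee_wpmul2l ?lee_fin ?invr_ge0 ?(ltW n0R) // lee_lne //.
    - by rewrite in_itv /= s0 leey.
    - by rewrite in_itv /= lee_fin ltW //= leey.
  rewrite lne_EFin // -EFinM lee_fin mulrC ler_pdivrMr // /b mulrA.
  rewrite lnM ?posrE ?expR_gt0 ?mulr_gt0 // expRK.
  rewrite ler_pdivrMr // in hn; rewrite natrD; lra.
have [c c0 hc] := Z_ge; apply: limn_esup_ge => eps eps0.
have [n1 hn1] := eventually_small (- ln c) eps0.
exists n1 => n /hn1[n0 hn]; have n0R : 0 < n%:R :> R by rewrite ltr0n.
have b0 : 0 < c * expR (n%:R * P) by rewrite mulr_gt0 // expR_gt0.
apply: (@le_trans _ _ ((n%:R^-1)%:E * lne (c * expR (n%:R * P))%:E)%E).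
  rewrite lne_EFin // -EFinM lee_fin mulrC ler_pdivlMr //.
  rewrite lnM ?posrE ?expR_gt0 // expRK.
  rewrite ler_pdivrMr // in hn; lra.
rewrite lee_wpmul2l ?lee_fin ?invr_ge0 ?(ltW n0R) //.
have h : ((c * expR (n%:R * P))%:E <=
    separated_sum (dtheta theta) (@gap_sigma S) phi n e)%E.
  by apply: le_trans (separated_sum_ge n e1); rewrite lee_fin.
rewrite lee_lne // in_itv /= leey ?andbT ?lee_fin ?(ltW b0) //.
by apply: le_trans h; rewrite lee_fin ltW.
Qed.

Lemma topological_pressureE :
  topological_pressure (dtheta theta) (@gap_sigma S) phi = P%:E.
Proof.
apply: lim_near_cst; first exact: ereal_hausdorff.
near=> e; apply: separated_pressureE; near: e.
  exact: nbhs_right_gt.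
exact: nbhs_right_lt.
Unshelve. all: by end_near. Qed.

End pressure.

(** * The equilibrium state and its stability *)

Lemma sqr_le_expR (R : realType) (e : R) : 0 < e ->
  exists2 K, 0 < K & forall n : nat, n.+1%:R ^+ 2 <= K * expR (n%:R * e).
Proof.
move=> e0; pose m := Num.max 1 (2 / e); have m1 : 1 <= m by rewrite le_max lexx.
have m0 : 0 < m by exact: lt_le_trans m1.
exists (m ^+ 2) => [|n]; first by rewrite exprn_gt0.
have -> : expR (n%:R * e) = expR (n%:R * (e / 2)) ^+ 2.
  by rewrite -expRM_natr; congr expR; field.
rewrite -exprMn lerXn2r ?nnegrE ?mulr_ge0 ?expR_ge0 ?(ltW m0) //.
apply: le_trans (ler_wpM2l (ltW m0) (expR_ge1Dx _)).
have : 1 <= m * (e / 2).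
  have : 2 / e <= m by rewrite le_max lexx orbT.
  by rewrite ler_pdivrMr // => h; rewrite mulrA ler_pdivlMr // mul1r.
have n0 : 0 <= n%:R :> R by [].
move=> h; have : n%:R * 1 <= n%:R * (m * (e / 2)) by rewrite ler_wpM2l.
rewrite -[n.+1%:R]natr1; lra.
Qed.

(** The optimal [t] is [sqrt d]; the bound 2 serves the case where this exceeds
    [t0]. *)
Lemma sqrt_bound (R : realType) (C t0 d Delta : R) :
  0 <= C -> 0 < t0 -> 0 <= d -> 0 <= Delta <= 2 ->
  (forall t, 0 <= t <= t0 -> t * Delta <= d + C * t ^+ 2) ->
  Delta <= (1 + C + 2 / t0) * Num.sqrt d.
Proof.
move=> C0 t00 d0 /andP[D0 D2] h; have s0 := sqrtr_ge0 d.
have f0 : 0 <= 2 / t0 by rewrite divr_ge0 // ltW.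
have [td|dt] := ltrP t0 (Num.sqrt d).
  apply: (le_trans D2); apply: (@le_trans _ _ (2 / t0 * Num.sqrt d)).
    by rewrite mulrAC ler_pdivlMr // ler_wpM2l // ltW.
  by rewrite ler_wpM2r // lerDr addr_ge0.
apply: (@le_trans _ _ ((1 + C) * Num.sqrt d)); last by rewrite ler_wpM2r // lerDl.
move: s0; rewrite le_eqVlt => /predU1P[sd|s0].
  rewrite -sd mulr0 leNgt; apply/negP => Dp.
  pose t := Num.min t0 (Delta / (2 * (C + 1))).
  have C1 : 0 < 2 * (C + 1) by rewrite mulr_gt0 // ltr_wpDl.
  have tp : 0 < t by rewrite lt_min t00 divr_gt0.
  have := h t; rewrite (ltW tp) ge_min lexx => /(_ isT).
  have -> : d = 0 by rewrite -(sqr_sqrtr d0) -sd expr0n.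
  rewrite add0r expr2 mulrCA ler_pM2l // => hh.
  have : t * (2 * (C + 1)) <= Delta by rewrite -ler_pdivlMr // ge_min lexx orbT.
  have := mulr_ge0 C0 (ltW tp); lra.
have := h (Num.sqrt d); rewrite (ltW s0) dt => /(_ isT).
move=> hh; rewrite -(ler_pM2l s0); apply: le_trans hh _.
have -> : Num.sqrt d * ((1 + C) * Num.sqrt d) = (1 + C) * Num.sqrt d ^+ 2 by ring.
by rewrite sqr_sqrtr // mulrDl mul1r.
Qed.

Section main.
Context (R : realType) (S : set nat) (theta : R).
Hypotheses (theta_gt0 : 0 < theta) (theta_lt1 : theta < 1).
Hypothesis S_neq0 : S !=set0.
Variables (phi : gap_shift S -> R) (psi : S -> R).
Hypothesis phi_renewal : renewal_type theta phi psi.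
Variable P : R.
Hypothesis P_eq : \esum_(n in [set: S])
              (expR (psi n - P * (set_val n).+1%:R))%:E = 1%E.
Hypothesis P_gt : finite_set S -> phi (zero_inf S) < P.
Local Notation X := (borel_gap_shift S).
Local Notation adm := (gap_set S).
Local Notation sigma := (@gap_sigma S : X -> X).
Local Notation inv mu := (invariant_measure mu sigma).

Let phiC : Ctheta theta phi. Proof. by case: phi_renewal. Qed.
Let c := fine (holder_norm theta phi).
Let hphi : holder_fun theta c phi.
Proof. exact: holder_fun_Ctheta. Qed.
Let c_ge0 : 0 <= c. Proof. by rewrite fine_ge0 // holder_norm_ge0. Qed.

Let z0 := phi (zero_inf S).
Let delta := P - z0.
Let delta_gt0 : 0 < delta.
Proof. by rewrite subr_gt0; exact: (P_gt_zinf theta_gt0 theta_lt1 S_neq0 phi_renewal P_eq). Qed.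

Let p := gap_weight psi P.
Let B := c / (1 - theta).
Let B_ge0 : 0 <= B. Proof. by rewrite divr_ge0 // subr_ge0 ltW. Qed.

Let p_tail a : p a <= expR (2 * c + B) * expR (- delta * a.+1%:R).
Proof. exact: (gap_weight_tail theta_gt0 theta_lt1 S_neq0 phi_renewal). Qed.

Let p_sum : series p @ \oo --> (1 : R).
Proof. exact: gap_weight_sum. Qed.

(** The polynomial factor is absorbed into an arbitrarily small rate [e]. *)
Lemma pressure_second_order : exists C t0 : R, [/\ 0 <= C, 0 < t0 &
  forall f : X -> R, holder_fun theta 1 f ->
  forall eps, 0 < eps -> exists M, forall t, `|t| <= t0 ->
  forall e, 0 < e -> exists2 K', 0 < K' & forall n,
   partition_fun S (raw (fun x => phi x + t * f x)) n zinf <= K' *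
     expR (n%:R * (P + t * M + C * t ^+ 2 + `|t| * eps + e))].
Proof.
have k0 : 0 < delta / 2 by rewrite divr_gt0.
have tail a : p a <= expR (2 * c + B) * expR (- (2 * (delta / 2)) * a.+1%:R).
  by rewrite mulrCA divff // mulr1 p_tail.
have zP : raw phi zinf + 2 * (delta / 2) <= P.
  rewrite /raw to_shift_zinf -/z0 mulrCA divff // mulr1 /delta; lra.
have [C [t0 [C0 t00 HC]]] := @partition_fun_second_order R S theta theta_gt0 theta_lt1 p
  (delta / 2) (expR (2 * c + B)) P (gap_weight_ge0 psi P) (gap_weight_out psi P) p_sum k0 tail
  (raw phi) (correction phi psi 1) c B (raw_phi_le theta_gt0 phi_renewal)
  (holder_fun_raw hphi) zP
  (correction_le theta_gt0 theta_lt1 S_neq0 phi_renewal (normr1 R))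
  (correction_block theta_gt0 theta_lt1 S_neq0 phi_renewal P).
exists C, t0; split=> // f hf eps e0.
have [M HM] := HC (raw f) (fun x => proj1 hf _) (holder_fun_raw hf) eps e0.
exists M => t tt0 e ee0; have [K' K'0 HK] := HM t tt0.
have [K2 K20 HK2] := sqr_le_expR ee0.
exists (K' * K2) => [|n]; first exact: mulr_gt0.
apply: le_trans (HK n) _; set E := expR _.
have -> : expR (n%:R * (P + t * M + C * t ^+ 2 + `|t| * eps + e)) =
  E * expR (n%:R * e) by rewrite mulrDr expRD.
have -> : K' * K2 * (E * expR (n%:R * e)) = K' * (K2 * expR (n%:R * e)) * E by ring.
by rewrite ler_wpM2r ?expR_ge0 // ler_wpM2l // ltW.
Qed.

(** The entropy bound for the potential [phi + t f].  The slope [M] is the same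
    for all measures and for both signs of [t], which lets it cancel when two
    measures are compared. *)
Lemma free_energy_second_order : exists C t0 : R, [/\ 0 <= C, 0 < t0 &
  forall f : X -> R, holder_fun theta 1 f ->
  forall eps, 0 < eps -> exists M, forall t, `|t| <= t0 ->
  forall mu : probability X R, inv mu ->
   (entropy mu sigma <= (P - \int[mu]_x phi x + t * (M - \int[mu]_x f x)
      + C * t ^+ 2 + `|t| * eps)%:E)%E].
Proof.
have [C [t0 [C0 t00 HC]]] := pressure_second_order; exists C, t0; split=> //.
move=> f hf eps e0; have [M HM] := HC f hf eps e0; exists M => t tt0 mu mu_inv.
apply/lee_addgt0Pr => e ee0; have [K' K'0 HK] := HM t tt0 e ee0.
have hg := holder_fun_lin t hphi hf.
apply: le_trans (entropy_le theta_gt0 theta_lt1 mu_inv hg K'0 HK) _.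
have i1 := integrable_holder theta_gt0 theta_lt1 mu hphi.
have i2 := integrable_holder theta_gt0 theta_lt1 mu hf.
rewrite -EFinD lee_fin RintegralD // ?RintegralZl //; last first.
  by have := integrableZl measurableT t i2; apply: eq_integrable.
lra.
Qed.

Lemma free_energy_le (mu : probability X R) : inv mu ->
  (free_energy phi mu <= P%:E)%E.
Proof.
have [C [t0 [C0 t00 HC]]] := free_energy_second_order => mu_inv.
have h0 : holder_fun theta 1 (fun _ : X => 0 : R).
  by split=> *; rewrite ?subrr normr0 ?mul1r ?exprn_ge0 // ltW.
have [M HM] := HC _ h0 1 ltr01.
have := HM 0 _ mu mu_inv; rewrite normr0 => /(_ (ltW t00)).
rewrite mul0r addr0 expr0n /= mulr0 addr0 mul0r addr0 => h.
rewrite /free_energy; apply: le_trans (leeD2r _ h) _.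
by rewrite -EFinD subrK.
Qed.

Lemma ex_gibbs : exists mu : probability X R, inv mu /\ exists C, forall w x,
  adm (catw w x) -> fine (mu (cyl w)) <=
    C * expR (bsum (raw phi) (size w) (catw w x) - P * (size w)%:R).
Proof.
pose r := expR (- delta).
have r0 : 0 < r by exact: expR_gt0.
have r1 : r < 1 by rewrite -[ltRHS]expR0 ltr_expR oppr_lt0.
have rE n : r ^+ n = expR (- delta * n%:R) by rewrite -expRM_natr.
have p_le a : p a <= expR (2 * c + B) * r ^+ a.
  apply: le_trans (p_tail a) _; rewrite ler_wpM2l ?expR_ge0 // rE ler_expR.
  by rewrite -natr1 mulrDr mulr1 gerDl oppr_le0 ltW.
pose Phi x := raw phi x - P.
have PhiE n x : bsum Phi n x = bsum (raw phi) n x - P * n%:R.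
  by rewrite /Phi bsum_add bsum_cst mulNr.
have sgn1 : `|-1| = 1 :> R by rewrite normrN1.
pose cr := correction phi psi (-1).
have cr_le x : adm x -> x 0%N = true -> `|cr x| <= B.
  exact: (correction_le theta_gt0 theta_lt1 S_neq0 phi_renewal sgn1).
pose B1 := c + 2 * B + `|P|.
have zer k x : adm x -> k%:R * z0 - B <= bsum (raw phi) k (zeros k x).
  move=> xS; have ag : agree (k + 0) (zeros k x) zinf.
    by rewrite addn0; exact: agree_zeros_zinf.
  have := bsum_holder theta_gt0 theta_lt1 c_ge0 (holder_fun_raw hphi)
    (@adm_zeros S k x xS) (@adm_zinf S) ag.
  rewrite expr0 mulr1 ler_norml => /andP[h _].
  have e : bsum (raw phi) k zinf = k%:R * z0.
    rewrite /bsum (eq_bigr (fun=> z0)) ?sumr_const ?card_ord ?mulr_natl // => j _.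
    by rewrite /raw sshift_zinf to_shift_zinf.
  by rewrite e -/B in h; lra.
have P0 := ler_norm P; have P1 := normr_ge0 P.
have [||||mu [hmu [C hC]]] := @ex_renewal_measure S R p (expR (2 * c + B)) r
  (gap_weight_ge0 psi P) (gap_weight_out psi P) p_sum r0 r1 p_le Phi cr B1.
- move=> l x xS; rewrite rE ler_expR PhiE bsumS -[sshift 1 _]/(zeros l x).
  have := zer l x (@adm_block_tail S l x xS).
  have := cr_le _ xS erefl; have := raw_phi_le theta_gt0 phi_renewal (block l x).
  rewrite !ler_norml -/c => /andP[h1 h2] /andP[h3 h4] h5.
  rewrite -natr1 /B1 /delta; lra.
- move=> k x xS; rewrite rE ler_expR PhiE; have := zer k x xS.
  have := c_ge0; have := B_ge0; rewrite /B1 /delta; lra.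
- move=> l x xS x1; have Sl := adm_block_inv x1 xS.
  have := correction_step theta_gt0 theta_lt1 S_neq0 phi_renewal sgn1
    (@adm_block_tail S l x xS) x1 Sl.
  rewrite -/cr mulN1r /p gap_weight_in // ler_expR PhiE; lra.
- move=> x xS x1; have := cr_le _ xS x1; rewrite ler_norml => /andP[h _].
  have := c_ge0; have := B_ge0; rewrite /B1; lra.
exists mu; split; last first.
  by exists C => w x xS; have := hC w x xS; rewrite PhiE.
pose fs : {mfun X >-> X} := MeasurableFun.Pack (MeasurableFun.Class
  (isMeasurableFun.Build _ _ _ _ sigma (@measurable_gap_sigma S))).
apply: (measure_cyl_unique (m1 := distribution mu fs) (m2 := mu)).
  by rewrite -ge0_fin_numE // fin_num_measure.
move=> w; rewrite -[LHS]/(mu (sigma @^-1` cyl w)) preimage_sigma_cyl.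
rewrite measureU //; [exact: hmu|exact: measurable_cyl..|].
apply/seteqP; split=> // x []; rewrite /cyl /= !prefix_sigma => -[+ _] [].
by move=> ->.
Qed.

(** The free energy of a measure with the upper Gibbs inequality is at least
    [P]; with the opposite inequality for all measures, [P] is the supremum. *)
Lemma free_energy_gibbs (mu : probability X R) (C : R) : inv mu ->
  (forall w x, adm (catw w x) -> fine (mu (cyl w)) <=
    C * expR (bsum (raw phi) (size w) (catw w x) - P * (size w)%:R)) ->
  free_energy phi mu = P%:E.
Proof.
move=> mu_inv gibbs; apply/eqP; rewrite eq_le free_energy_le //=.
have h := entropy_ge theta_gt0 theta_lt1 mu_inv hphi gibbs.
rewrite /free_energy; apply: le_trans (leeD2r _ h).
by rewrite -EFinD subrK.
Qed.

(** The masses of the cylinders add up to 1. *)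
Lemma partition_fun_ge (mu : probability X R) (C : R) :
  (forall w x, adm (catw w x) -> fine (mu (cyl w)) <=
    C * expR (bsum (raw phi) (size w) (catw w x) - P * (size w)%:R)) ->
  exists2 c' : R, 0 < c' & forall n, c' * expR (n%:R * P) <= partition_fun S (raw phi) n zinf.
Proof.
move=> gibbs; have C0 : 0 < C.
  have /= := @gibbs [::] zinf (@adm_zinf S).
  rewrite cyl_nil bsum0 probability_setT mulr0 subr0 expR0 mulr1.
  exact: lt_le_trans.
exists C^-1 => [|n]; first by rewrite invr_gt0.
rewrite ler_pdivrMl //.
have fib w : measurable (prefix_of n @^-1` [set w] : set X).
  rewrite (_ : _ @^-1` _ = [set x | pred1 w (prefix_of n x)]); first exact: measurable_word.
  by apply/seteqP; split=> x /= /eqP.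
have := Rintegral_label mu (uniq_words n) (fun x : X => mkseq_words (gap_seq x) n)
  fib (fun=> 1).
rewrite Rintegral1 => e1.
have h : 1 <= C * partition_fun S (raw phi) n zinf * expR (- (P * n%:R)).
  rewrite [leLHS]e1 /partition_fun [in leRHS]big_mkcond mulr_sumr mulr_suml.
  rewrite big_seq_cond [leRHS]big_seq_cond; apply: ler_sum => w.
  rewrite andbT mem_words => /eqP wn; rewrite mul1r.
  have -> : (prefix_of n @^-1` [set w] : set X) = cyl w by rewrite /cyl wn.
  case: asboolP => wS; first by rewrite -mulrA -expRD -wn gibbs.
  rewrite (_ : cyl w = set0) ?measure0 ?mulr0 ?mul0r //.
  apply/seteqP; split=> // x xw; apply: wS; rewrite -xw.
  exact: (@adm_catw_zinf S (gap_seq x) (size w) (@gap_seqP S x)).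
have : expR (n%:R * P) * 1 <= expR (n%:R * P) *
    (C * partition_fun S (raw phi) n zinf * expR (- (P * n%:R))).
  by rewrite ler_wpM2l // expR_ge0.
rewrite mulr1 mulrCA -expRD [n%:R * P]mulrC subrr expR0 mulr1; exact.
Qed.

Lemma pressureE :
  topological_pressure (dtheta theta) (@gap_sigma S) phi = P%:E.
Proof.
have [mu [mu_inv [C gibbs]]] := ex_gibbs.
apply: (topological_pressureE theta_gt0 theta_lt1 hphi); last exact: partition_fun_ge gibbs.
have [C1 [t0 [C10 t00 HC]]] := pressure_second_order => eps e0.
have h0 : holder_fun theta 1 (fun _ : X => 0 : R).
  by split=> *; rewrite ?subrr normr0 ?mul1r ?exprn_ge0 // ltW.
have [M HM] := HC _ h0 1 ltr01.
have [|K K0 HK] := HM 0 _ eps e0; first by rewrite normr0 ltW.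
exists K => // n; have := HK n.
have -> : P + 0 * M + C1 * 0 ^+ 2 + `|0 : R| * 1 + eps = P + eps.
  by rewrite normr0; ring.
have -> : (fun x => phi x + 0 * 0) = phi by apply/funext => x; rewrite mulr0 addr0.
by [].
Qed.

(** Both measures obey the second-order bound with the same slope [M], so [M]
    cancels; then [sqrt_bound] turns the bounds for all small [t] into a square
    root. *)
Lemma stability : exists2 C : R, 0 < C & forall mu0 mu : probability X R,
  inv mu0 -> free_energy phi mu0 = P%:E -> inv mu ->
  forall (N : R) (f : X -> R), 0 < N -> holder_fun theta N f ->
  forall d : R, free_energy phi mu = (P - d)%:E ->
  `|\int[mu]_x f x - \int[mu0]_x f x| <= C * N * Num.sqrt d.
Proof.
have [C [t0 [C0 t00 HC]]] := free_energy_second_order.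
have Cs0 : 0 < 1 + 2 * C + 2 / t0.
  by rewrite ltr_pwDl ?divr_ge0 ?(ltW t00) // ltr_pwDl // mulr_ge0.
exists (1 + 2 * C + 2 / t0) => // mu0 mu inv0 fe0 mu_inv.
have one f : holder_fun theta 1 f -> forall d, free_energy phi mu = (P - d)%:E ->
    `|\int[mu]_x f x - \int[mu0]_x f x| <= (1 + 2 * C + 2 / t0) * Num.sqrt d.
  move=> hf d fe; have i1 := integrable_holder theta_gt0 theta_lt1 mu hf.
  have i0 := integrable_holder theta_gt0 theta_lt1 mu0 hf.
  have le1 (m : probability X R) : m.-integrable setT (EFin \o f) ->
      `|\int[m]_x f x| <= 1.
    move=> im; rewrite ler_norml; case: hf => f1 _.
    have ic k : m.-integrable setT (EFin \o (fun=> k)) by exact: integrable_cstR.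
    have cstE k : \int[m]_x k = k :> R.
      by rewrite Rintegral_cst // -[fine _]mul1r -(@Rintegral_cst _ _ _ m) // Rintegral1 mulr1.
    apply/andP; split.
      rewrite -[leLHS]cstE; apply: le_Rintegral => // x _.
      by have := f1 x; rewrite ler_norml => /andP[].
    rewrite -[leRHS]cstE; apply: le_Rintegral => // x _.
    by have := f1 x; rewrite ler_norml => /andP[].
  have d0 : 0 <= d.
    have := free_energy_le mu_inv; rewrite fe lee_fin; lra.
  apply: sqrt_bound => //.
  - by rewrite mulr_ge0.
  - rewrite normr_ge0 /=; apply: le_trans (ler_normB _ _) _.
    by have := le1 _ i1; have := le1 _ i0; lra.
  move=> t /andP[tt0 tt1]; apply/ler_addgt0Pr => e e0.
  have eps0 : 0 < e / (2 * (t0 + 1)).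
    by rewrite divr_gt0 // mulr_gt0 // ltr_wpDl // ltW.
  have [M HM] := HC f hf _ eps0; set eps := e / _ in HM eps0.
  have ent (m : probability X R) (k : R) : free_energy phi m = k%:E ->
      entropy m sigma = (k - \int[m]_x phi x)%:E.
    rewrite /free_energy; case: (entropy m sigma) => [r||] //= [<-].
    by rewrite addrK.
  have teps : 2 * (t * eps) <= e.
    have : t * eps <= (t0 + 1) * eps by rewrite ler_wpM2r ?(ltW eps0) //; lra.
    have -> : (t0 + 1) * eps = e / 2.
      by rewrite /eps; field; rewrite gt_eqF // ltr_wpDl // ltW.
    lra.
  have bound s : `|s| = t ->
      s * (\int[mu]_x f x - \int[mu0]_x f x) <= d + 2 * C * t ^+ 2 + e.
    move=> st; have s2 : s ^+ 2 = t ^+ 2 by rewrite -st real_normK ?num_real.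
    have := HM s _ mu mu_inv; rewrite st (ent _ _ fe) => /(_ tt1).
    have := HM (- s) _ mu0 inv0; rewrite normrN st (ent _ _ fe0) => /(_ tt1).
    rewrite !lee_fin sqrrN s2; lra.
  have [D0|D0] := lerP 0 (\int[mu]_x f x - \int[mu0]_x f x).
    by rewrite ger0_norm // bound // ger0_norm.
  by rewrite ltr0_norm // mulrN -mulNr bound // normrN ger0_norm.
move=> N f N0 hf d fe.
have hfN : holder_fun theta 1 (fun x => N^-1 * f x).
  case: hf => f1 f2; have Ni : 0 <= N^-1 by rewrite invr_ge0 ltW.
  split=> [x|n x y xy].
    by rewrite normrM (ger0_norm Ni) ler_pdivrMl // mulr1.
  rewrite -mulrBr normrM (ger0_norm Ni) ler_pdivrMl // mul1r.
  exact: f2.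
have := one _ hfN d fe.
have i1 := integrable_holder theta_gt0 theta_lt1 mu hf.
have i0 := integrable_holder theta_gt0 theta_lt1 mu0 hf.
rewrite !RintegralZl // -mulrBr normrM ger0_norm ?invr_ge0 ?(ltW N0) //.
by rewrite ler_pdivrMl // mulrCA mulrA.
Qed.

(** This lets the stability estimate identify measures on cylinders. *)
Lemma holder_fun_cyl w : holder_fun theta (theta^-1 ^+ size w) (\1_(cyl w) : X -> R).
Proof.
have t1 : 1 <= theta^-1 by rewrite invf_ge1 // ltW.
split=> [x|n x y xy].
  rewrite indicE; case: (_ \in _); rewrite ?normr1 ?normr0 ?exprn_ege1 //.
  by rewrite exprn_ge0 // (le_trans ler01).
have [nw|wn] := ltnP n (size w).
  apply: (@le_trans _ _ 1).
    by rewrite !indicE; do 2 case: (_ \in _); rewrite ?subrr ?subr0 ?sub0r ?normrN ?normr1 ?normr0.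
  rewrite exprVn mulrC ler_pdivlMr ?exprn_gt0 // mul1r.
  by rewrite ler_wiXn2l ?(ltW theta_gt0) ?(ltW theta_lt1) // ltnW.
have -> : \1_(cyl w) x = \1_(cyl w) y :> R.
  have e : prefix_of (size w) x = prefix_of (size w) y.
    by apply/agree_mkseq; exact: agree_le wn xy.
  by rewrite !indicE; congr (nat_of_bool _)%:R; apply/idP/idP; rewrite !inE /cyl /= e.
rewrite subrr normr0 mulr_ge0 ?exprn_ge0 ?(ltW theta_gt0) //.
exact: le_trans ler01 t1.
Qed.

End main.

Theorem theorem1p1 (R : realType) (S : set nat) (S_neq0 : S !=set0)
    (theta : R) (theta_gt0 : 0 < theta) (theta_lt1 : theta < 1)
    (phi : gap_shift S -> R) (psi : S -> R)
    (phi_renewal : renewal_type theta phi psi)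
    (P : R)
    (P_eq : \esum_(n in [set: S])
              (expR (psi n - P * (set_val n).+1%:R))%:E = 1%E)
    (P_gt : finite_set S -> phi (zero_inf S) < P) :
  P%:E = topological_pressure (dtheta theta) (@gap_sigma S) phi /\
  exists mu_phi : probability (borel_gap_shift S) R,
    [/\ equilibrium_state phi mu_phi,
        (forall nu : probability (borel_gap_shift S) R,
           equilibrium_state phi nu ->
           forall A : set (borel_gap_shift S), measurable A ->
             nu A = mu_phi A)
      & exists2 C : R, 0 < C &
          forall mu : probability (borel_gap_shift S) R,
            invariant_measure mu (@gap_sigma S) ->
            forall f : gap_shift S -> R, Ctheta theta f ->
              (`|\int[mu]_x f x - \int[mu_phi]_x f x|%:E
                 <= C%:E * holder_norm theta f
                      * sqrte (P%:E - free_energy phi mu))%E].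
Proof.
split.
  by rewrite (pressureE theta_gt0 theta_lt1 S_neq0 phi_renewal P_eq P_gt).
have [mu0 [inv0 [C0 gibbs]]] :=
  ex_gibbs theta_gt0 theta_lt1 S_neq0 phi_renewal P_eq P_gt.
have fe0 := free_energy_gibbs theta_gt0 theta_lt1 S_neq0 phi_renewal P_eq P_gt
  inv0 gibbs.
have fe_le := free_energy_le theta_gt0 theta_lt1 S_neq0 phi_renewal P_eq P_gt.
have [C C_gt0 HC] := stability theta_gt0 theta_lt1 S_neq0 phi_renewal P_eq P_gt.
have eq0 : equilibrium_state phi mu0.
  split=> //; rewrite fe0; apply/eqP; rewrite eq_le; apply/andP; split.
    by apply: ereal_sup_ubound; exists mu0.
  by apply: ge_ereal_sup => _ [nu inu <-]; exact: fe_le.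
exists mu0; split=> //.
  move=> nu [inu fenu] A mA; apply: measure_cyl_unique mA => [|w].
    by rewrite -ge0_fin_numE // fin_num_measure.
  have fe : free_energy phi nu = (P - 0)%:E.
    by rewrite fenu subr0 -fe0; case: eq0 => _ ->.
  have hw := holder_fun_cyl S theta_gt0 theta_lt1 w.
  have N0 : 0 < theta^-1 ^+ size w by rewrite exprn_gt0 // invr_gt0.
  have := HC mu0 nu inv0 fe0 inu _ _ N0 hw 0 fe.
  rewrite sqrtr0 mulr0 normr_le0 subr_eq0 => /eqP.
  rewrite !Rintegral_indic; [|exact: measurable_cyl..].
  move=> h; rewrite -[LHS]fineK ?fin_num_measure //; last exact: measurable_cyl.
  rewrite -[RHS]fineK ?fin_num_measure ?h //; exact: measurable_cyl.
exists C => // mu mu_inv f fC.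
have hf := holder_fun_Ctheta theta_gt0 theta_lt1 fC.
have hN := holder_norm_ge0 theta_gt0 f.
rewrite -(fineK (Ctheta_fin theta_gt0 fC)); set N := fine _ in hf *.
have N0 : 0 <= N by rewrite fine_ge0.
move: N0; rewrite le_eqVlt => /predU1P[N0|N0].
  have f0 x : f x = 0.
    by apply/eqP; rewrite -normr_le0 N0; case: hf.
  have z (m : probability (borel_gap_shift S) R) : \int[m]_x f x = 0 :> R.
    rewrite (@eq_Rintegral _ _ _ _ _ (fun=> 0)) => [|x _]; last exact: f0.
    by rewrite Rintegral_cst // mul0r.
  by rewrite !z subrr normr0 -N0 mule0 mul0e.
have := fe_le mu mu_inv; case efe : (free_energy phi mu) => [r||] // hr.
  have fe : free_energy phi mu = (P - (P - r))%:E by rewrite efe subKr.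
  have := HC mu0 mu inv0 fe0 mu_inv N f N0 hf (P - r) fe.
  by rewrite -EFinB /= -!EFinM lee_fin.
rewrite /= -EFinM mulry gtr0_sg ?mulr_gt0 // mul1e leey //.
Qed.
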